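(* Assume the proportional covariance model $\Sigma_k=c_k\Sigma_1$ ($1\le k\le K$, $c_1=1$, $K\ge2$), and let $\hat c_2,\dots,\hat c_K$ be the maximum likelihood estimators of $c_2,\dots,c_K$, with $\hat c_1\equiv1$. Let $\hat U_{11}$ be the $(K-1)\times(K-1)$ matrix $$\hat U_{11}=\frac p2\left\{\mathrm{diag}\left(\frac{r_2}{\hat c_2^2},\dots,\frac{r_K}{\hat c_K^2}\right)-\hat\alpha\hat\alpha^T\right\},\qquad \hat\alpha=\left(\frac{r_2}{\hat c_2},\dots,\frac{r_K}{\hat c_K}\right)^T.$$ Then the statistic $$n_+(\hat c_2-1,\dots,\hat c_K-1)\,\hat U_{11}\,(\hat c_2-1,\dots,\hat c_K-1)^T$$ is equal to $$\frac{n_+p}{2}\left[\sum_{k=1}^K\frac{r_k}{\hat c_k^2}-\left(\sum_{k=1}^K\frac{r_k}{\hat c_k}\right)^2\right],$$ and under the hypothesis $H_0:c_2=\dots=c_K=1$ its asymptotic distribution, as $n_+$ tends to infinity with each $r_k=n_k/n_+$ held fixed, is a chi-squared distribution with $K-1$ degrees of freedom.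
   Context: Setting: $p\ge1$, $K\ge2$ are integers. $S_1,\dots,S_K$ are mutually independent random $p\times p$ matrices, $S_k$ being the unbiased sample covariance matrix of a sample of size $N_k$ from $N_p(\mu_k,\Sigma_k)$, so that $n_kS_k$ has the Wishart distribution $W_p(\Sigma_k,n_k)$ with $n_k=N_k-1$; the $\Sigma_k$ are positive definite. $n_+=\sum_{k=1}^Kn_k$, $r_k=n_k/n_+$. The proportional covariance model is $\Sigma_k=c_k\Sigma_1$ with unknown $c_k>0$ ($k\ge2$) and $c_1=1$. The maximum likelihood estimators maximize, over the parameters $c_2,\dots,c_K,\Sigma_1$ of this model, the likelihood $\prod_{k=1}^K|\Sigma_k|^{-n_k/2}\exp\{-\frac{n_k}{2}\mathrm{tr}(\Sigma_k^{-1}S_k)\}$ (given $S_1,\dots,S_K$). *)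

(* Defs.v *)
From HB Require Import structures.
From mathcomp Require Import all_boot all_order all_algebra.
From mathcomp Require Import all_classical all_reals all_analysis.
From mathcomp Require Import measurable_realfun.

Set Implicit Arguments.
Unset Strict Implicit.
Unset Printing Implicit Defensive.

Import Order.TTheory GRing.Theory Num.Theory.
Import numFieldNormedType.Exports.

Local Open Scope classical_set_scope.
Local Open Scope ring_scope.

(* For a finite family, letting some of the [B i] be [setT] gives the product
   rule for every subfamily. *)
Definition mutually_independent (R : realType) d (T : measurableType d)
    (P : probability T R) (I : finType) d' (T' : measurableType d')
    (X : I -> T -> T') : Prop :=
  forall B : I -> set T', (forall i, measurable (B i)) ->
    P [set w | forall i, B i (X i w)] = (\prod_(i : I) P (X i @^-1` B i))%E.

Definition standard_normal_vector (R : realType) d (T : measurableType d)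
    (P : probability T R) (p : nat) (Z : 'I_p -> {RV P >-> R}) : Prop :=
  mutually_independent P (fun i => Z i : T -> R) /\
  forall i (B : set R), measurable B ->
    distribution P (Z i) B = normal_prob 0 1 B.

Definition col_of_tuple (R : realType) (p : nat) (x : p.-tuple R) : 'cV[R]_p :=
  \col_i tnth x i.

(* [X] is distributed as N_p(mu, Sigma): an affine image [mu + A Z] of a
   standard normal vector [Z], with covariance matrix [A A^T = Sigma].  When
   [Sigma] is positive definite, [A] is invertible, so that having [Z] on the
   same probability space as [X] is no restriction. *)
Definition multivariate_normal (R : realType) d (T : measurableType d)
    (P : probability T R) (p : nat) (mu : 'cV[R]_p) (Sigma : 'M[R]_p)
    (X : {RV P >-> p.-tuple R}) : Prop :=
  exists (A : 'M[R]_p) (Z : 'I_p -> {RV P >-> R}),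
    [/\ A *m A^T = Sigma, standard_normal_vector Z &
        forall w, col_of_tuple (X w) = mu + A *m (\col_i Z i w)].

Definition posdefmx (R : realType) (p : nat) (A : 'M[R]_p) : Prop :=
  A^T = A /\ forall v : 'cV[R]_p, v != 0 -> 0 < (v^T *m A *m v) 0 0.

Section sample_covariance.
Context (R : realType) (p N : nat) (x : 'I_N -> 'cV[R]_p).

Definition sample_mean : 'cV[R]_p := N%:R^-1 *: \sum_i x i.

Definition sample_cov : 'M[R]_p :=
  N.-1%:R^-1 *: \sum_i (x i - sample_mean) *m (x i - sample_mean)^T.

End sample_covariance.

(* There are [K = q.+1] populations.  Population 1 is the index [ord0], and
   population [j + 2] is [lift ord0 j] with [j : 'I_q]. *)

(* (c_2, ..., c_K) completed with c_1 = 1. *)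
Definition with_c1 (R : realType) (q : nat) (c : 'cV[R]_q) (k : 'I_q.+1) : R :=
  if unlift ord0 k is Some j then c j 0 else 1.

Definition nplus (q : nat) (n : 'I_q.+1 -> nat) : nat := (\sum_k n k)%N.

Section maximum_likelihood.
Context (R : realType) (p q : nat) (n : 'I_q.+1 -> nat) (S : 'I_q.+1 -> 'M[R]_p).

Definition likelihood (Sigma : 'I_q.+1 -> 'M[R]_p) : R :=
  \prod_k ((\det (Sigma k)) `^ (- ((n k)%:R / 2)) *
           expR (- ((n k)%:R / 2) * \tr (invmx (Sigma k) *m S k))).

Definition prop_cov (c : 'cV[R]_q) (Sigma1 : 'M[R]_p) (k : 'I_q.+1) : 'M[R]_p :=
  with_c1 c k *: Sigma1.

Definition prop_param (c : 'cV[R]_q) (Sigma1 : 'M[R]_p) : Prop :=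
  (forall j, 0 < c j 0) /\ posdefmx Sigma1.

Definition is_mle (c : 'cV[R]_q) (Sigma1 : 'M[R]_p) : Prop :=
  prop_param c Sigma1 /\
  forall c' Sigma1', prop_param c' Sigma1' ->
    likelihood (prop_cov c' Sigma1') <= likelihood (prop_cov c Sigma1).

Definition is_mle_c (c : 'cV[R]_q) : Prop := exists Sigma1, is_mle c Sigma1.

End maximum_likelihood.

Section wald_statistic.
Context (R : realType) (p q : nat) (r : 'I_q.+1 -> R).

Definition alpha (c : 'cV[R]_q) : 'cV[R]_q := \col_j (r (lift ord0 j) / c j 0).

Definition U11 (c : 'cV[R]_q) : 'M[R]_q :=
  (p%:R / 2) *: (diag_mx (\row_j (r (lift ord0 j) / c j 0 ^+ 2))
                 - alpha c *m (alpha c)^T).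

Definition statistic (N : nat) (c : 'cV[R]_q) : R :=
  N%:R * ((c - const_mx 1)^T *m U11 c *m (c - const_mx 1)) 0 0.

End wald_statistic.

Section chi_squared.
Context (R : realType).
Local Notation RB := (measurableTypeR R).

Definition add_sqr (z : RB * RB) : RB := z.1 + z.2 ^+ 2.

Let measurable_add_sqr : measurable_fun [set: RB * RB] add_sqr.
Proof.
apply: measurable_funD; first exact: measurable_fst.
apply: measurable_funX; exact: measurable_snd.
Qed.

HB.instance Definition _ :=
  isMeasurableFun.Build _ _ _ _ add_sqr measurable_add_sqr.

(* The law of Z_1^2 + ... + Z_d^2 for independent standard normal variables:
   Z_(d+1)^2 is added on the product of the law of the first d terms with
   N(0, 1). *)
Fixpoint chi_squared (d : nat) : probability RB R :=
  if d is d'.+1 then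
    distribution (chi_squared d' \x normal_prob (0 : R) 1)%E add_sqr
  else \d_(0 : RB).

End chi_squared.

Definition cvg_in_distribution (R : realType) (d : nat -> measure_display)
    (T : forall m, measurableType (d m)) (P : forall m, probability (T m) R)
    (Y : forall m, T m -> R) (Q : probability (measurableTypeR R) R) : Prop :=
  forall x : R, {for x, continuous (fun t : R => Q `]-oo, t]%classic)} ->
    P m [set w | Y m w <= x] @[m --> \oo] --> Q `]-oo, x]%classic.

(* Main.v *)
(** The statistic is n_+ p / 2 times the variance of the 1 / c_k under the weights r_k: this
    gives the first part, and reduces the second one to the fluctuations of the c_k.

    Write Sigma1 = A A^T and y = A^-1 (x - mu), so that the y are standard normal vectors.
    Comparing likelihoods shows that Stein's loss of A^T Sigma^-1 A is O(n_+^(-1/2)) at the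
    maximum, and the first-order condition c_k = tr (Sigma^-1 S_k) / p then yields
    1 - 1 / c_k = (tr S'_k - tr S'_1) / p + O(n_+^(-3/4)), where S'_k is the whitened S_k.
    Hence the statistic is, up to o(1) in probability, the quadratic form
    |Y|^2 - (sum_k sqrt r_k Y_k)^2 in the centred and normalized sums Y_k of the |y|^2.

    The Laplace transform of this quadratic form is linearized by a Gaussian integral
    (Hubbard-Stratonovich), which leaves products of functions exp (- b Y_k^2 + a Y_k); their
    expectations converge by Lindeberg's replacement argument, in which the heat semigroup
    applied to such a function is explicit.  The limit (1 + 2 lam)^(-(K - 1) / 2) is the
    Laplace transform of the chi-squared law, and Laplace transforms determine convergence of
    distribution functions because indicators of intervals are approximated by polynomials in
    an exponential. *)

Require Import Defs.
From HB Require Import structures.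
From mathcomp Require Import all_boot all_order all_algebra.
From mathcomp Require Import all_classical all_reals all_analysis.
From mathcomp Require Import measurable_realfun.
From mathcomp Require Import ring lra.

Set Implicit Arguments.
Unset Strict Implicit.
Unset Printing Implicit Defensive.

Import Order.TTheory GRing.Theory Num.Theory.
Import numFieldNormedType.Exports.

Local Open Scope classical_set_scope.
Local Open Scope ring_scope.

(** * Expectation and independence *)

(** The estimators have no closed form; all that is known of them comes from the value of the
    likelihood and from stationarity. A crude rate is enough. The comparison of likelihoods bounds
    the entries of [A^T Sigma^-1 A - 1] only by O(n_+^(-1/4)), but in the expansion of c_k they
    occur multiplied by the O(n_+^(-1/2)) errors of the sample covariances: the unknown trace of
    [A^T Sigma^-1 A] cancels against the equation of population 1, where c_1 = 1. These estimates
    are deterministic on an event where finitely many normalized sums are bounded by B. Its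
    complement has probability O(B^-2) uniformly in the stage, so B is fixed before n_+ grows. The
    quadratic form is degenerate in the direction (sqrt r_k). After linearization the natural
    envelope of the integrand is then exp (h^2 / 2), which just fails to be integrable against the
    normal law of h. A penalty eps |Y|^2 repairs this, and eps tends to 0 only after n_+ has gone to
    infinity. The degenerate direction is also what turns K into K - 1. *)

Section expect.
Context (R : realType) d (T : measurableType d) (P : probability T R).
Implicit Types f g h : T -> R.

Definition integ f := P.-integrable setT (EFin \o f).
Definition EE f : R := \int[P]_x f x.

Lemma integ_measurable f : integ f -> measurable_fun setT f.
Proof. by move=> /measurable_int/measurable_EFinP. Qed.

Lemma integ_cst (k : R) : integ (fun=> k).
Proof. exact: (finite_measure_integrable_cst P k measurableT). Qed.

Lemma integD f g : integ f -> integ g -> integ (fun x => f x + g x).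
Proof. by move=> fi gi; apply: (integrableD measurableT fi gi). Qed.

Lemma integZ (k : R) f : integ f -> integ (fun x => k * f x).
Proof. by move=> fi; apply: (integrableZl measurableT k fi). Qed.

Lemma integB f g : integ f -> integ g -> integ (fun x => f x - g x).
Proof. by move=> fi gi; apply: (integrableB measurableT fi gi). Qed.

Lemma integ_sum (I : Type) (s : seq I) (Q : pred I) (F : I -> T -> R) :
  (forall i, Q i -> integ (F i)) -> integ (fun x => \sum_(i <- s | Q i) F i x).
Proof.
move=> Fi; have := integrable_sum (mu := P) measurableT s Fi.
by apply: eq_integrable => // x _ /=; rewrite sumEFin.
Qed.

Lemma integ_le f g : measurable_fun setT f -> (forall x, `|f x| <= g x) ->
  integ g -> integ f.
Proof.
move=> mf fg gi; apply: (le_integrable measurableT _ _ gi) => /=.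
  exact/measurable_EFinP.
by move=> x _; rewrite lee_fin (le_trans (fg x))// ler_norm.
Qed.

Lemma integ_bounded f (k : R) : measurable_fun setT f -> (forall x, `|f x| <= k) ->
  integ f.
Proof. by move=> mf fk; exact: (integ_le mf fk (integ_cst k)). Qed.

Lemma integM_bounded f g (k : R) : measurable_fun setT f ->
  (forall x, `|f x| <= k) -> integ g -> integ (fun x => f x * g x).
Proof.
move=> mf fk gi.
apply: (@integ_le _ (fun x => k * `|g x|)).
- by apply: measurable_funM => //; exact: integ_measurable.
- by move=> x; rewrite normrM ler_wpM2r.
- by apply: integZ; exact: integrable_norm.
Qed.

Lemma EE_cst (k : R) : EE (fun=> k) = k.
Proof. rewrite /EE Rintegral_cst//=.
by rewrite [X in fine X](@probability_setT _ _ _ P) mulr1. Qed.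

Lemma EED f g : integ f -> integ g -> EE (fun x => f x + g x) = EE f + EE g.
Proof. by move=> fi gi; rewrite /EE RintegralD. Qed.

Lemma EEB f g : integ f -> integ g -> EE (fun x => f x - g x) = EE f - EE g.
Proof. by move=> fi gi; rewrite /EE RintegralB. Qed.

Lemma EEZ (k : R) f : integ f -> EE (fun x => k * f x) = k * EE f.
Proof. by move=> fi; rewrite /EE RintegralZl. Qed.

Lemma EE_sum (I : Type) (s : seq I) (F : I -> T -> R) :
  (forall i, integ (F i)) ->
  EE (fun x => \sum_(i <- s) F i x) = \sum_(i <- s) EE (F i).
Proof.
move=> Fi; elim: s => [|a s IHs].
  rewrite big_nil -[RHS](EE_cst 0); congr EE.
  by apply/funext => x; rewrite big_nil.
rewrite big_cons -IHs -EED//; last exact: integ_sum.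
by congr EE; apply/funext => x; rewrite big_cons.
Qed.

Lemma EE_le f g : integ f -> integ g -> (forall x, f x <= g x) -> EE f <= EE g.
Proof. by move=> fi gi fg; apply: le_Rintegral. Qed.

Lemma EE_ge0 f : (forall x, 0 <= f x) -> 0 <= EE f.
Proof. by move=> f0; apply: Rintegral_ge0. Qed.

Lemma EE_norm_le f g : integ f -> integ g -> (forall x, `|f x| <= g x) ->
  `|EE f| <= EE g.
Proof.
move=> fi gi fg; apply: (le_trans (le_normr_Rintegral measurableT fi)).
by apply: le_Rintegral => //; exact: integrable_norm.
Qed.

Lemma EE_norm_bounded f (k : R) : measurable_fun setT f ->
  (forall x, `|f x| <= k) -> `|EE f| <= k.
Proof.
move=> mf fk; rewrite -[leRHS]EE_cst; apply: EE_norm_le => //.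
- exact: integ_bounded fk.
- exact: integ_cst.
Qed.

Lemma EE_EFin f : integ f -> (EE f)%:E = (\int[P]_x (f x)%:E)%E.
Proof. by move=> fi; rewrite /EE /Rintegral fineK//; exact: integrable_fin_num. Qed.

Lemma EE_indic (A : set T) : measurable A -> EE (\1_A) = fine (P A).
Proof. by move=> mA; rewrite /EE /Rintegral integral_indic// setIT. Qed.

Lemma integ_indic (A : set T) : measurable A -> integ (\1_A).
Proof. by move=> mA; apply: integrable_indic. Qed.

Lemma ae_eq_EE f g : measurable_fun setT f -> measurable_fun setT g ->
  {ae P, forall x, f x = g x} -> EE f = EE g.
Proof.
move=> mf mg fg; rewrite /EE /Rintegral; congr fine.
apply: ae_eq_integral => //; [exact/measurable_EFinP|exact/measurable_EFinP|].
by apply: filterS fg => x /= -> _.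
Qed.

End expect.

Section event_independence.
Context (R : realType) d (T : measurableType d) (P : probability T R).
Local Notation RB := R.
Variables (f g : T -> R).
Hypotheses (mf : measurable_fun setT f) (mg : measurable_fun setT g).
Hypothesis fg_indep : forall A B : set R, measurable A -> measurable B ->
  P ((f @^-1` A) `&` (g @^-1` B)) = (P (f @^-1` A) * P (g @^-1` B))%E.

Let f' : {mfun T >-> RB} := HB.pack f (isMeasurableFun.Build _ _ _ _ _ mf).
Let g' : {mfun T >-> RB} := HB.pack g (isMeasurableFun.Build _ _ _ _ _ mg).

Let mfg : measurable_fun setT (fun x => (f x, g x) : RB * RB).
Proof. exact: measurable_fun_pair. Qed.

Let fg' : {mfun T >-> (RB * RB)%type} :=
  HB.pack (fun x => (f x, g x) : RB * RB) (isMeasurableFun.Build _ _ _ _ _ mfg).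

(** The law of the pair and the product of the two laws agree on rectangles, hence are equal; Fubini
    then factors the integral of [z.1 * z.2]. *)
Lemma EEM_indep : integ P f -> integ P g -> integ P (fun x => f x * g x) ->
  EE P (fun x => f x * g x) = EE P f * EE P g.
Proof.
move=> fi gi fgi.
pose F (z : RB * RB) : \bar R := (z.1 * z.2)%:E.
have mF : measurable_fun setT F.
  by apply/measurable_EFinP; apply: measurable_funM;
    [exact: measurable_fst|exact: measurable_snd].
have E1 X : measurable X ->
    (distribution P f' \x distribution P g')%E X = distribution P fg' X.
  by apply: product_measure_unique => A B mA mB; exact: fg_indep.
have E2 : (\int[distribution P f' \x distribution P g']_z F z =
    \int[distribution P fg']_z F z)%E.
  by apply: eq_measure_integral => A mA _; exact: E1.
have Fi : (distribution P f' \x distribution P g')%E.-integrable setT F.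
  have : (distribution P fg').-integrable setT F.
    exact: (integrable_pushforward mfg mF).
  move=> /integrableP[_ Fy]; apply/integrableP; split => //.
  apply: le_lt_trans Fy; rewrite le_eqVlt; apply/orP; left; apply/eqP.
  by apply: eq_measure_integral => A mA _; exact: E1.
apply: EFin_inj; rewrite EFinM !EE_EFin//.
transitivity (\int[distribution P fg']_z F z)%E.
  by rewrite integral_distribution.
rewrite -E2 -(integral12_prod_meas1 Fi) /=.
have mid : measurable_fun [set: RB] (EFin : RB -> \bar R).
  by apply/measurable_EFinP; exact: measurable_id.
have gi' : (distribution P g').-integrable setT (EFin : RB -> \bar R).
  exact: (integrable_pushforward mg mid).
have fi' : (distribution P f').-integrable setT (EFin : RB -> \bar R).
  exact: (integrable_pushforward mf mid).
have -> : (\int[P]_x (f x)%:E = \int[distribution P f']_x x%:E)%E.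
  by rewrite integral_distribution.
have gE : (\int[P]_x (g x)%:E = \int[distribution P g']_x x%:E)%E.
  by rewrite integral_distribution.
transitivity (\int[distribution P f']_x (x%:E * \int[P]_x (g x)%:E))%E.
  apply: eq_integral => x _; rewrite /fubini_F /F /= gE.
  by under eq_integral do rewrite EFinM; rewrite integralZl.
by rewrite -(EE_EFin gi) -integralZr.
Qed.

End event_independence.

(** * Sigma-algebras generated by subfamilies of independent variables *)

Section past.
Context (R : realType) d (T : measurableType d) (P : probability T R).
Context (I : finType) d' (T' : measurableType d') (X : I -> T -> T').
Hypothesis mX : forall i, measurable_fun setT (X i).
Hypothesis indepX : mutually_independent P X.

(** A pi-system, since intersections are taken coordinate by coordinate; it generates the
    sigma-algebra of the variables with index in [A]. *)
Definition cylinder (A : {set I}) : set (set T) :=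
  [set F | exists B : I -> set T', (forall i, measurable (B i)) /\
    F = [set w | forall i, i \in A -> B i (X i w)]].

Let restr (A : {set I}) (B : I -> set T') (i : I) : set T' :=
  if i \in A then B i else setT.

Let restrE (A : {set I}) (B : I -> set T') :
  [set w | forall i, i \in A -> B i (X i w)] =
  [set w | forall i, restr A B i (X i w)].
Proof.
apply/seteqP; split => w /= h i.
  by rewrite /restr; case: ifPn => // /h.
by move=> iA; have := h i; rewrite /restr iA.
Qed.

Let restrM (A : {set I}) B : (forall i, measurable (B i)) -> forall i, measurable (restr A B i).
Proof. by move=> mB i; rewrite /restr; case: ifPn. Qed.

Lemma cylinder_measurable A : cylinder A `<=` measurable.
Proof.
move=> F [B [mB ->]].
rewrite restrE (_ : [set w | _] = \bigcap_(i in [set: I]) (X i @^-1` restr A B i)).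
  apply: fin_bigcap_measurable => // i _.
  by rewrite -[X in measurable X]setTI; apply: mX => //; exact: restrM.
by apply/seteqP; split => w /= h i; [move=> _; exact: h|exact: h].
Qed.

Lemma sigma_cylinder_measurable A : <<s cylinder A >> `<=` measurable.
Proof.
apply: smallest_sub => //; first exact: sigma_algebra_measurable.
exact: cylinder_measurable.
Qed.

(** The space [T] retyped with the smaller sigma-algebra, so that depending only on the variables
    indexed by [A] becomes plain measurability. *)
Definition past (A : {set I}) := g_sigma_algebraType (cylinder A).

Lemma past_measurable_fun d2 (T2 : measurableType d2) A (f : T -> T2) :
  measurable_fun [set: past A] f -> measurable_fun setT f.
Proof.
move=> mf _ B mB; rewrite setTI; apply: (@sigma_cylinder_measurable A).
by have := mf measurableT B mB; rewrite setTI.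
Qed.

Lemma past_measurable (A : {set I}) i : i \in A -> measurable_fun [set: past A] (X i).
Proof.
move=> iA _ B mB; rewrite setTI; apply: sub_sigma_algebra.
exists (fun j => if j == i then B else setT); split.
  by move=> j; case: ifPn.
apply/seteqP; split => w /=.
  by move=> Bw j _; case: eqP => // ->.
by move=> /(_ i iA); rewrite eqxx.
Qed.

(** For a fixed second event both sides are finite measures in [F]; they agree on the pi-system of
    cylinders, hence on the sigma-algebra it generates. *)
Lemma past_indep (A : {set I}) s F B : s \notin A -> (<<s cylinder A >>) F -> measurable B ->
  P (F `&` (X s @^-1` B)) = (P F * P (X s @^-1` B))%E.
Proof.
move=> sA sF mB.
have mE : measurable (X s @^-1` B) by rewrite -[X in measurable X]setTI; exact: mX.
have PE0 : 0 <= fine (P (X s @^-1` B)) by rewrite fine_ge0.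
have PE : (fine (P (X s @^-1` B)))%:E = P (X s @^-1` B).
  by rewrite fineK//; exact: fin_num_measure.
pose m1 : {measure set T -> \bar R} := mrestr P mE.
pose m2 : {measure set T -> \bar R} := mscale (NngNum PE0) P.
suff -> : P (F `&` (X s @^-1` B)) = m1 F.
  rewrite (_ : m1 F = m2 F); first by rewrite /m2 /= /mscale /= PE muleC.
  apply: (g_sigma_algebra_measure_unique (cylinder A) _ (fun=> setT)) => //.
  - exact: cylinder_measurable.
  - move=> _; exists (fun=> setT); split => //.
    by apply/seteqP; split.
  - by rewrite bigcup_const//; exists 0%N.
  - move=> _ _ [B1 [mB1 ->]] [B2 [mB2 ->]].
    exists (fun i => B1 i `&` B2 i); split; first by move=> i; exact: measurableI.
    apply/seteqP; split => w /=; first by move=> [h1 h2] i iA; split; auto.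
    by move=> h; split => i /h [].
  - move=> _ [C [mC ->]].
    rewrite /m1 /m2 /= /mrestr /mscale /= PE.
    have H1 := indepX (restrM A mC).
    (* As [s] is not in [A], the cylinder leaves coordinate [s] free and [B] can be inserted there,
       which makes the intersection a single rectangle. *)
    pose D i := if i == s then B else restr A C i.
    have mD i : measurable (D i) by rewrite /D; case: ifPn => // _; exact: restrM.
    have H2 := indepX mD.
    rewrite (_ : _ `&` _ = [set w | forall i, D i (X i w)]); last first.
      rewrite restrE; apply/seteqP; split => w /=.
        by move=> [h1 h2] i; rewrite /D; case: eqP => [->//|_]; exact: h1.
      move=> h; split; last by have := h s; rewrite /D eqxx.
      move=> i; have := h i; rewrite /D; case: eqP => // -> _.
      by rewrite /restr (negbTE sA).
    rewrite H2 restrE H1 (bigD1 s)//= [in RHS](bigD1 s)//=.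
    rewrite {1}/D eqxx {1}/restr (negbTE sA) preimage_setT probability_setT mul1e.
    congr (_ * _)%E; apply: eq_bigr => i /negbTE si.
    by rewrite /D si.
  - move=> _; rewrite /m1 /= /mrestr setTI.
    by rewrite (le_lt_trans (probability_le1 P mE)) ?ltry.
by [].
Qed.

Lemma EE_past (A : {set I}) s (f : T -> R) (g : T' -> R) : s \notin A ->
  measurable_fun [set: past A] f -> measurable_fun setT g ->
  integ P f -> integ P (g \o X s) -> integ P (fun x => f x * g (X s x)) ->
  EE P (fun x => f x * g (X s x)) = EE P f * EE P (g \o X s).
Proof.
move=> sA mf mg fi gi fgi.
apply: (EEM_indep _ _ _ fi gi fgi).
- exact: past_measurable_fun mf.
- exact: measurableT_comp.
- move=> B C mB mC; rewrite comp_preimage; apply: (past_indep sA).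
    by have := mf measurableT B mB; rewrite setTI.
  by rewrite -[X in measurable X]setTI; exact: mg.
Qed.

Lemma EE_past_bounded (A : {set I}) s (f : T -> R) (g : T' -> R) (k : R) : s \notin A ->
  measurable_fun [set: past A] f -> measurable_fun setT g ->
  (forall x, `|f x| <= k) -> integ P (g \o X s) ->
  EE P (fun x => f x * g (X s x)) = EE P f * EE P (g \o X s).
Proof.
move=> sA mf mg fk gi; have mf' := past_measurable_fun mf.
apply: (EE_past sA mf mg) => //; first exact: integ_bounded mf' fk.
exact: (integM_bounded mf' fk gi).
Qed.

Lemma EE_pair_indep s t (f g : T' -> R) : s != t ->
  measurable_fun setT f -> measurable_fun setT g ->
  integ P (f \o X s) -> integ P (g \o X t) ->
  integ P (fun x => f (X s x) * g (X t x)) ->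
  EE P (fun x => f (X s x) * g (X t x)) = EE P (f \o X s) * EE P (g \o X t).
Proof.
move=> st mf mg fi gi fgi.
apply: (@EE_past (finset.set1 s) t (f \o X s)) => //.
  by rewrite inE eq_sym.
by apply: measurableT_comp => //; apply: past_measurable; rewrite inE.
Qed.

Lemma EE_sqr_sum_indep (A : {set I}) (g : I -> T' -> R) :
  (forall i, measurable_fun setT (g i)) ->
  (forall i, integ P (fun w => g i (X i w) ^+ 2)) ->
  (forall i, EE P (fun w => g i (X i w)) = 0) ->
  EE P (fun w => (\sum_(i in A) g i (X i w)) ^+ 2) =
    \sum_(i in A) EE P (fun w => g i (X i w) ^+ 2) /\
  integ P (fun w => (\sum_(i in A) g i (X i w)) ^+ 2).
Proof.
move=> mg ig2 g0.
have mgX i : measurable_fun setT (fun w => g i (X i w)) by exact: measurableT_comp.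
have ig i : integ P (fun w => g i (X i w)).
  apply: (@integ_le _ _ _ _ _ (fun w => 1 + g i (X i w) ^+ 2)) => //.
    move=> w; rewrite -[X in 1 + X]real_normK ?num_real//.
    by have := normr_ge0 (g i (X i w)); set z := `|_| => z0; nra.
  by apply: integD; [exact: integ_cst|].
have igg i j : integ P (fun w => g i (X i w) * g j (X j w)).
  apply: (@integ_le _ _ _ _ _ (fun w => g i (X i w) ^+ 2 + g j (X j w) ^+ 2)).
  - exact: measurable_funM.
  - move=> w; rewrite normrM -[X in _ <= X + _]real_normK ?num_real//.
    rewrite -[X in _ <= _ + X]real_normK ?num_real//.
    set x := `|_|; set y := `|_|; have := sqr_ge0 (x - y); have := sqr_ge0 (x + y).
    by nra.
  - exact: integD.
have E : (fun w => (\sum_(i in A) g i (X i w)) ^+ 2) =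
    (fun w => \sum_(i <- enum A) \sum_(j <- enum A) g i (X i w) * g j (X j w)).
  apply/funext => w; rewrite expr2 mulr_suml big_enum /=.
  by apply: eq_bigr => i _; rewrite mulr_sumr big_enum.
rewrite E; split; last by apply: integ_sum => i _; exact: integ_sum.
rewrite EE_sum; last by move=> i; exact: integ_sum.
under eq_bigr do rewrite EE_sum//.
rewrite big_enum /=; apply: eq_bigr => i iA.
rewrite big_enum /= (bigD1 i)//= big1 ?addr0; first by under eq_fun do rewrite -expr2.
move=> j /andP[_ ji]; rewrite eq_sym in ji.
rewrite (EE_pair_indep ji (mg i) (mg j) (ig i) (ig j) (igg i j)).
by rewrite [X in X * _]g0 mul0r.
Qed.

End past.

(** * Lindeberg replacement with explicit heat flow *)

Section taylor.
Context (R : realType).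
Implicit Types (f df : R -> R).

Lemma MVT_dist f df (a b : R) : (forall x, is_derive x (1 : R) f (df x)) ->
  exists2 c, `|c - a| <= `|b - a| & f b - f a = df c * (b - a).
Proof.
move=> fdf.
have cf (x : R) : {for x, continuous f}.
  by apply: differentiable_continuous; apply/derivable1_diffP; have [] := fdf x.
have wcf (u v : R) : {within `[u, v], continuous f}.
  by apply: continuous_subspaceT => x; exact: cf.
case: (leP a b) => [ab|/ltW ba].
  have [c] := MVT_segment ab (fun x _ => fdf x) (wcf a b).
  rewrite in_itv /= => /andP[ac cb] E; exists c => //.
  by rewrite !ger0_norm ?subr_ge0// lerD2r.
have [c] := MVT_segment ba (fun x _ => fdf x) (wcf b a).
rewrite in_itv /= => /andP[bc ca] E; exists c.
  by rewrite !ler0_norm ?subr_le0// lerN2 lerD2r.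
by rewrite -[LHS]opprB E -mulrN opprB.
Qed.

(** Three applications of the mean value theorem, so that [K] stands where Taylor's formula has K /
    6. The bound on [f3] is asked only within distance [|x|] of [y], because the lemma also serves
    for [expR], whose third derivative is unbounded. *)
Lemma taylor3 (f f1 f2 f3 : R -> R) (K y x : R) :
  (forall x, is_derive x (1 : R) f (f1 x)) ->
  (forall x, is_derive x (1 : R) f1 (f2 x)) ->
  (forall x, is_derive x (1 : R) f2 (f3 x)) ->
  (forall t, `|t| <= `|x| -> `|f3 (y + t)| <= K) ->
  `|f (y + x) - (f y + f1 y * x + f2 y * x ^+ 2 / 2)| <= K * `|x| ^+ 3.
Proof.
move=> d1 d2 d3 f3K.
have shift (g dg : R -> R) : (forall x, is_derive x (1 : R) g (dg x)) ->
    forall t, is_derive t (1 : R) (fun t => g (y + t)) (dg (y + t)).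
  move=> dgd t.
  have h : is_derive t (1 : R) (fun t => y + t) 1.
    by apply: is_derive_eq; rewrite add0r mulr1.
  have := dgd (y + t) => h'; rewrite -[X in is_derive _ _ _ X]mulr1.
  exact: (is_derive1_comp h' h).
have K0 : 0 <= K by rewrite (le_trans _ (f3K x _)).
have s1 t : `|t| <= `|x| -> `|f2 (y + t) - f2 y| <= K * `|t|.
  move=> tx; have [c ct] := MVT_dist 0 t (shift _ _ d3).
  rewrite addr0 subr0 => ->; rewrite normrM ler_wpM2r// f3K//.
  by rewrite (le_trans _ tx)//; rewrite !subr0 in ct.
have s2 t : `|t| <= `|x| -> `|f1 (y + t) - f1 y - f2 y * t| <= K * `|t| ^+ 2.
  move=> tx.
  have dg u : is_derive u (1 : R) (fun t => f1 (y + t) - f2 y * t) (f2 (y + u) - f2 y).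
    have := shift _ _ d2 u => ?.
    by apply: is_derive_eq; rewrite /GRing.scale /=; ring.
  have [c] := MVT_dist 0 t dg.
  rewrite addr0 mulr0 !subr0 => ct E.
  rewrite addrAC E normrM expr2 mulrA ler_wpM2r//.
  by rewrite (le_trans (s1 _ _)) ?(le_trans ct)// ler_wpM2l.
have dh u : is_derive u (1 : R) (fun t => f (y + t) - (f1 y * t + f2 y / 2 * t ^+ 2))
    (f1 (y + u) - f1 y - f2 y * u).
  have := shift _ _ d1 u => ?.
  apply: is_derive_eq.
  by rewrite /GRing.scale /=; field.
have [c] := MVT_dist 0 x dh.
rewrite addr0 expr0n /= !mulr0 addr0 !subr0 => ct E.
rewrite (_ : _ - _ = f (y + x) - (f1 y * x + f2 y / 2 * x ^+ 2) - f y); last by field.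
rewrite E normrM exprSr mulrA ler_wpM2r//.
by rewrite (le_trans (s2 _ _))// ler_wpM2l// lerXn2r ?nnegrE.
Qed.

End taylor.

(** * The functions c exp (- b y^2 + a y) and their derivatives *)

Section quadratic_exponential.
Context (R : realType).

Definition qexp (c b a y : R) : R := c * expR (- b * y ^+ 2 + a * y).

Lemma is_derive_qexp c b a (p : R -> R) (dp y : R) : is_derive y (1 : R) p dp ->
  is_derive y (1 : R) (fun x => p x * qexp c b a x)
    ((dp + p y * (a - 2 * b * y)) * qexp c b a y).
Proof.
move=> hp.
have h1 : is_derive y (1 : R) (fun y => - b * y ^+ 2 + a * y) (a - 2 * b * y).
  apply: is_derive_eq; rewrite /GRing.scale /=; ring.
have h2 : is_derive y (1 : R) (fun x => expR (- b * x ^+ 2 + a * x))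
    (expR (- b * y ^+ 2 + a * y) * (a - 2 * b * y)).
  exact: is_derive1_comp.
by rewrite /qexp; apply: is_derive_eq; rewrite /GRing.scale /=; ring.
Qed.

(** The derivatives are kept as polynomials in the logarithmic derivative w = a - 2 b y, because in
    this variable the exponential is a constant times exp (- w^2 / (4 b)), as [qexp_square]
    shows. *)
Definition qexp1 c b a (y : R) := (a - 2 * b * y) * qexp c b a y.
Definition qexp2 c b a (y : R) := ((a - 2 * b * y) ^+ 2 - 2 * b) * qexp c b a y.
Definition qexp3 c b a (y : R) :=
  ((a - 2 * b * y) ^+ 3 - 6 * b * (a - 2 * b * y)) * qexp c b a y.

Lemma is_derive_qexp0 c b a y : is_derive y (1 : R) (qexp c b a) (qexp1 c b a y).
Proof.
have h := @is_derive_qexp c b a (fun=> 1) 0 y (is_derive_cst _ _ _).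
rewrite (_ : qexp c b a = (fun x => 1 * qexp c b a x)).
  by apply: is_derive_eq h _; rewrite add0r mul1r.
by apply: funext => x; rewrite mul1r.
Qed.

Lemma is_derive_qexp1 c b a y : is_derive y (1 : R) (qexp1 c b a) (qexp2 c b a y).
Proof.
have hp : is_derive y (1 : R) (fun y => a - 2 * b * y) (- (2 * b)).
  by apply: is_derive_eq; rewrite /GRing.scale /=; ring.
apply: is_derive_eq (is_derive_qexp c b a hp) _.
by rewrite /qexp2; ring.
Qed.

Lemma is_derive_qexp2 c b a y : is_derive y (1 : R) (qexp2 c b a) (qexp3 c b a y).
Proof.
have hp : is_derive y (1 : R) (fun y => (a - 2 * b * y) ^+ 2 - 2 * b)
    (- (4 * b) * (a - 2 * b * y)).
  by apply: is_derive_eq; rewrite /GRing.scale /=; ring.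
apply: is_derive_eq (is_derive_qexp c b a hp) _.
by rewrite /qexp3; ring.
Qed.

(** For x = w^2 / (4 b) one has expR x >= 1 + x^2 / 2 and w^4 = 32 b^2 (x^2 / 2). Up to constants,
    the weight 1 + w^4 dominates the polynomial factors of the first three derivatives. *)
Lemma quartic_expN_bound (b w : R) : 0 < b ->
  (1 + w ^+ 4) * expR (- (w ^+ 2 / (4 * b))) <= 1 + 32 * b ^+ 2.
Proof.
move=> b0; rewrite expRN ler_pdivrMr ?expR_gt0//.
have bb : b * b^-1 = 1 by rewrite divff ?gt_eqF.
set x := w ^+ 2 / (4 * b).
have x0 : 0 <= x by rewrite divr_ge0 ?sqr_ge0// mulr_ge0 ?ltW.
have ex : 1 + x ^+ 2 / 2 <= expR x by have := expR_ge1Dxn 1 x0.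
apply: (@le_trans _ _ ((1 + 32 * b ^+ 2) * (1 + x ^+ 2 / 2))); last first.
  by rewrite ler_wpM2l//; nra.
have -> : w ^+ 4 = 32 * b ^+ 2 * (x ^+ 2 / 2) by rewrite /x; field; lra.
have := sqr_ge0 x; have := sqr_ge0 b; nra.
Qed.

Lemma qexp_square (c b a y : R) : 0 < b ->
  qexp c b a y =
  c * expR (a ^+ 2 / (4 * b)) * expR (- ((a - 2 * b * y) ^+ 2 / (4 * b))).
Proof.
move=> b0; rewrite /qexp -mulrA -expRD; congr (_ * expR _).
by field; lra.
Qed.

Lemma qexp_ge0 (c b a y : R) : 0 <= c -> 0 <= qexp c b a y.
Proof. by move=> c0; rewrite mulr_ge0 ?expR_ge0. Qed.

(** Along the heat flow [b] shrinks and the maximum c expR (a^2 / (4 b)) does not grow. Allowing any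
    [b <= B] and any maximum up to [C] makes the bounds uniform in time. *)
Lemma qexp_le (c b a B C y : R) : 0 < b -> b <= B -> 0 <= c ->
  c * expR (a ^+ 2 / (4 * b)) <= C ->
  qexp c b a y <= C * expR (- ((a - 2 * b * y) ^+ 2 / (4 * B))).
Proof.
move=> b0 bB c0 cC; rewrite qexp_square//; apply: ler_pM => //.
- by rewrite mulr_ge0 ?expR_ge0.
- rewrite ler_expR lerN2 ler_wpM2l ?sqr_ge0//.
  by rewrite lef_pV2 ?ler_pM2l// posrE mulr_gt0//; exact: lt_le_trans bB.
Qed.

Lemma qexp_bound (c b a C y : R) : 0 < b -> 0 <= c ->
  c * expR (a ^+ 2 / (4 * b)) <= C -> `|qexp c b a y| <= C.
Proof.
move=> b0 c0 cC; rewrite ger0_norm ?qexp_ge0//.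
apply: (le_trans (qexp_le y b0 (lexx b) c0 cC)).
have C0 : 0 <= C by rewrite (le_trans _ cC)// mulr_ge0 ?expR_ge0.
have e1 : expR (- ((a - 2 * b * y) ^+ 2 / (4 * b))) <= 1.
  by rewrite expR_le1 oppr_le0 divr_ge0 ?sqr_ge0// mulr_ge0// ltW.
by rewrite -[leRHS]mulr1 ler_wpM2l.
Qed.

Let poly_bound (c b a B C k p y : R) : 0 < b -> b <= B -> 0 <= c ->
  c * expR (a ^+ 2 / (4 * b)) <= C ->
  0 <= k -> `|p| <= k * (1 + (a - 2 * b * y) ^+ 4) ->
  `|p * qexp c b a y| <= k * (1 + 32 * B ^+ 2) * C.
Proof.
move=> b0 bB c0 cC k0 pk; rewrite normrM [X in _ * X]ger0_norm ?qexp_ge0//.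
have B0 : 0 < B by lra.
have C0 : 0 <= C by rewrite (le_trans _ cC)// mulr_ge0 ?expR_ge0.
apply: (@le_trans _ _ (k * (1 + (a - 2 * b * y) ^+ 4) *
  (C * expR (- ((a - 2 * b * y) ^+ 2 / (4 * B)))))).
  by apply: ler_pM; rewrite ?qexp_ge0//; exact: qexp_le.
have := quartic_expN_bound (a - 2 * b * y) B0.
set w := 1 + _; set e := expR _ => /(ler_wpM2l (mulr_ge0 k0 C0)).
by rewrite (_ : k * C * (w * e) = k * w * (C * e)); [rewrite [k * C * _]mulrAC|ring].
Qed.

Let w4E (w : R) : w ^+ 4 = `|w| ^+ 4.
Proof. by rewrite -normrX ger0_norm// -[4%N]/(2 * 2)%N exprM sqr_ge0. Qed.

Let w3 (w : R) : `|w| ^+ 3 <= 1 + w ^+ 4.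
Proof.
rewrite w4E; have := normr_ge0 w; set z := `|w| => z0.
have z4 : 0 <= z ^+ 4 by rewrite exprn_ge0.
have [z1|/ltW z1] := leP z 1.
  by apply: (@le_trans _ _ 1); [exact: exprn_ile1|rewrite lerDl].
apply: (@le_trans _ _ (z ^+ 4)); last by rewrite lerDr.
exact: ler_weXn2l.
Qed.

Let w1 (w : R) : `|w| <= 1 + w ^+ 4.
Proof.
rewrite w4E; have := normr_ge0 w; set z := `|w| => z0.
have z4 : 0 <= z ^+ 4 by rewrite exprn_ge0.
have [z1|/ltW z1] := leP z 1.
  by apply: (@le_trans _ _ 1); [|rewrite lerDl].
apply: (@le_trans _ _ (z ^+ 4)); last by rewrite lerDr.
by have := @ler_weXn2l _ z z1 1 4 isT; rewrite expr1.
Qed.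

Let w2 (w : R) : w ^+ 2 <= 1 + w ^+ 4.
Proof. nra. Qed.

Lemma qexp1_bound (c b a B C y : R) : 0 < b -> b <= B -> 0 <= c ->
  c * expR (a ^+ 2 / (4 * b)) <= C ->
  `|qexp1 c b a y| <= 1 * (1 + 32 * B ^+ 2) * C.
Proof. by move=> *; apply: poly_bound; rewrite // mul1r. Qed.

Lemma qexp2_bound (c b a B C y : R) : 0 < b -> b <= B -> 0 <= c ->
  c * expR (a ^+ 2 / (4 * b)) <= C ->
  `|qexp2 c b a y| <= (1 + 2 * B) * (1 + 32 * B ^+ 2) * C.
Proof.
move=> b0 bB c0 cC; apply: poly_bound => //; first lra.
set w := a - _; apply: (le_trans (ler_normB _ _)).
rewrite (ger0_norm (sqr_ge0 w)) ger0_norm; last lra.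
have := w2 w; have : 0 <= w ^+ 4 by rewrite -[4%N]/(2 * 2)%N exprM sqr_ge0.
nra.
Qed.

Lemma qexp3_bound (c b a B C y : R) : 0 < b -> b <= B -> 0 <= c ->
  c * expR (a ^+ 2 / (4 * b)) <= C ->
  `|qexp3 c b a y| <= (1 + 6 * B) * (1 + 32 * B ^+ 2) * C.
Proof.
move=> b0 bB c0 cC; apply: poly_bound => //; first lra.
set w := a - _; apply: (le_trans (ler_normB _ _)).
rewrite normrX normrM [`|6 * b|]ger0_norm; last lra.
rewrite [leRHS]mulrDl mul1r lerD ?w3//.
by apply: ler_pM; rewrite ?w1//; lra.
Qed.

End quadratic_exponential.

(** * Gaussian integrals and moments *)

Definition gaussian (R : realType) : probability (measurableTypeR R) R := normal_prob 0 1.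

Section gaussian.
Context (R : realType).
Local Notation N01 := (normal_prob (0 : R) 1).
Local Notation mu := (@lebesgue_measure R).

(** The change of variables is by the Radon-Nikodym derivative, which equals the density almost
    everywhere because both have the same integral over every measurable set. *)
Lemma ge0_integral_normal_prob (f : R -> \bar R) : (forall x, 0 <= f x)%E ->
  measurable_fun [set: measurableTypeR R] f ->
  (\int[N01]_x f x = \int[mu]_x (f x * (normal_pdf 0 1 x)%:E))%E.
Proof.
move=> f0 mf.
have dom := normal_prob_dominates (0 : R) 1.
rewrite -(Radon_Nikodym_SigmaFinite.change_of_variables dom f0 measurableT mf).
have RNi := Radon_Nikodym_SigmaFinite.f_integrable dom.
apply: ge0_ae_eq_integral => //.
- by apply: emeasurable_funM => //; exact: measurable_int RNi.
- apply: emeasurable_funM => //; apply/measurable_EFinP; exact: measurable_normal_pdf.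
- by move=> x _; rewrite mule_ge0// Radon_Nikodym_SigmaFinite.f_ge0.
- by move=> x _; rewrite mule_ge0// lee_fin normal_pdf_ge0.
- apply: ae_eqe_mul2l => /=.
  apply: integral_ae_eq => //=.
  + by apply/measurable_EFinP; exact: measurable_normal_pdf.
  + by move=> E _ mE; rewrite -Radon_Nikodym_SigmaFinite.f_integral.
Qed.

(** Completing the square turns the integrand times the standard density into a multiple of the
    density of N(a / D, 1 / D), where D = 1 + 2 b. Negative [b] above -1/2 is allowed: it supplies
    integrable envelopes such as expR (x^2 / 4). *)
Lemma integral_gaussian_qexp (b a : R) : - 1 < 2 * b ->
  (\int[gaussian R]_x (expR (- b * x ^+ 2 + a * x))%:E =
   ((Num.sqrt (1 + 2 * b))^-1 * expR (a ^+ 2 / (2 * (1 + 2 * b))))%:E)%E.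
Proof.
move=> b1; set D := 1 + 2 * b.
have D0 : 0 < D by rewrite /D; lra.
set s := Num.sqrt D.
have s0 : 0 < s by rewrite sqrtr_gt0.
have sD : s ^+ 2 = D by rewrite sqr_sqrtr// ltW.
have mq : measurable_fun [set: measurableTypeR R]
    (fun x : R => (expR (- b * x ^+ 2 + a * x))%:E).
  apply/measurable_EFinP; apply: measurableT_comp => //.
  apply: measurable_funD; apply: measurable_funM => //.
rewrite /gaussian (ge0_integral_normal_prob _ mq); last by move=> x; rewrite lee_fin expR_ge0.
have V0 : s^-1 != 0 by rewrite invr_eq0 gt_eqF.
transitivity (\int[mu]_x ((s^-1 * expR (a ^+ 2 / (2 * D)))%:E *
    (normal_pdf (a / D) s^-1 x)%:E))%E.
  apply: eq_integral => x _; rewrite -!EFinM !normal_pdfE ?oner_neq0//.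
  congr EFin; rewrite /normal_peak /normal_fun expr1n mul1r.
  have -> : s^-1 ^+ 2 = D^-1 by rewrite exprVn sD.
  have -> : Num.sqrt (D^-1 * pi *+ 2) = s^-1 * Num.sqrt (pi *+ 2).
    by rewrite -mulrnAr sqrtrM ?invr_ge0 ?(ltW D0)// -(sqrtrV (ltW D0)).
  rewrite [(s^-1 * Num.sqrt _)^-1]invfM invrK.
  have -> : s^-1 * expR (a ^+ 2 / (2 * D)) *
      (s * (Num.sqrt (pi *+ 2))^-1 * expR (- (x - a / D) ^+ 2 / (D^-1 *+ 2))) =
      (Num.sqrt (pi *+ 2))^-1 * (expR (a ^+ 2 / (2 * D)) *
       expR (- (x - a / D) ^+ 2 / (D^-1 *+ 2))).
    have : Num.sqrt (pi *+ 2) != 0 :> R.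
      by rewrite gt_eqF// sqrtr_gt0 mulrn_wgt0// pi_gt0.
    set k := Num.sqrt _ => k0; have sn0 : s != 0 by rewrite gt_eqF.
    by rewrite !mulrA; congr (_ * _); field; apply/andP; split.
  rewrite mulrCA -!expRD; congr (_ * expR _).
  by rewrite subr0 -mulr_natr -(mulr_natr D^-1) /D; field; rewrite -/D; lra.
rewrite integralZl//; last exact: integrable_normal_pdf.
by rewrite integral_normal_pdf// mule1.
Qed.

Lemma integ_gaussian_qexp (b a : R) : - 1 < 2 * b ->
  integ (gaussian R) (fun x => expR (- b * x ^+ 2 + a * x)).
Proof.
move=> b1; apply/integrableP; split.
  apply/measurable_EFinP; apply: measurableT_comp => //.
  by apply: measurable_funD; apply: measurable_funM.
under eq_integral do rewrite /= ger0_norm ?expR_ge0//.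
by rewrite integral_gaussian_qexp// ltry.
Qed.

Lemma EE_gaussian_qexp (b a : R) : - 1 < 2 * b ->
  EE (gaussian R) (fun x => expR (- b * x ^+ 2 + a * x)) =
  (Num.sqrt (1 + 2 * b))^-1 * expR (a ^+ 2 / (2 * (1 + 2 * b))).
Proof.
move=> b1; apply: EFin_inj; rewrite EE_EFin; last exact: integ_gaussian_qexp.
exact: integral_gaussian_qexp.
Qed.

End gaussian.

Section gaussian_moments.
Context (R : realType).
Local Notation N01 := (gaussian R).

Lemma exprn_le_expR (n : nat) (x : R) : 0 <= x -> x ^+ n <= n`!%:R * expR x.
Proof.
move=> x0; case: n => [|n]; first by rewrite expr0 mul1r -expR0 ler_expR.
have h : x ^+ n.+1 / n.+1`!%:R <= expR x.
  by rewrite (le_trans _ (expR_ge1Dxn n x0))// lerDr.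
by rewrite mulrC -ler_pdivrMr// ltr0n fact_gt0.
Qed.

Lemma normrX_le_expR_sqr (n : nat) (k x : R) : 0 < k ->
  `|x| ^+ n <= 1 + k ^+ n * n`!%:R * expR (x ^+ 2 / k).
Proof.
move=> k0.
have h : (x ^+ 2) ^+ n <= k ^+ n * n`!%:R * expR (x ^+ 2 / k).
  have := @exprn_le_expR n (x ^+ 2 / k) (divr_ge0 (sqr_ge0 _) (ltW k0)).
  rewrite expr_div_n ler_pdivrMr ?exprn_gt0// => h.
  by rewrite (le_trans h)// -mulrA mulrC mulrAC.
apply: le_trans (_ : 1 + (x ^+ 2) ^+ n <= _); last by rewrite lerD2l.
have -> : (x ^+ 2) ^+ n = (`|x| ^+ n) ^+ 2.
  by rewrite -real_normK ?num_real// -!exprM mulnC.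
by set z := `|x| ^+ n; nra.
Qed.

Lemma integ_gaussian_expR_sqr : integ N01 (fun x => expR (x ^+ 2 / 4)).
Proof.
have := @integ_gaussian_qexp R (- 4^-1) 0; rewrite (_ : (fun x => _) = fun x => expR (x ^+ 2 / 4)).
  by apply; lra.
by apply/funext => x; rewrite mul0r addr0 opprK mulrC.
Qed.

Lemma integ_gaussian_norm (n : nat) : integ N01 (fun x => `|x| ^+ n).
Proof.
apply: (@integ_le R _ _ N01 _ (fun x => 1 + 4 ^+ n * n`!%:R * expR (x ^+ 2 / 4))).
- by apply: measurable_funX; exact: normr_measurable.
- by move=> x; rewrite ger0_norm ?exprn_ge0//; exact: normrX_le_expR_sqr.
- by apply: integD; [exact: integ_cst|apply: integZ; exact: integ_gaussian_expR_sqr].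
Qed.

Lemma integ_gaussian_exp (n : nat) : integ N01 (fun x => x ^+ n).
Proof.
apply: integ_le (integ_gaussian_norm n); first exact: measurable_funX.
by move=> x; rewrite normrX.
Qed.

(* From [expR (a * x) >= 1 + a * x] and [E expR (a X) = expR (a^2 / 2)]. *)
Lemma gaussian_mean : EE N01 (fun x => x) = 0.
Proof.
have i0 : integ N01 (fun x => x) by have := integ_gaussian_exp 1.
set m := EE _ _.
have key (a : R) : 1 + a * m <= expR (a ^+ 2 / 2).
  have hq : - 1 < 2 * (0 : R) by lra.
  have := @EE_gaussian_qexp R 0 a hq; rewrite mulr0 addr0 sqrtr1 invr1 mul1r mulr1.
  move=> <-.
  have i1 : integ N01 (fun x => 1 + a * x).
    by apply: (integD (integ_cst N01 1)); exact: (integZ a i0).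
  have -> : 1 + a * m = EE N01 (fun x => 1 + a * x).
    rewrite (EED (integ_cst N01 1) (integZ a i0)) (EEZ a i0).
    by rewrite [EE N01 (fun=> 1)]EE_cst.
  apply: EE_le => //; first exact: integ_gaussian_qexp.
  by move=> x; rewrite oppr0 mul0r add0r expR_ge1Dx.
have key2 (a : R) : `|a| <= 1 -> a * m <= a ^+ 2.
  move=> a1; have a2 : a ^+ 2 <= 1.
    by rewrite -real_normK ?num_real// exprn_ile1.
  have h2 : expR (a ^+ 2 / 2) <= (1 - a ^+ 2 / 2)^-1.
    have := expR_ge1Dx (- (a ^+ 2 / 2)); rewrite expRN => h.
    rewrite -[leLHS]invrK lef_pV2 ?posrE ?invr_gt0 ?expR_gt0//.
    by have := sqr_ge0 a; lra.
  have h3 : (1 - a ^+ 2 / 2)^-1 <= 1 + a ^+ 2.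
    have := sqr_ge0 a; set z := a ^+ 2 in a2 * => z0.
    by rewrite -[leLHS]mul1r ler_pdivrMr; nra.
  have := key a; lra.
apply/eqP; rewrite -normr_le0; apply/ler_addgt0Pl => e e0; rewrite addr0.
pose a := Num.min 1 e.
have a0 : 0 < a by rewrite lt_min ltr01.
have a1 : a <= 1 by rewrite ge_min lexx.
have ae : a <= e by rewrite ge_min lexx orbT.
have h1 : `|a| <= 1 by rewrite ger0_norm// ltW.
have := key2 a h1; have := key2 (- a); rewrite normrN => /(_ h1).
rewrite sqrrN mulNr => k1 k2.
rewrite (le_trans _ ae)// ler_norml; apply/andP; split.
  by rewrite -(ler_pM2l a0); nra.
by rewrite -(ler_pM2l a0) -expr2.
Qed.

(** Dividing by x and letting x tend to 0 gives [u = 0]; after that, dividing by x^2 gives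
    [v = 0]. *)
Lemma linear_quadratic_small_eq0 (u v C r : R) : 0 < r -> r <= 1 ->
  (forall x, 0 < x -> x <= r -> `|u * x + v * x ^+ 2| <= C * x ^+ 3) ->
  u = 0 /\ v = 0.
Proof.
move=> r0 r1 h.
have C0 : 0 <= C.
  have := h r r0 (lexx _) => /(le_trans (normr_ge0 _)).
  by rewrite pmulr_lge0// exprn_gt0.
have small (w D : R) : 0 <= D -> (forall x, 0 < x -> x <= r -> `|w| <= D * x) -> w = 0.
  move=> D0 wD; apply/eqP; rewrite -normr_le0; apply/ler_addgt0Pl => e e0.
  rewrite addr0; pose x := Num.min r (e / (D + 1)).
  have x0 : 0 < x by rewrite lt_min r0 divr_gt0//; lra.
  have x1 : x <= r by rewrite ge_min lexx.
  have xe : x <= e / (D + 1) by rewrite ge_min lexx orbT.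
  rewrite (le_trans (wD x x0 x1))//.
  by move: xe; rewrite ler_pdivlMr; [nra|lra].
have u0 : u = 0.
  apply: (small u (C + `|v|)); first by rewrite addr_ge0.
  move=> x x0 x1.
  have h1 : `|u * x| <= C * x ^+ 3 + `|v| * x ^+ 2.
    rewrite -[u * x](addrK (v * x ^+ 2)) (le_trans (ler_normB _ _))// lerD ?h//.
    by rewrite normrM [`|x ^+ 2|]ger0_norm ?sqr_ge0.
  rewrite -(ler_pM2r x0) -[X in _ * X <= _](gtr0_norm x0) -normrM (le_trans h1)//.
  have x3 : x ^+ 3 <= x ^+ 2 by rewrite exprS ler_piMl ?sqr_ge0// (le_trans x1).
  rewrite (_ : (C + `|v|) * x * x = C * x ^+ 2 + `|v| * x ^+ 2); last by ring.
  by rewrite lerD2r ler_wpM2l.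
split => //; apply: (small v C C0) => x x0 x1.
have := h x x0 x1; rewrite u0 mul0r add0r normrM [`|x ^+ 2|]ger0_norm ?sqr_ge0// => hv.
by rewrite -(@ler_pM2r _ (x ^+ 2)) ?exprn_gt0// (le_trans hv)// exprS mulrA.
Qed.

(* Compares the expansions of [E expR (- t X^2) = (1 + 2 t)^(-1/2)] up to order 2. *)
Lemma gaussian_moments : EE N01 (fun x => x ^+ 2) = 1 /\ EE N01 (fun x => x ^+ 4) = 3.
Proof.
set m2 := EE N01 _; set m4 := EE N01 (fun x => x ^+ 4).
(* By [normrX_le_expR_sqr], x^6 <= 1 + 8^6 6! expR (x^2 / 8). A second factor expR (x^2 / 8) bounds
   [expR] between - t x^2 and t x^2 when t <= 1/8. The product of the two is at most the integrand
   of [K], which is still integrable. *)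
pose K := EE N01 (fun x => (1 + 8 ^+ 6 * 6`!%:R) * expR (x ^+ 2 / 4)).
have iK : integ N01 (fun x => (1 + 8 ^+ 6 * 6`!%:R) * expR (x ^+ 2 / 4)).
  by apply: integZ; exact: integ_gaussian_expR_sqr.
have K0 : 0 <= K by apply: EE_ge0 => x; rewrite mulr_ge0 ?expR_ge0// addr_ge0.
have iq (t : R) : 0 < t -> integ N01 (fun x => expR (- t * x ^+ 2)).
  move=> t0; have := @integ_gaussian_qexp R t 0.
  rewrite (_ : (fun x => _) = fun x => expR (- t * x ^+ 2)); first by apply; lra.
  by apply/funext => x; rewrite mul0r addr0.
have Eq (t : R) : 0 < t -> EE N01 (fun x => expR (- t * x ^+ 2)) = (Num.sqrt (1 + 2 * t))^-1.
  move=> t0; have := @EE_gaussian_qexp R t 0.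
  rewrite (_ : (fun x => _) = fun x => expR (- t * x ^+ 2)).
    by rewrite expr0n/= mul0r expR0 mulr1; apply; lra.
  by apply/funext => x; rewrite mul0r addr0.
have ip (t : R) : integ N01 (fun x => 1 - t * x ^+ 2 + t ^+ 2 / 2 * x ^+ 4).
  apply: integD; last by apply: integZ; exact: integ_gaussian_exp.
  by apply: integB; [exact: integ_cst|apply: integZ; exact: integ_gaussian_exp].
have Ep (t : R) : EE N01 (fun x => 1 - t * x ^+ 2 + t ^+ 2 / 2 * x ^+ 4) =
    1 - t * m2 + t ^+ 2 / 2 * m4.
  have i2 := integ_gaussian_exp 2; have i4 := integ_gaussian_exp 4.
  rewrite (EED (integB (integ_cst N01 1) (integZ t i2)) (integZ _ i4)).
  rewrite (EEB (integ_cst N01 1) (integZ t i2)) (EEZ t i2) (EEZ _ i4).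
  by rewrite [EE N01 (fun=> 1)]EE_cst.
have step (t : R) : 0 < t -> t <= 8^-1 ->
    `|(Num.sqrt (1 + 2 * t))^-1 - (1 - t * m2 + t ^+ 2 / 2 * m4)| <= K * t ^+ 3.
  move=> t0 t8.
  rewrite -Eq// -Ep -(EEB (iq _ t0) (ip t)) [K * _]mulrC /K -(EEZ (t ^+ 3) iK).
  apply: (EE_norm_le (integB (iq _ t0) (ip t)) (integZ _ iK)) => x.
  have := @taylor3 R expR expR expR expR (expR (x ^+ 2 / 8)) 0 (- t * x ^+ 2).
  have dE y : is_derive y (1 : R) (@expR R) (expR y) by exact: is_derive_expR.
  move=> /(_ dE dE dE).
  have tx : `|- t * x ^+ 2| = t * x ^+ 2.
    by rewrite normrM normrN !ger0_norm ?sqr_ge0// ltW.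
  rewrite tx => H.
  have {H}H1 := H _.
  apply: (@le_trans _ _ (expR (x ^+ 2 / 8) * (t * x ^+ 2) ^+ 3)).
    have -> : 1 - t * x ^+ 2 + t ^+ 2 / 2 * x ^+ 4 =
      expR 0 + expR 0 * (- t * x ^+ 2) + expR 0 * (- t * x ^+ 2) ^+ 2 / 2.
      by rewrite expR0; field.
    rewrite -[X in expR X - _]add0r; apply: H1 => s hs.
    rewrite add0r ger0_norm ?expR_ge0// ler_expR (le_trans (ler_norm s))//.
    by rewrite (le_trans hs)// mulrC ler_wpM2l ?sqr_ge0.
  rewrite exprMn mulrCA ler_wpM2l ?exprn_ge0 ?(ltW t0)//.
  have := @normrX_le_expR_sqr 6 8 x ltac:(lra).
  have -> : `|x| ^+ 6 = (x ^+ 2) ^+ 3.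
    by rewrite -[in RHS]real_normK ?num_real// -exprM.
  move=> h6; apply: (@le_trans _ _ (expR (x ^+ 2 / 8) *
      (1 + 8 ^+ 6 * 6`!%:R * expR (x ^+ 2 / 8)))); first by rewrite ler_wpM2l ?expR_ge0.
  have -> : expR (x ^+ 2 / 4) = expR (x ^+ 2 / 8) * expR (x ^+ 2 / 8).
    by rewrite -expRD; congr expR; field.
  have : 1 <= expR (x ^+ 2 / 8) by rewrite -[leLHS]expR0 ler_expR divr_ge0 ?sqr_ge0.
  set e := expR _ => e1; set k := _ * _%:R.
  by rewrite mulrDr mulr1 mulrDl mul1r lerD//; [nra|rewrite mulrCA].
have m40 : 0 <= m4 by apply: EE_ge0 => x; rewrite -[4%N]/(2 * 2)%N exprM sqr_ge0.
have [| | |h2 h4] := @linear_quadratic_small_eq0 (m2 - 1) (1 + m2 / 2 - m4 / 2)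
    (8 * K + 1 + m4) (16^-1); [lra|lra| |].
  move=> x x0 x1.
  (* With this t, 1 + 2 t = (1 + x)^2, so the square root disappears and a rational function of x is
     compared with a polynomial. In the constant, [8 * K] comes from t <= 2 x and [1 + m4] from the
     rational remainder. *)
  pose t := x + x ^+ 2 / 2.
  have x2 : x ^+ 2 <= x by rewrite expr2 ler_piMl ?ltW//; lra.
  have xx0 := sqr_ge0 x.
  have t0 : 0 < t by rewrite /t; lra.
  have t8 : t <= 8^-1 by rewrite /t; lra.
  have t2 : t <= 2 * x by rewrite /t; lra.
  have := step t t0 t8.
  have -> : 1 + 2 * t = (1 + x) ^+ 2 by rewrite /t; field.
  rewrite sqrtr_sqr [`|1 + x|]ger0_norm; last lra.
  set L := _ - (_ + _) => hL.
  have t3 : t ^+ 3 <= 8 * x ^+ 3.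
    rewrite (_ : 8 * x ^+ 3 = (2 * x) ^+ 3); last by ring.
    by rewrite lerXn2r// nnegrE; lra.
  have E : (m2 - 1) * x + (1 + m2 / 2 - m4 / 2) * x ^+ 2 =
      L + x ^+ 3 * ((1 + x)^-1 + (1 + x / 4) * m4 / 2).
    by rewrite /L /t; field; lra.
  have x30 : 0 <= x ^+ 3 by rewrite exprn_ge0// ltW.
  have v1 : (1 + x)^-1 <= 1 by rewrite invf_le1; lra.
  have v0 : 0 <= (1 + x)^-1 by rewrite invr_ge0; lra.
  have b1 : (1 + x / 4) * m4 / 2 <= m4.
    by rewrite -mulrA mulrC -mulrA ler_piMr//; lra.
  have b0 : 0 <= (1 + x / 4) * m4 / 2 by rewrite divr_ge0// mulr_ge0//; lra.
  rewrite E (le_trans (ler_normD _ _))//.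
  rewrite (_ : _ * x ^+ 3 = K * (8 * x ^+ 3) + x ^+ 3 * (1 + m4)); last by ring.
  apply: lerD; first by rewrite (le_trans hL)// ler_wpM2l.
  rewrite normrM (ger0_norm x30) (ger0_norm (addr_ge0 v0 b0)).
  exact: (ler_wpM2l x30 (lerD v1 b1)).
have {}h2 : m2 = 1 by lra.
by split => //; move: h4; rewrite h2; lra.
Qed.

End gaussian_moments.

(** * Explicit heat flow of the quadratic exponentials *)

Section heat.
Context (R : realType).

(* [heat b a t] solves the heat equation with initial value [expR (- b y^2 + a y)]:
   it is [E expR (- b Y^2 + a Y)] with [Y = y + sqrt t * G], [G] standard normal. *)
Definition heat (b a t y : R) : R :=
  qexp ((Num.sqrt (1 + 2 * b * t))^-1 * expR (a ^+ 2 * t / (2 * (1 + 2 * b * t))))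
    (b / (1 + 2 * b * t)) (a / (1 + 2 * b * t)) y.

Lemma heat0 b a y : heat b a 0 y = expR (- b * y ^+ 2 + a * y).
Proof.
by rewrite /heat /qexp !mulr0 addr0 mul0r expR0 sqrtr1 invr1 !mulr1 !mul1r.
Qed.

Lemma heat_at0 b a t :
  heat b a t 0 = (Num.sqrt (1 + 2 * b * t))^-1 * expR (a ^+ 2 * t / (2 * (1 + 2 * b * t))).
Proof. by rewrite /heat /qexp expr0n/= !mulr0 addr0 expR0 mulr1. Qed.

(** The maximum of expR (- b y^2 + a y) over y, reached at a / (2 b) for positive [b]. *)
Definition heat_sup (b a : R) := expR (a ^+ 2 / (4 * b)).

Lemma heat_denom_ge1 (b t : R) : 0 < b -> 0 <= t -> 1 <= 1 + 2 * b * t.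
Proof. by move=> b0 t0; rewrite lerDl mulr_ge0// mulr_ge0// ltW. Qed.

Lemma heat_denom_gt0 (b t : R) : 0 < b -> 0 <= t -> 0 < 1 + 2 * b * t.
Proof. by move=> b0 t0; exact: lt_le_trans (heat_denom_ge1 b0 t0). Qed.

Lemma heat_coef_gt0 (b t : R) : 0 < b -> 0 <= t -> 0 < b / (1 + 2 * b * t).
Proof. by move=> b0 t0; rewrite divr_gt0// heat_denom_gt0. Qed.

Lemma heat_coef_le (b t : R) : 0 < b -> 0 <= t -> b / (1 + 2 * b * t) <= b.
Proof.
move=> b0 t0; rewrite ler_pdivrMr ?heat_denom_gt0//.
by rewrite ler_peMr ?heat_denom_ge1// ltW.
Qed.

Lemma heat_scale_ge0 (b a t : R) :
  0 <= (Num.sqrt (1 + 2 * b * t))^-1 * expR (a ^+ 2 * t / (2 * (1 + 2 * b * t))).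
Proof. by rewrite mulr_ge0 ?expR_ge0// invr_ge0 sqrtr_ge0. Qed.

(** The two exponents add up to a^2 / (4 b) at every time; only the prefactor depends on t, and it
    is at most 1. *)
Lemma heat_scale_le (b a t : R) : 0 < b -> 0 <= t ->
  (Num.sqrt (1 + 2 * b * t))^-1 * expR (a ^+ 2 * t / (2 * (1 + 2 * b * t))) *
  expR ((a / (1 + 2 * b * t)) ^+ 2 / (4 * (b / (1 + 2 * b * t)))) <= heat_sup b a.
Proof.
move=> b0 t0; have D0 := heat_denom_gt0 b0 t0.
rewrite -mulrA -expRD [X in expR X](_ : _ = a ^+ 2 / (4 * b)); last first.
  by field; rewrite !gt_eqF.
rewrite ler_piMl ?expR_ge0// invf_le1 ?sqrtr_gt0//.
by rewrite -[leLHS]sqrtr1 ler_sqrt ?heat_denom_ge1// ltW.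
Qed.

Lemma heat_ge0 b a t y : 0 <= heat b a t y.
Proof. by apply: qexp_ge0; exact: heat_scale_ge0. Qed.

Lemma heat_le b a t y : 0 < b -> 0 <= t -> heat b a t y <= heat_sup b a.
Proof.
move=> b0 t0; rewrite (le_trans (ler_norm _))//; apply: qexp_bound.
- exact: heat_coef_gt0.
- exact: heat_scale_ge0.
- exact: heat_scale_le.
Qed.

(** Convolution with N(0, e^2) adds e^2 to the time. This turns a time step into a random increment,
    which can be compared with an increment of the sample. *)
Lemma heat_semigroup b a t e y : 0 < b -> 0 <= t ->
  EE (gaussian R) (fun g => heat b a t (y + e * g)) = heat b a (t + e ^+ 2) y.
Proof.
move=> b0 t0.
have D0 : 0 < 1 + 2 * b * t by rewrite ltr_wpDr// mulr_ge0// mulr_ge0// ltW.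
have D'0 : 0 < 1 + 2 * b * (t + e ^+ 2).
  by rewrite ltr_wpDr// mulr_ge0 ?addr_ge0 ?sqr_ge0// mulr_ge0// ltW.
rewrite /heat.
set c := (Num.sqrt (1 + 2 * b * t))^-1 * _.
set B := b / (1 + 2 * b * t); set A := a / (1 + 2 * b * t).
have B0 : 0 < B by exact: heat_coef_gt0.
have Be : - 1 < 2 * (B * e ^+ 2).
  by rewrite (lt_le_trans (ltrN10 _))// mulr_ge0// mulr_ge0 ?sqr_ge0// ltW.
have -> : (fun g => qexp c B A (y + e * g)) =
    (fun g => (c * expR (- B * y ^+ 2 + A * y)) *
      expR (- (B * e ^+ 2) * g ^+ 2 + (e * (A - 2 * B * y)) * g)).
  by apply/funext => g; rewrite /qexp -mulrA -expRD; congr (_ * expR _); ring.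
rewrite EEZ; last exact: integ_gaussian_qexp.
rewrite EE_gaussian_qexp// /qexp.
have -> : (1 + 2 * (B * e ^+ 2)) = (1 + 2 * b * (t + e ^+ 2)) / (1 + 2 * b * t).
  by rewrite /B; field; rewrite gt_eqF.
set D := 1 + 2 * b * t; set D' := 1 + _.
have sD : Num.sqrt D != 0 by rewrite gt_eqF// sqrtr_gt0.
have sD' : Num.sqrt D' != 0 by rewrite gt_eqF// sqrtr_gt0.
rewrite (sqrtrM _ (ltW D'0)) (sqrtrV (ltW D0)) /c.
set E0 := a ^+ 2 * t / _; set E1 := - B * _ + _.
set E2 := _ / (2 * (D' / D)).
transitivity ((Num.sqrt D')^-1 * expR (E0 + E1 + E2)).
  by rewrite !expRD; field; rewrite sD sD'.
rewrite -[RHS]mulrA -expRD; congr (_ * expR _).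
rewrite /E0 /E1 /E2 /B /A -/D -/D'.
have -> : D' = D + 2 * b * e ^+ 2 by rewrite /D' /D; ring.
rewrite /D; field; rewrite !gt_eqF// (_ : _ + 2 * b * e ^+ 2 = D') //.
by rewrite /D'; ring.
Qed.

End heat.

Section taylor_expectation.
Context (R : realType) d (T : measurableType d) (P : probability T R).
Variables (W S X : T -> R) (B M : R).
Hypotheses (mW : measurable_fun setT W) (WB : forall w, `|W w| <= B).
Hypothesis mS : measurable_fun setT S.
Hypothesis mX : measurable_fun setT X.
Hypothesis iX3 : integ P (fun w => `|X w| ^+ 3).
Hypothesis X3M : EE P (fun w => `|X w| ^+ 3) <= M.

Let cubeD1 (z : R) : 0 <= z -> z <= 1 + z ^+ 3 /\ z ^+ 2 <= 1 + z ^+ 3.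
Proof.
move=> z0; have z3 : 0 <= z ^+ 3 by rewrite exprn_ge0.
have [z1|/ltW z1] := leP z 1.
  by split; apply: (@le_trans _ _ 1); rewrite ?lerDl ?exprn_ile1.
split; (apply: (@le_trans _ _ (z ^+ 3)); last by rewrite lerDr).
  by have := @ler_weXn2l _ z z1 1 3 isT; rewrite expr1.
exact: ler_weXn2l.
Qed.

Let iX31 : integ P (fun w => 1 + `|X w| ^+ 3).
Proof. by apply: integD iX3; exact: integ_cst. Qed.

Lemma integ_of_cube1 : integ P X.
Proof. by apply: integ_le iX31 => // w; case: (cubeD1 (normr_ge0 (X w))). Qed.

Lemma integ_of_cube2 : integ P (fun w => X w ^+ 2).
Proof.
apply: integ_le iX31; first exact: measurable_funX.
by move=> w; rewrite normrX; case: (cubeD1 (normr_ge0 (X w))).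
Qed.

Let measurable_qexpT c b a (f : T -> R) : measurable_fun setT f ->
  measurable_fun setT (fun w => qexp c b a (f w)).
Proof.
move=> mf; apply: measurable_funM => //; apply: measurableT_comp => //.
apply: measurable_funD; apply: measurable_funM => //; exact: measurable_funX.
Qed.

Let mqexp1 c b a (f : T -> R) : measurable_fun setT f ->
  measurable_fun setT (fun w => qexp1 c b a (f w)).
Proof.
move=> mf; apply: measurable_funM; last exact: measurable_qexpT.
by apply: measurable_funB => //; apply: measurable_funM.
Qed.

Let mqexp2 c b a (f : T -> R) : measurable_fun setT f ->
  measurable_fun setT (fun w => qexp2 c b a (f w)).
Proof.
move=> mf; apply: measurable_funM; last exact: measurable_qexpT.
apply: measurable_funB => //; apply: measurable_funX.
by apply: measurable_funB => //; apply: measurable_funM.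
Qed.

(** [W] stands for the groups left untouched, [S] for the partial sum formed so far, [X] for the
    next increment. The last two hypotheses are what centring, unit variance and independence
    provide, so that only the third-order remainder survives. *)
Lemma EE_taylor3 (c b a A C e : R) : 0 < b -> b <= A -> 0 <= c ->
  c * expR (a ^+ 2 / (4 * b)) <= C -> 0 <= e ->
  EE P (fun w => W w * qexp1 c b a (S w) * X w) = 0 ->
  EE P (fun w => W w * qexp2 c b a (S w) * X w ^+ 2) =
    EE P (fun w => W w * qexp2 c b a (S w)) ->
  `|EE P (fun w => W w * qexp c b a (S w + e * X w)) -
    EE P (fun w => W w * qexp c b a (S w)) -
    e ^+ 2 / 2 * EE P (fun w => W w * qexp2 c b a (S w))| <=
  B * ((1 + 6 * A) * (1 + 32 * A ^+ 2) * C) * e ^+ 3 * M.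
Proof.
move=> b0 bA c0 cC e0 h1 h2.
set K := (1 + 6 * A) * _ * C.
have B0 : 0 <= B by rewrite (le_trans _ (WB point)).
have K0 : 0 <= K by rewrite (le_trans _ (qexp3_bound 0 b0 bA c0 cC)).
have bd (f : T -> R) k : measurable_fun setT f -> (forall w, `|f w| <= k) ->
    forall w, `|W w * f w| <= B * k.
  by move=> mf fk w; rewrite normrM ler_pM.
have mSX : measurable_fun setT (fun w => S w + e * X w).
  by apply: measurable_funD => //; apply: measurable_funM.
have i0 : integ P (fun w => W w * qexp c b a (S w + e * X w)).
  apply: (@integ_bounded _ _ _ _ _ (B * C)).
    by apply: measurable_funM => //; exact: measurable_qexpT.
  by apply: bd; [exact: measurable_qexpT|move=> w; exact: qexp_bound].
have i1 : integ P (fun w => W w * qexp c b a (S w)).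
  apply: (@integ_bounded _ _ _ _ _ (B * C)).
    by apply: measurable_funM => //; exact: measurable_qexpT.
  by apply: bd; [exact: measurable_qexpT|move=> w; exact: qexp_bound].
have i2 : integ P (fun w => W w * qexp1 c b a (S w) * X w).
  apply: integM_bounded integ_of_cube1.
    by apply: measurable_funM => //; exact: mqexp1.
  by apply: bd; [exact: mqexp1|move=> w; exact: qexp1_bound b0 bA c0 cC].
have i3 : integ P (fun w => W w * qexp2 c b a (S w) * X w ^+ 2).
  apply: integM_bounded integ_of_cube2.
    by apply: measurable_funM => //; exact: mqexp2.
  by apply: bd; [exact: mqexp2|move=> w; exact: qexp2_bound b0 bA c0 cC].
pose rest w := W w * qexp c b a (S w + e * X w) - W w * qexp c b a (S w) -
  e * (W w * qexp1 c b a (S w) * X w) -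
  e ^+ 2 / 2 * (W w * qexp2 c b a (S w) * X w ^+ 2).
have ir : integ P rest.
  by apply: (integB (integB (integB i0 i1) (integZ e i2)) (integZ _ i3)).
have -> : EE P (fun w => W w * qexp c b a (S w + e * X w)) -
    EE P (fun w => W w * qexp c b a (S w)) -
    e ^+ 2 / 2 * EE P (fun w => W w * qexp2 c b a (S w)) = EE P rest.
  rewrite (EEB (integB (integB i0 i1) (integZ e i2)) (integZ _ i3)).
  rewrite (EEB (integB i0 i1) (integZ e i2)) (EEB i0 i1) (EEZ _ i2) (EEZ _ i3).
  by rewrite h1 h2 mulr0 subr0.
apply: (@le_trans _ _ (EE P (fun w => (B * K * e ^+ 3) * `|X w| ^+ 3))); last first.
  by rewrite EEZ// ler_wpM2l// mulr_ge0 ?exprn_ge0// mulr_ge0.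
apply: EE_norm_le => //; first exact: integZ.
move=> w; rewrite /rest.
have H := @taylor3 R (qexp c b a) (qexp1 c b a) (qexp2 c b a) (qexp3 c b a) K (S w) (e * X w)
  (is_derive_qexp0 c b a) (is_derive_qexp1 c b a) (is_derive_qexp2 c b a)
  (fun t _ => qexp3_bound _ b0 bA c0 cC).
rewrite (_ : _ - _ = W w * (qexp c b a (S w + e * X w) - (qexp c b a (S w) +
  qexp1 c b a (S w) * (e * X w) + qexp2 c b a (S w) * (e * X w) ^+ 2 / 2))); last by field.
rewrite normrM (_ : B * K * e ^+ 3 * _ = B * (K * `|e * X w| ^+ 3)).
  exact: ler_pM.
by rewrite normrM exprMn (ger0_norm e0) !mulrA.
Qed.

End taylor_expectation.

Section lindeberg_step.
Context (R : realType).

Definition heat_lip (b a : R) := (1 + 6 * b) * (1 + 32 * b ^+ 2) * heat_sup b a.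

Definition gauss_abs3 := EE (gaussian R) (fun x => `|x| ^+ 3).

Definition heat2 (b a t y : R) : R :=
  qexp2 ((Num.sqrt (1 + 2 * b * t))^-1 * expR (a ^+ 2 * t / (2 * (1 + 2 * b * t))))
    (b / (1 + 2 * b * t)) (a / (1 + 2 * b * t)) y.

Definition heat1 (b a t y : R) : R :=
  qexp1 ((Num.sqrt (1 + 2 * b * t))^-1 * expR (a ^+ 2 * t / (2 * (1 + 2 * b * t))))
    (b / (1 + 2 * b * t)) (a / (1 + 2 * b * t)) y.

(** By [heat_semigroup] the time step is an increment by [e] times a standard normal variable, to
    which [EE_taylor3] applies with [W] equal to 1 and [S] constant; no derivative in time is
    taken. *)
Lemma heat_time_step b a t e y : 0 < b -> 0 <= t -> 0 <= e ->
  `|heat b a (t + e ^+ 2) y - heat b a t y - e ^+ 2 / 2 * heat2 b a t y| <=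
  heat_lip b a * e ^+ 3 * gauss_abs3.
Proof.
move=> b0 t0 e0; rewrite -heat_semigroup//.
have i3 := integ_gaussian_norm R 3.
have i1 : integ (gaussian R) (fun x => x) by have := integ_gaussian_exp R 1.
have i2 := integ_gaussian_exp R 2.
have h1 k : EE (gaussian R) (fun w => 1 * k * w) = 0.
  by rewrite mul1r (EEZ k i1) gaussian_mean mulr0.
have h2 k : EE (gaussian R) (fun w => 1 * k * w ^+ 2) = EE (gaussian R) (fun=> 1 * k).
  by rewrite mul1r (EEZ k i2) EE_cst; case: (gaussian_moments R) => -> _; rewrite mulr1.
have n1 (w : measurableTypeR R) : `|1 : R| <= 1 by rewrite normr1.
have m1 : measurable_fun setT (fun _ : measurableTypeR R => 1 : R) by [].
have my : measurable_fun setT (fun _ : measurableTypeR R => y) by [].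
have mid : measurable_fun setT (fun x : measurableTypeR R => x : R) by exact: measurable_id.
have := EE_taylor3 (P := gaussian R) m1 n1 my mid i3 (lexx _) (heat_coef_gt0 b0 t0) (heat_coef_le b0 t0)
  (heat_scale_ge0 b a t) (heat_scale_le a b0 t0) e0 (h1 _) (h2 _).
rewrite !EE_cst !mul1r; set L := `|_|; set L' := `|_|.
rewrite (_ : L = L') // /L /L'; congr (`|EE _ _ - _ - _|).
by apply/funext => w; rewrite mul1r.
Qed.

Lemma measurable_heat d (T : measurableType d) b a t (S : T -> R) :
  measurable_fun setT S -> measurable_fun setT (fun w => heat b a t (S w)).
Proof.
move=> mS; apply: measurable_funM => //; apply: measurableT_comp => //.
by apply: measurable_funD; apply: measurable_funM => //; exact: measurable_funX.
Qed.

Lemma measurable_heat2 d (T : measurableType d) b a t (S : T -> R) :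
  measurable_fun setT S -> measurable_fun setT (fun w => heat2 b a t (S w)).
Proof.
move=> mS; apply: measurable_funM; last exact: measurable_heat.
apply: measurable_funB => //; apply: measurable_funX.
by apply: measurable_funB => //; apply: measurable_funM.
Qed.

Lemma measurable_heat1 d (T : measurableType d) b a t (S : T -> R) :
  measurable_fun setT S -> measurable_fun setT (fun w => heat1 b a t (S w)).
Proof.
move=> mS; apply: measurable_funM; last exact: measurable_heat.
by apply: measurable_funB => //; apply: measurable_funM.
Qed.

Lemma heat1_bounded b a t : 0 < b -> 0 <= t ->
  exists k, forall y, `|heat1 b a t y| <= k.
Proof.
move=> b0 t0; eexists => y.
exact: (qexp1_bound _ (heat_coef_gt0 b0 t0) (heat_coef_le b0 t0)
  (heat_scale_ge0 b a t) (heat_scale_le a b0 t0)).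
Qed.

Lemma heat2_bounded b a t : 0 < b -> 0 <= t ->
  exists k, forall y, `|heat2 b a t y| <= k.
Proof.
move=> b0 t0; eexists => y.
exact: (qexp2_bound _ (heat_coef_gt0 b0 t0) (heat_coef_le b0 t0)
  (heat_scale_ge0 b a t) (heat_scale_le a b0 t0)).
Qed.

(** Both expectations have the same expansion around time t and increment 0 up to order e^2: the
    sample increment by [EE_taylor3], the time step by [heat_time_step]. The two third-order
    remainders give [M] and [gauss_abs3]. *)
Lemma lindeberg_step d (T : measurableType d) (P : probability T R)
    (W S X : T -> R) (B M b a t e : R) :
  measurable_fun setT W -> (forall w, `|W w| <= B) ->
  measurable_fun setT S -> measurable_fun setT X ->
  integ P (fun w => `|X w| ^+ 3) -> EE P (fun w => `|X w| ^+ 3) <= M ->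
  0 < b -> 0 <= t -> 0 <= e ->
  EE P (fun w => W w * heat1 b a t (S w) * X w) = 0 ->
  EE P (fun w => W w * heat2 b a t (S w) * X w ^+ 2) =
    EE P (fun w => W w * heat2 b a t (S w)) ->
  `|EE P (fun w => W w * heat b a t (S w + e * X w)) -
    EE P (fun w => W w * heat b a (t + e ^+ 2) (S w))| <=
  B * heat_lip b a * e ^+ 3 * (M + gauss_abs3).
Proof.
move=> mW WB mS mX i3 XM b0 t0 e0 h1 h2.
have B0 : 0 <= B by rewrite (le_trans _ (WB point)).
have := EE_taylor3 mW WB mS mX i3 XM (heat_coef_gt0 b0 t0) (heat_coef_le b0 t0)
  (heat_scale_ge0 b a t) (heat_scale_le a b0 t0) e0 h1 h2.
rewrite -/(heat_lip b a) -/(heat2 b a t _) => H1.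
have iW (f : T -> R) k : measurable_fun setT f -> (forall w, `|f w| <= k) ->
    integ P (fun w => W w * f w).
  move=> mf fk; apply: (@integ_bounded _ _ _ _ _ (B * k)).
    exact: measurable_funM.
  by move=> w; rewrite normrM ler_pM.
have hb s (f : T -> R) : 0 <= s -> forall w, `|heat b a s (f w)| <= heat_sup b a.
  by move=> s0 w; rewrite ger0_norm ?heat_ge0// heat_le.
have te0 : 0 <= t + e ^+ 2 by rewrite addr_ge0 ?sqr_ge0.
have j1 := iW _ _ (measurable_heat b a (t + e ^+ 2) mS) (hb _ S te0).
have j2 := iW _ _ (measurable_heat b a t mS) (hb _ S t0).
have [k2 hk2] := heat2_bounded a b0 t0.
have j3 := iW _ _ (measurable_heat2 b a t mS) (fun w => hk2 (S w)).
have H2 : `|EE P (fun w => W w * heat b a (t + e ^+ 2) (S w)) -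
    EE P (fun w => W w * heat b a t (S w)) -
    e ^+ 2 / 2 * EE P (fun w => W w * heat2 b a t (S w))| <=
    B * heat_lip b a * e ^+ 3 * gauss_abs3.
  rewrite -(EEZ _ j3) -(EEB j1 j2) -(EEB (integB j1 j2) (integZ _ j3)).
  rewrite -[leRHS](EE_cst P); apply: EE_norm_le.
  - exact: (integB (integB j1 j2) (integZ _ j3)).
  - exact: integ_cst.
  move=> w; rewrite (_ : _ - _ = W w * (heat b a (t + e ^+ 2) (S w) -
    heat b a t (S w) - e ^+ 2 / 2 * heat2 b a t (S w))); last by ring.
  rewrite normrM -!(mulrA B) ler_pM//.
  exact: heat_time_step.
rewrite mulrDr.
move: H1 H2; set u := EE P _; set v := EE P _; set x := EE P _; set y := EE P _.
move=> H1 H2.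
rewrite (_ : u - y = (u - v - e ^+ 2 / 2 * x) - (y - v - e ^+ 2 / 2 * x)); last by ring.
by rewrite (le_trans (ler_normB _ _))// lerD.
Qed.

End lindeberg_step.

Section measurable_bigop.
Context (R : realType) d (T : measurableType d).

Lemma measurable_sum_cond (I : Type) (s : seq I) (Q : pred I) (h : I -> T -> R) :
  (forall i, Q i -> measurable_fun setT (h i)) ->
  measurable_fun setT (fun w => \sum_(i <- s | Q i) h i w).
Proof.
move=> mh; elim: s => [|i s IHs].
  by rewrite (_ : (fun _ => _) = cst 0)//; apply/funext => w; rewrite big_nil.
case: (boolP (Q i)) => Qi.
  rewrite (_ : (fun _ => _) = fun w => h i w + \sum_(i <- s | Q i) h i w).
    by apply: measurable_funD => //; exact: mh.
  by apply/funext => w; rewrite big_cons Qi.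
rewrite (_ : (fun _ => _) = fun w => \sum_(i <- s | Q i) h i w)//.
by apply/funext => w; rewrite big_cons (negbTE Qi).
Qed.

Lemma measurable_prod_cond (I : Type) (s : seq I) (Q : pred I) (h : I -> T -> R) :
  (forall i, Q i -> measurable_fun setT (h i)) ->
  measurable_fun setT (fun w => \prod_(i <- s | Q i) h i w).
Proof.
move=> mh; elim: s => [|i s IHs].
  by rewrite (_ : (fun _ => _) = cst 1)//; apply/funext => w; rewrite big_nil.
case: (boolP (Q i)) => Qi.
  rewrite (_ : (fun _ => _) = fun w => h i w * \prod_(i <- s | Q i) h i w).
    by apply: measurable_funM => //; exact: mh.
  by apply/funext => w; rewrite big_cons Qi.
rewrite (_ : (fun _ => _) = fun w => \prod_(i <- s | Q i) h i w)//.
by apply/funext => w; rewrite big_cons (negbTE Qi).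
Qed.

End measurable_bigop.

(** * Lindeberg's replacement argument for grouped sums *)

Section lindeberg_chain.
Context (R : realType) d (T : measurableType d) (P : probability T R).
Context (I J : finType) d' (T' : measurableType d') (X : I -> T -> T').
Hypothesis mX : forall i, measurable_fun setT (X i).
Hypothesis indepX : mutually_independent P X.
Variables (g : I -> T' -> R) (M : R).
Hypothesis mg : forall i, measurable_fun setT (g i).
Hypothesis ig3 : forall i, integ P (fun w => `|g i (X i w)| ^+ 3).
Hypothesis g3M : forall i, EE P (fun w => `|g i (X i w)| ^+ 3) <= M.
Hypothesis g1 : forall i, EE P (fun w => g i (X i w)) = 0.
Hypothesis g2 : forall i, EE P (fun w => g i (X i w) ^+ 2) = 1.
Variables (grp : I -> J) (e a : J -> R) (b : R).
Hypotheses (e0 : forall j, 0 <= e j) (b0 : 0 < b).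

Definition partial_sum (A : {set I}) j w : R :=
  \sum_(i | (i \in A) && (grp i == j)) e j * g i (X i w).

Definition remaining_time (A : {set I}) j : R :=
  \sum_(i | (i \notin A) && (grp i == j)) e j ^+ 2.

(** The variables indexed by [A] are kept; the others are already replaced by Gaussian ones and
    integrated out, which leaves only their total variance, in the form of heat time. *)
Definition interpolation (A : {set I}) : R :=
  EE P (fun w => \prod_j heat b (a j) (remaining_time A j) (partial_sum A j w)).

Let mgX i : measurable_fun setT (fun w => g i (X i w)).
Proof. exact: measurableT_comp. Qed.

Let past_partial_sum A j :
  measurable_fun setT (partial_sum A j : past X A -> R).
Proof.
apply: measurable_sum_cond => i /andP[iA _]; apply: measurable_funM => //.
by apply: measurableT_comp => //; exact: past_measurable.
Qed.

Let measurable_partial_sum A j : measurable_fun setT (partial_sum A j).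
Proof.
by apply: measurable_sum_cond => i /andP[iA _]; apply: measurable_funM.
Qed.

Let remaining_ge0 A j : 0 <= remaining_time A j.
Proof. by apply: sumr_ge0 => i _; rewrite sqr_ge0. Qed.

(** A third-derivative bound for the group being changed times the suprema of the other groups; the
    value is the same for every group because all share [b]. *)
Definition chain_const := (1 + 6 * b) * (1 + 32 * b ^+ 2) * \prod_j heat_sup b (a j).

(** Adding [s] affects only its own group: the partial sum gains a term and the time loses the
    variance of that term. Everything else is measurable for the past [A], hence independent of
    [X s]. *)
Lemma interpolation_step (A : {set I}) s : s \notin A ->
  `|interpolation (s |: A) - interpolation A| <=
  chain_const * (M + gauss_abs3 R) * e (grp s) ^+ 3.
Proof.
move=> sA; set j0 := grp s; set A' := s |: A.
pose W w := \prod_(j | j != j0) heat b (a j) (remaining_time A j) (partial_sum A j w).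
pose t := remaining_time A' j0.
have sumE w : partial_sum A' j0 w = partial_sum A j0 w + e j0 * g s (X s w).
  rewrite /partial_sum (bigD1 s) ?inE ?eqxx//= addrC; congr (_ + _).
  apply: eq_bigl => i; rewrite !inE; case: (eqVneq i s) => [->|_] /=.
    by rewrite (negbTE sA) !andbF.
  by rewrite andbT.
have timeE : remaining_time A j0 = t + e j0 ^+ 2.
  rewrite /t /remaining_time (bigD1 s) ?sA ?eqxx//= addrC; congr (_ + _).
  apply: eq_bigl => i; rewrite !inE; case: (eqVneq i s) => [->|_] /=.
    by rewrite !andbF.
  by rewrite andbT.
have sumN j w : j != j0 -> partial_sum A' j w = partial_sum A j w.
  move=> jj0; apply: eq_bigl => i; rewrite !inE.
  case: (eqVneq i s) => [->|//] /=.
  by rewrite (negbTE sA) /= -/j0 eq_sym (negbTE jj0).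
have timeN j : j != j0 -> remaining_time A' j = remaining_time A j.
  move=> jj0; apply: eq_bigl => i; rewrite !inE.
  case: (eqVneq i s) => [->|//] /=.
  by rewrite sA /= -/j0 eq_sym (negbTE jj0).
have -> : interpolation A' = EE P (fun w => W w *
    heat b (a j0) t (partial_sum A j0 w + e j0 * g s (X s w))).
  congr EE; apply/funext => w; rewrite (bigD1 j0)//= mulrC sumE; congr (_ * _).
  by apply: eq_bigr => j jj0; rewrite sumN// timeN.
have -> : interpolation A = EE P (fun w => W w *
    heat b (a j0) (t + e j0 ^+ 2) (partial_sum A j0 w)).
  by congr EE; apply/funext => w; rewrite (bigD1 j0)//= mulrC timeE.
pose B := \prod_(j | j != j0) heat_sup b (a j).
have W0 w : 0 <= W w by apply: prodr_ge0 => j _; exact: heat_ge0.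
have WB w : `|W w| <= B.
  rewrite ger0_norm//; apply: ler_prod => j _; rewrite heat_ge0/=.
  exact: heat_le.
have pW : measurable_fun setT (W : past X A -> R).
  by apply: measurable_prod_cond => j _; exact: measurable_heat.
have mW := past_measurable_fun mX pW.
have t0 : 0 <= t := remaining_ge0 A' j0.
have CE : chain_const = B * heat_lip b (a j0).
  rewrite /chain_const (bigD1 j0)//= /heat_lip /B; ring.
rewrite CE mulrAC; apply: lindeberg_step => //.
- have [k hk] := heat1_bounded (a j0) b0 t0.
  rewrite (@EE_past_bounded _ _ _ _ _ _ _ _ mX indepX A s
    (fun w => W w * heat1 b (a j0) t (partial_sum A j0 w)) (g s) (B * k))//.
  + by rewrite [X in _ * X]g1 mulr0.
  + by apply: measurable_funM => //; exact: measurable_heat1.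
  + by move=> w; rewrite normrM ler_pM.
  + exact: (integ_of_cube1 (mgX s) (ig3 s)).
- have [k hk] := heat2_bounded (a j0) b0 t0.
  rewrite (@EE_past_bounded _ _ _ _ _ _ _ _ mX indepX A s
    (fun w => W w * heat2 b (a j0) t (partial_sum A j0 w)) (fun x => g s x ^+ 2) (B * k))//.
  + by rewrite [X in _ * X]g2 mulr1.
  + by apply: measurable_funM => //; exact: measurable_heat2.
  + exact: measurable_funX.
  + by move=> w; rewrite normrM ler_pM.
  + exact: (integ_of_cube2 (mgX s) (ig3 s)).
Qed.

(** Telescopes [interpolation_step] over an enumeration of the indices: for the full set no time
    remains, for the empty set all partial sums are 0. *)
Lemma lindeberg :
  `|EE P (fun w => \prod_j
      expR (- b * (\sum_(i | grp i == j) e j * g i (X i w)) ^+ 2 +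
            a j * \sum_(i | grp i == j) e j * g i (X i w))) -
    \prod_j heat b (a j) (\sum_(i | grp i == j) e j ^+ 2) 0| <=
  chain_const * (M + gauss_abs3 R) * \sum_i e (grp i) ^+ 3.
Proof.
have key (l : seq I) : uniq l ->
    `|interpolation [set i in l] - interpolation finset.set0| <=
    chain_const * (M + gauss_abs3 R) * \sum_(i <- l) e (grp i) ^+ 3.
  elim: l => [_|i l IHl /= /andP[il ul]].
    by rewrite finset.set_nil subrr normr0 big_nil mulr0.
  rewrite finset.set_cons big_cons mulrDr.
  rewrite (le_trans _ (lerD (@interpolation_step [set i in l] i _) (IHl ul)))//.
    by rewrite (le_trans _ (ler_normD _ _))// addrA subrK.
  by rewrite inE.
have := key (enum I) (enum_uniq I).
rewrite (_ : [set i in enum I] = finset.setT); last first.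
  by apply/setP => i; rewrite !inE mem_enum.
rewrite big_enum/=; congr (`|_ - _| <= _).
- congr EE; apply/funext => w; apply: eq_bigr => j _.
  rewrite (_ : remaining_time _ _ = 0) ?heat0; last first.
    by rewrite /remaining_time big_pred0// => i; rewrite !inE.
  rewrite (_ : partial_sum _ _ _ = \sum_(i | grp i == j) e j * g i (X i w))//.
  by apply: eq_bigl => i; rewrite !inE.
- rewrite /interpolation (_ : (fun w => _) = fun=> \prod_j heat b (a j)
    (\sum_(i | grp i == j) e j ^+ 2) 0) ?EE_cst//.
  apply/funext => w; apply: eq_bigr => j _; congr heat.
    by apply: eq_bigl => i; rewrite !inE.
  by rewrite /partial_sum big_pred0// => i; rewrite !inE.
Qed.

End lindeberg_chain.

(** * Laplace transforms *)

Section fubini_EE.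
Context (R : realType) d1 d2 (T1 : measurableType d1) (T2 : measurableType d2).
Variables (P1 : probability T1 R) (P2 : probability T2 R) (F : T1 -> T2 -> R).
Hypothesis mF : measurable_fun setT (fun z : T1 * T2 => F z.1 z.2).
Hypothesis F0 : forall x y, 0 <= F x y.
Hypothesis iF1 : forall y, integ P1 (F ^~ y).
Hypothesis iF2 : forall x, integ P2 (F x).

Let mFE : measurable_fun setT (fun z : T1 * T2 => (F z.1 z.2)%:E).
Proof. exact/measurable_EFinP. Qed.

Let FE0 (z : T1 * T2) : (0 <= (F z.1 z.2)%:E)%E.
Proof. by rewrite lee_fin. Qed.

Lemma EE_fubini : EE P1 (fun x => EE P2 (F x)) = EE P2 (fun y => EE P1 (F ^~ y)).
Proof.
rewrite {1 3}/EE /Rintegral; congr fine.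
under eq_integral do rewrite EE_EFin//.
under [in RHS]eq_integral do rewrite EE_EFin//.
exact: (@fubini_tonelli _ _ _ _ _ P1 P2 _ mFE FE0).
Qed.

Lemma measurable_EE_param : measurable_fun setT (fun y => EE P1 (F ^~ y)).
Proof.
apply/measurable_EFinP.
rewrite (_ : _ \o _ = fubini_G P1 (fun z : T1 * T2 => (F z.1 z.2)%:E)); last first.
  by apply/funext => y; rewrite /= EE_EFin.
exact: measurable_fun_fubini_tonelli_G.
Qed.

End fubini_EE.

Lemma EE_dominated_cvg (R : realType) d (T : measurableType d) (P : probability T R)
    (f : nat -> T -> R) (l g : T -> R) :
  (forall m, measurable_fun setT (f m)) -> integ P g ->
  (forall m x, `|f m x| <= g x) ->
  (forall x, f m x @[m --> \oo] --> l x) ->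
  EE P (f m) @[m --> \oo] --> EE P l.
Proof.
move=> mf ig fg fl.
have := @dominated_convergence _ T R P setT measurableT
  (fun m x => (f m x)%:E) (EFin \o l) (EFin \o g).
have ml : measurable_fun setT l.
  apply: (measurable_fun_cvg (h := f)) => // x _; exact: fl.
case.
- by move=> m; apply/measurable_EFinP.
- exact/measurable_EFinP.
- by apply: aeW => x _; apply: cvg_EFin; [exact: nearW|exact: fl].
- exact: ig.
- by apply: aeW => x m _; rewrite lee_fin.
move=> il _ h.
have il' : integ P l by exact: il.
rewrite -(EE_EFin il') in h.
by have := fine_cvg h; apply.
Qed.

(** * Linearization of the quadratic form *)

Section hubbard_stratonovich.
Context (R : realType) (J : finType).
Variables (s : J -> R) (lam eps : R).
Hypothesis s1 : \sum_j s j ^+ 2 = 1.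

(* The term [eps] makes the envelope of the linearized integrand integrable. *)
Definition penalized_exp (y : J -> R) : R :=
  expR (- lam * (\sum_j y j ^+ 2 - (\sum_j s j * y j) ^+ 2) - eps * \sum_j y j ^+ 2).

Let slope (h : R) j := Num.sqrt (2 * lam) * h * s j.

Let kernel (h : R) (y : J -> R) : R :=
  \prod_j expR (- (lam + eps) * y j ^+ 2 + slope h j * y j).

Let kernelE h y : kernel h y = expR (- (lam + eps) * \sum_j y j ^+ 2) *
  expR (Num.sqrt (2 * lam) * (\sum_j s j * y j) * h).
Proof.
rewrite /kernel -expRD -expR_sum; congr expR.
rewrite big_split /= -mulr_sumr; congr (_ + _).
by rewrite mulr_sumr mulr_suml; apply: eq_bigr => j _; rewrite /slope; ring.
Qed.

(* The Hubbard-Stratonovich transformation: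
   expR (lam * v ^+ 2) = E expR (sqrt (2 * lam) * v * h) for [h] standard normal. *)
Lemma penalized_expE y : 0 <= lam -> penalized_exp y = EE (gaussian R) (fun h => kernel h y).
Proof.
move=> lam0.
set v := \sum_j s j * y j.
have hb : - 1 < 2 * (0 : R) by rewrite mulr0 ltrN10.
rewrite (_ : (fun h => _) = (fun h => expR (- (lam + eps) * \sum_j y j ^+ 2) *
    expR (- 0 * h ^+ 2 + Num.sqrt (2 * lam) * v * h))); last first.
  by apply/funext => h; rewrite kernelE oppr0 mul0r add0r.
rewrite EEZ; last exact: integ_gaussian_qexp.
rewrite EE_gaussian_qexp// mulr0 addr0 sqrtr1 invr1 mul1r mulr1 -expRD.
rewrite /penalized_exp -/v; congr expR.
rewrite exprMn sqr_sqrtr ?mulr_ge0//.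
by field.
Qed.

Lemma kernel_integ y : integ (gaussian R) (fun h => kernel h y).
Proof.
rewrite (_ : (fun h => _) = (fun h => expR (- (lam + eps) * \sum_j y j ^+ 2) *
    expR (- 0 * h ^+ 2 + Num.sqrt (2 * lam) * (\sum_j s j * y j) * h))); last first.
  by apply/funext => h; rewrite kernelE oppr0 mul0r add0r.
by apply: integZ; apply: integ_gaussian_qexp; rewrite mulr0 ltrN10.
Qed.

Let sum_slope h : 0 <= lam -> \sum_j slope h j ^+ 2 = 2 * lam * h ^+ 2.
Proof.
move=> lam0; rewrite /slope; under eq_bigr do rewrite exprMn.
rewrite -mulr_sumr s1 mulr1 exprMn sqr_sqrtr ?mulr_ge0//.
Qed.

Let envelope (h : R) := expR (- (- (lam / (2 * (lam + eps)))) * h ^+ 2 + 0 * h).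

Let prod_sup h : 0 <= lam -> 0 < eps ->
  \prod_j heat_sup (lam + eps) (slope h j) = envelope h.
Proof.
move=> lam0 e0; rewrite /heat_sup -expR_sum -mulr_suml sum_slope//.
rewrite /envelope; congr expR; rewrite mul0r addr0; field.
by rewrite gt_eqF// ltr_wpDl.
Qed.

(** The coefficient lam / (2 (lam + eps)) of h^2 stays below the 1/2 of the normal density exactly
    because [eps] is positive. *)
Let envelope_integ : 0 <= lam -> 0 < eps -> integ (gaussian R) envelope.
Proof.
move=> lam0 e0; apply: integ_gaussian_qexp.
have b0 : 0 < lam + eps by rewrite ltr_wpDl.
rewrite mulrN ltrN2 (_ : 2 * (lam / (2 * (lam + eps))) = lam / (lam + eps)).
  by rewrite ltr_pdivrMr// mul1r ltrDl.
by field; rewrite gt_eqF.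
Qed.

Lemma kernel_bound h y : 0 <= lam -> 0 < eps -> `|kernel h y| <= envelope h.
Proof.
move=> lam0 e0; rewrite ger0_norm; last by apply: prodr_ge0 => j _; exact: expR_ge0.
rewrite -prod_sup//; apply: ler_prod => j _; rewrite expR_ge0 /=.
rewrite -heat0 heat_le// ltr_wpDl//.
Qed.

Let limit_heatE h : 0 <= lam -> 0 < eps ->
  \prod_j heat (lam + eps) (slope h j) 1 0 =
  (Num.sqrt (1 + 2 * (lam + eps)))^-1 ^+ #|J| *
  expR (- (- (lam / (1 + 2 * (lam + eps)))) * h ^+ 2 + 0 * h).
Proof.
move=> lam0 e0; under eq_bigr do rewrite heat_at0 !mulr1.
rewrite big_split /= prodr_const -expR_sum -mulr_suml sum_slope//; congr (_ * expR _).
rewrite mul0r addr0; field.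
by rewrite gt_eqF// ltr_wpDr// ?mulr_ge0 ?addr_ge0// ltW.
Qed.

(** After Fubini the inner expectation at fixed h is the one of the hypothesis, and dominated
    convergence in h concludes. The limit is that of a standard normal vector: the direction [s]
    contributes (1 + 2 eps)^(-1/2), each of the remaining orthogonal directions (1 + 2 (lam +
    eps))^(-1/2). *)
Lemma penalized_exp_cvg (d : nat -> measure_display) (T : forall m, measurableType (d m))
    (P : forall m, probability (T m) R) (Y : forall m, J -> T m -> R) :
  0 <= lam -> 0 < eps ->
  (forall m j, measurable_fun setT (Y m j)) ->
  (forall a : J -> R, EE (P m) (fun w => \prod_j
      expR (- (lam + eps) * Y m j w ^+ 2 + a j * Y m j w)) @[m --> \oo] -->
    \prod_j heat (lam + eps) (a j) 1 0) ->
  EE (P m) (fun w => penalized_exp (Y m ^~ w)) @[m --> \oo] -->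
  (Num.sqrt (1 + 2 * (lam + eps)))^-1 ^+ #|J| *
  (Num.sqrt ((1 + 2 * eps) / (1 + 2 * (lam + eps))))^-1.
Proof.
move=> lam0 e0 mY hY.
have D0 : 0 < 1 + 2 * (lam + eps).
  by rewrite ltr_wpDr// mulr_ge0 ?addr_ge0// ltW.
have mker m : measurable_fun setT
    (fun z : T m * measurableTypeR R => kernel z.2 (Y m ^~ z.1)).
  apply: measurable_prod_cond => j _; apply: measurableT_comp => //.
  have mYj : measurable_fun setT (fun z : T m * measurableTypeR R => Y m j z.1).
    by apply: measurableT_comp => //; exact: measurable_fst.
  apply: measurable_funD; apply: measurable_funM => //; first exact: measurable_funX.
  apply: measurable_funM => //; apply: measurable_funM => //; exact: measurable_snd.
have ker0 h y : 0 <= kernel h y by apply: prodr_ge0 => j _; exact: expR_ge0.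
have mk m h : measurable_fun setT (fun w => kernel h (Y m ^~ w)).
  apply: measurable_prod_cond => j _; apply: measurableT_comp => //.
  by apply: measurable_funD; apply: measurable_funM => //; exact: measurable_funX.
have ik1 m h : integ (P m) (fun w => kernel h (Y m ^~ w)).
  apply: (@integ_bounded _ _ _ _ _ (envelope h)); first exact: mk.
  by move=> w; exact: kernel_bound.
have -> : (fun m => EE (P m) (fun w => penalized_exp (Y m ^~ w))) =
    (fun m => EE (gaussian R) (fun h => EE (P m) (fun w => kernel h (Y m ^~ w)))).
  apply/funext => m.
  transitivity (EE (P m) (fun w => EE (gaussian R) (fun h => kernel h (Y m ^~ w)))).
    by congr EE; apply/funext => w; rewrite penalized_expE.
  apply: (@EE_fubini _ _ _ _ _ (P m) (gaussian R) (fun w h => kernel h (Y m ^~ w))) => //.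
  by move=> w; exact: kernel_integ.
have -> : (Num.sqrt (1 + 2 * (lam + eps)))^-1 ^+ #|J| *
  (Num.sqrt ((1 + 2 * eps) / (1 + 2 * (lam + eps))))^-1 =
  EE (gaussian R) (fun h => \prod_j heat (lam + eps) (slope h j) 1 0).
  have hb : - 1 < 2 * - (lam / (1 + 2 * (lam + eps))).
    rewrite mulrN ltrN2 mulrA ltr_pdivrMr// mul1r; lra.
  under eq_fun do rewrite limit_heatE//.
  rewrite EEZ; last exact: integ_gaussian_qexp.
  rewrite EE_gaussian_qexp// expr0n/= mul0r expR0 mulr1.
  congr (_ * (Num.sqrt _)^-1); field.
  by rewrite gt_eqF.
apply: (EE_dominated_cvg _ (envelope_integ lam0 e0)).
- move=> m; exact: (measurable_EE_param (mker m) (fun w h => ker0 h (Y m ^~ w)) (ik1 m)).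
- move=> m h; apply: EE_norm_bounded; first exact: mk.
  by move=> w; exact: kernel_bound.
- by move=> h; exact: hY.
Qed.

End hubbard_stratonovich.

(** * From Laplace transforms to distribution functions *)

Section smooth_step.
Context (R : realType).

(* [step a N] is a polynomial in [expR (- N * ln 2 / a * z)] which tends, as [N] tends to
   infinity, to the indicator function of [z < a] on [0, +oo[, away from [z = a]. *)
Definition step (a : R) (N : nat) (z : R) : R :=
  1 - (1 - expR (- (N%:R * ln 2 / a) * z)) ^+ (2 ^ N).

Lemma expRN_le_inv (v : R) : 0 < v -> expR (- v) <= v^-1.
Proof.
move=> v0; rewrite expRN lef_pV2 ?posrE ?expR_gt0//.
by rewrite (le_trans _ (expR_ge1Dx v))// lerDr.
Qed.

Lemma bernoulli (u : R) k : 0 <= u <= 1 -> 1 - k%:R * u <= (1 - u) ^+ k.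
Proof.
move=> /andP[u0 u1]; elim: k => [|k IHk]; first by rewrite mul0r subr0 expr0.
rewrite exprS.
apply: (@le_trans _ _ ((1 - u) * (1 - k%:R * u))); last by rewrite ler_wpM2l// subr_ge0.
rewrite -subr_ge0 -natr1 (_ : _ - _ = k%:R * (u * u)); last by ring.
by rewrite mulr_ge0// mulr_ge0.
Qed.

Lemma step_exp_itv (a z : R) N : 0 < a -> 0 <= z ->
  0 < expR (- (N%:R * ln 2 / a) * z) <= 1.
Proof.
move=> a0 z0; rewrite expR_gt0 /= expR_le1 mulNr oppr_le0.
by rewrite mulr_ge0// divr_ge0 ?(ltW a0)// mulr_ge0// ln_ge0// ler1n.
Qed.

Lemma step_itv (a z : R) N : 0 < a -> 0 <= z -> 0 <= step a N z <= 1.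
Proof.
move=> a0 z0; have /andP[/ltW u0 u1] := step_exp_itv N a0 z0.
rewrite /step subr_ge0 lerBlDr lerDl exprn_ge0 ?subr_ge0// andbT.
by rewrite exprn_ile1 ?subr_ge0// lerBlDr lerDl.
Qed.

(** For large N this product is large if z < a and small if z > a. With M = 2^N and u the
    exponential, the first case is used through (1 - u)^M <= expR (- M u) in [step_ge], the second
    through Bernoulli's inequality in [step_le]. *)
Lemma pow2_step_exp (a z : R) N : 0 < a ->
  (2 ^ N)%:R * expR (- (N%:R * ln 2 / a) * z) = expR (N%:R * ln 2 * (1 - z / a)).
Proof.
move=> a0; rewrite -[(2 ^ N)%:R]lnK; last by rewrite posrE ltr0n expn_gt0.
rewrite -expRD natrX lnXn ?ltr0n// -mulr_natl; congr expR.
by field; rewrite gt_eqF.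
Qed.

Lemma step_ge (a x z : R) N : (0 < N)%N -> 0 < a -> x < a -> 0 <= z -> z <= x ->
  1 - expR (- (N%:R * ln 2 * (1 - x / a))) <= step a N z.
Proof.
move=> N0 a0 xa z0 zx; rewrite lerD2l lerN2.
have /andP[u0 u1] := step_exp_itv N a0 z0.
have h := pow2_step_exp z N a0.
move: u0 u1 h; set u := expR (_ * z) => u0 u1 h.
apply: (@le_trans _ _ (expR (- u) ^+ (2 ^ N))).
  apply: lerXn2r; rewrite ?nnegrE ?subr_ge0 ?expR_ge0//.
  exact: expR_ge1Dx.
rewrite -expRM_natl mulrN h.
apply: (le_trans (expRN_le_inv (expR_gt0 _))).
rewrite -expRN ler_expR lerN2 ler_wpM2l ?mulr_ge0 ?ln_ge0 ?ler1n//.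
by rewrite lerD2l lerN2 ler_wpM2r// invr_ge0 ltW.
Qed.

Lemma step_le (a x z : R) N : 0 < a -> a < x -> x <= z ->
  step a N z <= expR (- (N%:R * ln 2 * (x / a - 1))).
Proof.
move=> a0 ax xz; have z0 : 0 <= z by rewrite (le_trans _ xz)// (le_trans _ (ltW ax))// ltW.
have /andP[u0 u1] := step_exp_itv N a0 z0.
have h := pow2_step_exp z N a0.
rewrite /step; move: u0 u1 h; set u := expR (_ * z) => u0 u1 h.
have := @bernoulli u (2 ^ N); rewrite (ltW u0) u1 h => /(_ isT).
rewrite lerBlDr -lerBlDl => h2; apply: (le_trans h2).
rewrite ler_expR -[leRHS]mulrN ler_wpM2l ?mulr_ge0 ?ln_ge0 ?ler1n//.
by rewrite opprB lerD2l lerN2 ler_wpM2r// invr_ge0 ltW.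
Qed.

Lemma expRN_nat_small (th z : R) : 0 < th -> 0 < z ->
  exists N, (0 < N)%N /\ expR (- (N%:R * ln 2 * th)) <= z.
Proof.
move=> th0 z0; pose c := ln 2 * th * z.
have l2 : 0 < ln 2 :> R by rewrite ln_gt0// ltr1n.
have c0 : 0 < c by rewrite !mulr_gt0.
have cV0 : 0 < c^-1 by rewrite invr_gt0.
have hN := archi_boundP (ltW cV0); set N := Num.bound _ in hN.
have N0 : 0 < N%:R :> R by exact: lt_trans hN.
exists N; split; first by rewrite -(ltr0n R).
apply: (le_trans (expRN_le_inv _)); first by rewrite !mulr_gt0.
rewrite -[leLHS]mul1r ler_pdivrMr ?mulr_gt0//.
rewrite (_ : z * _ = N%:R * c); last by rewrite /c; ring.
by rewrite -ler_pdivrMr// mul1r ltW.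
Qed.

Lemma step_poly (a z : R) N : step a N z = 1 - \sum_(i < (2 ^ N).+1)
  ((-1) ^+ i *+ 'C(2 ^ N, i)) * expR (- ((i * N)%:R * ln 2 / a) * z).
Proof.
rewrite /step exprDn; congr (_ - _); apply: eq_bigr => i _.
rewrite expr1n mul1r [in LHS]exprNn -expRM_natl -mulrnAl; congr (_ * expR _).
by rewrite natrM; ring.
Qed.

End smooth_step.

Section laplace_to_cdf.
Context (R : realType).

Section one_measure.
Context d (T : measurableType d) (P : probability T R) (Z : T -> R).
Hypotheses (mZ : measurable_fun setT Z) (Z0 : forall w, 0 <= Z w).

Let mexp c : measurable_fun setT (fun w => expR (c * Z w)).
Proof. by apply: measurableT_comp => //; exact: measurable_funM. Qed.

Lemma integ_expRN (c : R) : 0 <= c -> integ P (fun w => expR (- c * Z w)).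
Proof.
move=> c0; apply: (@integ_bounded _ _ _ _ _ 1); first exact: mexp.
by move=> w; rewrite ger0_norm ?expR_ge0// expR_le1 mulNr oppr_le0 mulr_ge0.
Qed.

Let mstep (a : R) N : measurable_fun setT (fun w => step a N (Z w)).
Proof. by apply: measurable_funB => //; apply: measurable_funX; apply: measurable_funB. Qed.

Lemma integ_step (a : R) N : 0 < a -> integ P (fun w => step a N (Z w)).
Proof.
move=> a0; apply: (@integ_bounded _ _ _ _ _ 1); first exact: mstep.
by move=> w; have /andP[h0 h1] := step_itv N a0 (Z0 w); rewrite ger0_norm.
Qed.

Lemma measurable_sublevel x : measurable [set w | Z w <= x].
Proof.
have -> : [set w | Z w <= x] = Z @^-1` `]-oo, x].
  by apply/seteqP; split => w /=; rewrite in_itv.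
by rewrite -[X in measurable X]setTI; exact: mZ.
Qed.

Lemma sublevel_le_step (a x : R) N : (0 < N)%N -> 0 < a -> x < a ->
  fine (P [set w | Z w <= x]) <=
  EE P (fun w => step a N (Z w)) + expR (- (N%:R * ln 2 * (1 - x / a))).
Proof.
move=> N0 a0 xa; have mA := measurable_sublevel x.
rewrite -EE_indic// -[X in _ <= _ + X](EE_cst P) -EED ?integ_cst ?integ_step//.
apply: EE_le; first exact: integ_indic.
  by apply: integD; [exact: integ_step|exact: integ_cst].
move=> w; rewrite indicE; case: (boolP (w \in _)) => [|_] /=.
  by rewrite inE /= => Zx; rewrite -lerBlDr step_ge.
by rewrite addr_ge0 ?expR_ge0//; have /andP[] := step_itv N a0 (Z0 w).
Qed.

Lemma step_le_sublevel (a x : R) N : 0 < a -> a < x ->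
  EE P (fun w => step a N (Z w)) <=
  fine (P [set w | Z w <= x]) + expR (- (N%:R * ln 2 * (x / a - 1))).
Proof.
move=> a0 xa; have mA := measurable_sublevel x.
rewrite -EE_indic// -[X in _ <= _ + X](EE_cst P) -EED ?integ_cst ?integ_indic//.
apply: EE_le; first exact: integ_step.
  by apply: integD; [exact: integ_indic|exact: integ_cst].
move=> w; rewrite indicE; case: (boolP (w \in _)) => [_|] /=.
  by rewrite (@le_trans _ _ 1)// ?lerDl ?expR_ge0//; have /andP[] := step_itv N a0 (Z0 w).
rewrite notin_setE /= => /negP; rewrite -ltNge => /ltW xZ.
by rewrite add0r; exact: step_le.
Qed.

Lemma EE_step (a : R) N : 0 < a -> EE P (fun w => step a N (Z w)) =
  1 - \sum_(i < (2 ^ N).+1) ((-1) ^+ i *+ 'C(2 ^ N, i)) *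
    EE P (fun w => expR (- ((i * N)%:R * ln 2 / a) * Z w)).
Proof.
move=> a0.
have c0 i : 0 <= (i * N)%:R * ln 2 / a.
  by rewrite divr_ge0 ?(ltW a0)// mulr_ge0// ln_ge0// ler1n.
under eq_fun do rewrite step_poly.
rewrite EEB; [|exact: integ_cst|]; last first.
  by apply: integ_sum => i _; apply: integZ; exact: integ_expRN.
rewrite EE_cst EE_sum; last by move=> i; apply: integZ; exact: integ_expRN.
by congr (_ - _); apply: eq_bigr => i _; rewrite EEZ//; exact: integ_expRN.
Qed.

End one_measure.

(** Expectations of [step] are finite combinations of Laplace transforms, hence converge. They are
    squeezed between distribution functions at two levels y < y', so the prelimit at y is bounded by
    the limit at y' and conversely; at a continuity point the gap closes. The absolute value keeps
    the integrand bounded also on the half-line of measure 0. *)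
Theorem laplace_cvg_in_distribution (d : nat -> measure_display)
    (T : forall m, measurableType (d m)) (P : forall m, probability (T m) R)
    (Y : forall m, T m -> R) (Q : probability (measurableTypeR R) R) :
  (forall m, measurable_fun setT (Y m)) -> (forall m w, 0 <= Y m w) ->
  Q `]-oo, 0[%classic = 0%E ->
  (forall lam, 0 < lam -> EE (P m) (fun w => expR (- lam * Y m w)) @[m --> \oo] -->
    EE Q (fun x => expR (- lam * `|x|))) ->
  cvg_in_distribution P Y Q.
Proof.
move=> mY Y0 Q0 hL x cx.
have mabs : measurable_fun setT (fun x : measurableTypeR R => `|x| : R).
  exact: normr_measurable.
have abs0 (y : measurableTypeR R) : 0 <= `|y| :> R by [].
pose F m (y : R) := fine (P m [set w | Y m w <= y]).
pose G (y : R) := fine (Q [set z | `|z| <= y]).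
pose H (y : R) := fine (Q `]-oo, y]%classic).
have mabsle (y : R) : measurable [set z : measurableTypeR R | `|z| <= y].
  exact: (measurable_sublevel mabs).
have Hneg (y : R) : y < 0 -> H y = 0.
  move=> y0; rewrite /H (_ : Q _ = 0%E)//; apply/eqP.
  rewrite -measure_le0 -Q0; apply: le_measure; rewrite ?inE//.
  by move=> z /=; rewrite !in_itv /= => zy; exact: le_lt_trans y0.
have HG (y : R) : 0 <= y -> H y = G y.
  move=> y0; rewrite /H /G; congr fine; apply/eqP; rewrite eq_le; apply/andP; split.
    apply: (@le_trans _ _ (Q ([set z | `|z| <= y] `|` `]-oo, 0[))).
      apply: le_measure; rewrite ?inE//; first exact: measurableU.
      move=> z /=; rewrite !in_itv /= => zy.
      by have [z0|z0] := leP 0 z; [left; rewrite ger0_norm|right].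
    have mneg : measurable (`]-oo, 0[%classic : set (measurableTypeR R)) by [].
    apply: (le_trans (measureU2 Q (mabsle y) mneg)).
    rewrite -[leRHS]adde0; apply: leeD => //.
    by rewrite le_eqVlt; apply/orP; left; apply/eqP; exact: Q0.
  apply: le_measure; rewrite ?inE//.
  by move=> z /=; rewrite in_itv /=; apply: le_trans (ler_norm z).
have stepc a N : 0 < a -> EE (P m) (fun w => step a N (Y m w)) @[m --> \oo] -->
    EE Q (fun z => step a N `|z|).
  move=> a0; rewrite (EE_step Q mabs abs0 N a0).
  rewrite (_ : (fun m => _) = fun m => 1 - \sum_(i < (2 ^ N).+1)
      ((-1) ^+ i *+ 'C(2 ^ N, i)) *
      EE (P m) (fun w => expR (- ((i * N)%:R * ln 2 / a) * Y m w))); last first.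
    by apply/funext => m; rewrite EE_step.
  apply: cvgB; first exact: cvg_cst.
  apply: cvg_big => [|i _]; first exact: add_continuous.
  apply: cvgM; first exact: cvg_cst.
  set c := _ / a.
  have : 0 <= c by rewrite divr_ge0 ?(ltW a0)// mulr_ge0// ln_ge0// ler1n.
  (* The constant term of the expansion has c = 0, outside the range of the hypothesis on Laplace
     transforms. *)
  rewrite le_eqVlt => /predU1P[<-|c0]; last exact: hL.
  have e1 d' (T' : measurableType d') (P' : probability T' R) (f : T' -> R) :
      EE P' (fun w => expR (- 0 * f w)) = 1.
    by under eq_fun do rewrite oppr0 mul0r expR0; rewrite EE_cst.
  by under eq_fun do rewrite e1; rewrite e1; exact: cvg_cst.
have middle (y y' : R) : 0 <= y -> y < y' -> exists2 a, 0 < a & y < a < y'.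
  move=> y0 yy'; exists ((y + y') / 2); first by rewrite divr_gt0// ltr_wpDl// (le_lt_trans y0).
  by rewrite !midf_lt.
have thetas (a y y' : R) : 0 < a -> y < a < y' -> 0 < 1 - y / a /\ 0 < y' / a - 1.
  move=> a0 /andP[ya ay']; rewrite !subr_gt0 ltr_pdivrMr// ltr_pdivlMr// mul1r.
  by split.
have small (a y y' z : R) : 0 < a -> y < a < y' -> 0 < z -> exists N, [/\ (0 < N)%N,
    expR (- (N%:R * ln 2 * (1 - y / a))) <= z & expR (- (N%:R * ln 2 * (y' / a - 1))) <= z].
  move=> a0 yay' z0; have [t1 t2] := thetas a y y' a0 yay'.
  have tm : 0 < Num.min (1 - y / a) (y' / a - 1) by rewrite lt_min t1.
  have [N [N0 hN]] := expRN_nat_small tm z0; exists N; split => //;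
    apply: le_trans hN; rewrite ler_expR lerN2 ler_wpM2l ?mulr_ge0 ?ln_ge0 ?ler1n//.
    by rewrite ge_min lexx.
  by rewrite ge_min lexx orbT.
have upper (y y' z : R) : 0 <= y -> y < y' -> 0 < z -> \forall m \near \oo, F m y <= G y' + z.
  move=> y0 yy' z0; have z30 : 0 < z / 3 by rewrite divr_gt0.
  have [a a0 yay'] := middle y y' y0 yy'; have /andP[ya ay'] := yay'.
  have [N [N0 k1 k2]] := small a y y' (z / 3) a0 yay' z30.
  have /cvgrPdist_le/(_ _ z30) := stepc a N a0.
  apply: filterS => m; rewrite ler_norml => /andP[h _].
  have h1 := sublevel_le_step (P m) (mY m) (Y0 m) N0 a0 ya.
  have h2 := step_le_sublevel Q mabs abs0 N a0 ay'.
  rewrite /F /G; lra.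
have lower (y y' z : R) : 0 <= y -> y < y' -> 0 < z -> \forall m \near \oo, G y <= F m y' + z.
  move=> y0 yy' z0; have z30 : 0 < z / 3 by rewrite divr_gt0.
  have [a a0 yay'] := middle y y' y0 yy'; have /andP[ya ay'] := yay'.
  have [N [N0 k1 k2]] := small a y y' (z / 3) a0 yay' z30.
  have /cvgrPdist_le/(_ _ z30) := stepc a N a0.
  apply: filterS => m; rewrite ler_norml => /andP[_ h].
  have h1 := sublevel_le_step Q mabs abs0 N0 a0 ya.
  have h2 := step_le_sublevel (P m) (mY m) (Y0 m) N a0 ay'.
  rewrite /F /G; lra.
have PF m (y : R) : P m [set w | Y m w <= y] = (F m y)%:E.
  by rewrite /F fineK// fin_num_measure//; exact: measurable_sublevel.
have QH (y : R) : Q `]-oo, y]%classic = (H y)%:E by rewrite /H fineK// fin_num_measure.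
rewrite (_ : (fun m => P m _) = (fun m => (F m x)%:E)); last by apply/funext => m.
rewrite QH; apply: cvg_EFin; first exact: nearW.
rewrite (_ : fine \o _ = (fun m => F m x))//.
have [x0|x0] := ltP x 0.
  rewrite Hneg// (_ : (fun m => F m x) = fun=> 0); first exact: cvg_cst.
  apply/funext => m; rewrite /F (_ : [set w | _] = set0) ?measure0//.
  by apply/seteqP; split => w //= /(le_trans (Y0 m w)); rewrite leNgt x0.
have cH : H t @[t --> x] --> H x.
  have := cx; rewrite /prop_for /continuous_at QH (_ : (fun t => Q _) = (fun t => (H t)%:E)).
    by move=> /fine_cvg; apply.
  by apply/funext => t.
apply/cvgrPdist_le => z z0.
have z20 : 0 < z / 2 by rewrite divr_gt0.
have /cvgrPdist_le/(_ _ z20) := cH.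
move=> /nbhs_ballP[e /= e0 he].
have hx (t : R) : `|x - t| < e -> `|H x - H t| <= z / 2 by move=> xt; apply: he.
have up : \forall m \near \oo, F m x <= H x + z.
  have xe : x < x + e / 2 by rewrite ltrDl divr_gt0.
  have := upper x (x + e / 2) (z / 2) x0 xe z20.
  apply: filterS => m; rewrite -HG; last by rewrite (le_trans x0)// ltW.
  have : `|H x - H (x + e / 2)| <= z / 2.
    by apply: hx; rewrite opprD addrA subrr add0r normrN ger0_norm ?divr_ge0 ?ltW// ltr_pdivrMr// ltr_pMr// ltr1n.
  by rewrite ler_norml => /andP[h1 h2] h3; lra.
have lo : \forall m \near \oo, H x - z <= F m x.
  pose t := x - e / 2.
  have tx : t < x by rewrite ltrBlDr ltrDl divr_gt0.
  have : `|H x - H t| <= z / 2.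
    by apply: hx; rewrite /t opprB addrCA subrr addr0 ger0_norm ?divr_ge0 ?ltW// ltr_pdivrMr// ltr_pMr// ltr1n.
  rewrite ler_norml => /andP[h1 h2].
  (* [lower] needs a nonnegative level; left of 0 the limit [H] vanishes and the bound is
     immediate. *)
  have [t0|t0] := ltP t 0.
    apply: nearW => m; have : 0 <= F m x by rewrite fine_ge0.
    by move: h2; rewrite (Hneg _ t0); lra.
  have := lower t x (z / 2) t0 tx z20.
  by apply: filterS => m; rewrite -HG// => h3; lra.
by apply: filterS2 up lo => m h1 h2; rewrite ler_norml; lra.
Qed.

End laplace_to_cdf.

Section chi_squared_laplace.
Context (R : realType).

Let measurable_laplace (lam : R) :
  measurable_fun setT (fun x : measurableTypeR R => (expR (- lam * x))%:E).
Proof.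
by apply/measurable_EFinP; apply: measurableT_comp => //; exact: measurable_funM.
Qed.

Lemma chi_squared_laplace (lam : R) q : 0 < lam ->
  (\int[chi_squared R q]_x (expR (- lam * x))%:E =
   ((Num.sqrt (1 + 2 * lam))^-1 ^+ q)%:E)%E.
Proof.
move=> lam0; elim: q => [|q IHq].
  rewrite /= integral_dirac//.
  by rewrite diracT mul1e mulr0 expR0 expr0.
rewrite /= ge0_integral_distribution//=.
have mf : measurable_fun setT
    (fun z : measurableTypeR R * measurableTypeR R => (expR (- lam * (z.1 + z.2 ^+ 2)))%:E).
  apply/measurable_EFinP; apply: measurableT_comp => //; apply: measurable_funM => //.
  apply: measurable_funD; first exact: measurable_fst.
  by apply: measurable_funX; exact: measurable_snd.
rewrite (@fubini_tonelli1 _ _ _ _ _ (chi_squared R q) (normal_prob (0 : R) 1) _ mf)//.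
have hb : - 1 < 2 * lam by rewrite (lt_trans (ltrN10 _))// mulr_gt0.
set c := (Num.sqrt (1 + 2 * lam))^-1 in IHq *.
transitivity (\int[chi_squared R q]_x (c%:E * (expR (- lam * x))%:E))%E; last first.
  rewrite ge0_integralZl//.
  - by rewrite IHq -EFinM exprS.
  - by rewrite lee_fin invr_ge0 sqrtr_ge0.
apply: eq_integral => x _; rewrite /fubini_F /=.
have := integral_gaussian_qexp 0 hb; rewrite expr0n/= mul0r expR0 mulr1 -/c => <-.
rewrite muleC -ge0_integralZl//; last first.
  apply/measurable_EFinP; apply: measurableT_comp => //.
  by apply: measurable_funD; apply: measurable_funM => //; exact: measurable_funX.
apply: eq_integral => y _; rewrite -EFinM -expRD; congr (expR _)%:E.
by ring.
Qed.

Lemma chi_squared_lt0 q : chi_squared R q `]-oo, 0[%classic = 0%E.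
Proof.
elim: q => [|q IHq].
  by rewrite /= diracE memNset//= in_itv/= ltxx.
rewrite /= /distribution /pushforward.
have mI : measurable (`]-oo, 0[%classic : set (measurableTypeR R)) by [].
apply/eqP; rewrite -measure_le0.
apply: (@le_trans _ _ ((chi_squared R q \x normal_prob (0 : R) 1)%E
  ((`]-oo, 0[%classic : set (measurableTypeR R)) `*` setT))).
  apply: le_measure; rewrite ?inE.
  - rewrite -[X in measurable X]setTI; apply: measurable_funP => //.
  - exact: measurableX.
  - move=> z /=; rewrite /add_sqr !in_itv /= => zn; split => //.
    by rewrite (le_lt_trans _ zn)// lerDl sqr_ge0.
rewrite product_measure1E// [X in (X * _ <= _)%E]IHq mul0e//.
Qed.

Lemma chi_squared_laplace_norm (lam : R) q : 0 < lam ->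
  EE (chi_squared R q) (fun x => expR (- lam * `|x|)) = (Num.sqrt (1 + 2 * lam))^-1 ^+ q.
Proof.
move=> lam0; rewrite -[RHS]/(fine ((Num.sqrt (1 + 2 * lam))^-1 ^+ q)%:E).
rewrite -chi_squared_laplace// -/(EE _ (fun x : measurableTypeR R => expR (- lam * x))).
apply: ae_eq_EE.
- apply: measurableT_comp => //; apply: measurable_funM => //; exact: normr_measurable.
- by apply: measurableT_comp => //; exact: measurable_funM.
exists (`]-oo, 0[%classic); split => //; first exact: chi_squared_lt0.
move=> x /= hx; rewrite in_itv /= ltNge; apply/negP => x0; apply: hx.
by rewrite ger0_norm.
Qed.

End chi_squared_laplace.

(** * Stein's loss and the maximum likelihood estimators *)

Section cholesky.
Context (R : realType).

(** Induction on the size, the smaller matrix being the Schur complement [D - a^-1 *: (b *m b^T)].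
    Through the triangular factor, the trace and the log-determinant become sums over its entries,
    which does the work of a diagonalization below. *)
Lemma cholesky p (A : 'M[R]_p) : posdefmx A ->
  exists L : 'M[R]_p, [/\ is_trig_mx L, forall i, 0 < L i i & A = L *m L^T].
Proof.
elim: p A => [|p IHp] A [symA posA].
  exists 0; split; [exact: mx0_is_trig|by case|].
  by apply/matrixP => -[].
pose B : 'M[R]_(1 + p) := A.
have symB : B^T = B by exact: symA.
have posB (v : 'cV[R]_(1 + p)) : v != 0 -> 0 < (v^T *m B *m v) 0 0 by exact: posA.
pose a := B 0 0; pose b := dlsubmx B; pose D := drsubmx B.
have BE : B = block_mx a%:M b^T b D.
  rewrite -[LHS]submxK; congr block_mx.
    by apply/matrixP => i j; rewrite !ord1 !mxE eqxx mulr1n; congr (B _ _); apply/val_inj.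
  by rewrite /b trmx_dlsub symB.
have a0 : 0 < a.
  have v0 : col_mx (1%:M : 'M[R]_1) (0 : 'cV[R]_p) != 0.
    apply/eqP => /(congr1 (fun M : 'cV[R]_(1 + p) => usubmx M 0 0)).
    by rewrite col_mxKu !mxE eqxx mulr1n => /eqP; rewrite oner_eq0.
  have := posB _ v0; rewrite BE -mulmxA mul_block_col tr_col_mx mul_row_col.
  by rewrite !mulmx0 !addr0 !mulmx1 trmx1 mul1mx trmx0 mul0mx addr0 mxE eqxx mulr1n.
have pos' : posdefmx (D - a^-1 *: (b *m b^T)).
  split.
    by rewrite linearB linearZ /= trmx_mul trmxK /D trmx_drsub symB.
  (* For given [w], this first coordinate minimizes the quadratic form of [B], and the minimum is
     the quadratic form of the Schur complement. *)
  move=> w w0; pose x : 'M[R]_1 := - a^-1 *: (b^T *m w).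
  have v0 : col_mx x w != 0.
    apply: contraNneq w0 => /(congr1 (@dsubmx _ 1 p 1)).
    by rewrite col_mxKd linear0 => ->.
  have := posB _ v0; rewrite BE -mulmxA mul_block_col tr_col_mx mul_row_col.
  rewrite mul_scalar_mx /x scalerA mulrN divff ?gt_eqF// scaleN1r addNr mulmx0 add0r.
  rewrite -scalemxAr mulmxA scaleNr addrC.
  by rewrite -[in X in _ -> X]mulmxA mulmxBl -scalemxAl.
have [L [trigL posL LE]] := IHp _ pos'.
have s0 : 0 < Num.sqrt a by rewrite sqrtr_gt0.
have ss : Num.sqrt a * Num.sqrt a = a by rewrite -expr2 sqr_sqrtr// ltW.
pose L1 : 'M[R]_(1 + p) := block_mx (Num.sqrt a)%:M 0 ((Num.sqrt a)^-1 *: b) L.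
exists L1; split.
- change (is_true (@is_trig_mx R (1 + p) (1 + p) L1)).
  by rewrite /L1 is_trig_block_mx// eqxx mx11_is_trig.
- move=> i; case: (split_ordP (i : 'I_(1 + p))) => j ->.
    by rewrite [L1 _ _]block_mxEul mxE eqxx mulr1n.
  by rewrite [L1 _ _]block_mxEdr.
change (B = L1 *m L1^T).
rewrite /L1 tr_block_mx mulmx_block BE; congr block_mx.
- by rewrite trmx0 mulmx0 addr0 tr_scalar_mx -scalar_mxM ss.
- by rewrite mul0mx addr0 linearZ /= mul_scalar_mx scalerA divff ?gt_eqF// scale1r.
- by rewrite trmx0 mulmx0 addr0 tr_scalar_mx mul_mx_scalar scalerA divff ?gt_eqF// scale1r.
- rewrite -LE linearZ /= -scalemxAl -scalemxAr scalerA -invfM ss addrC subrK//.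
Qed.

Lemma posdefmx_mul_trmx p (L : 'M[R]_p) : L \in unitmx -> posdefmx (L *m L^T).
Proof.
move=> uL; split; first by rewrite trmx_mul trmxK.
move=> v v0; pose u := L^T *m v.
have -> : v^T *m (L *m L^T) *m v = u^T *m u by rewrite /u trmx_mul trmxK !mulmxA.
have u0 : u != 0.
  apply: contraNneq v0 => u0; rewrite -[v](mulKmx (_ : L^T \in unitmx)) ?unitmx_tr//.
  by rewrite -/u u0 mulmx0.
rewrite mxE lt_neqAle; apply/andP; split; last first.
  by apply: sumr_ge0 => i _; rewrite mxE -expr2 sqr_ge0.
apply: contraNneq u0 => /esym h.
apply/eqP/matrixP => i j; rewrite ord1 [RHS]mxE; apply/eqP; rewrite -sqrf_eq0.
have : \sum_i u i 0 ^+ 2 == 0.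
  rewrite (eq_bigr (fun k => u^T 0 k * u k 0)); first by rewrite h.
  by move=> k _; rewrite [u^T _ _]mxE expr2.
rewrite psumr_eq0; last by move=> k _; rewrite sqr_ge0.
by move=> /allP/(_ i (mem_index_enum _)).
Qed.

Lemma trig_unitmx p (L : 'M[R]_p) : is_trig_mx L -> (forall i, 0 < L i i) -> L \in unitmx.
Proof.
move=> tL L0; rewrite unitmxE det_trig// unitfE prodf_seq_neq0.
by apply/allP => i _ /=; rewrite gt_eqF.
Qed.

Lemma det_mul_trmx p (L : 'M[R]_p) : is_trig_mx L ->
  \det (L *m L^T) = (\prod_i L i i) ^+ 2.
Proof. by move=> tL; rewrite det_mulmx det_tr det_trig// expr2. Qed.

Lemma det_posdef_gt0 p (A : 'M[R]_p) : posdefmx A -> 0 < \det A.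
Proof.
move=> /cholesky[L [tL L0 ->]]; rewrite det_mul_trmx// exprn_gt0//.
exact: prodr_gt0.
Qed.

Lemma posdef_unitmx p (A : 'M[R]_p) : posdefmx A -> A \in unitmx.
Proof. by move=> pA; rewrite unitmxE unitfE gt_eqF// det_posdef_gt0. Qed.

Lemma trace_mul_trmx p (L : 'M[R]_p) : \tr (L *m L^T) = \sum_i \sum_j L i j ^+ 2.
Proof.
by apply: eq_bigr => i _; rewrite mxE; apply: eq_bigr => j _; rewrite mxE expr2.
Qed.

Lemma ln_prod (I : Type) (s : seq I) (f : I -> R) : (forall i, 0 < f i) ->
  ln (\prod_(i <- s) f i) = \sum_(i <- s) ln (f i).
Proof.
move=> f0; elim: s => [|i s IHs]; first by rewrite !big_nil ln1.
rewrite !big_cons lnM ?IHs// posrE//.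
by elim: s {IHs} => [|j s IHs]; rewrite ?big_nil// big_cons mulr_gt0.
Qed.

Lemma ln_leB1 (x : R) : 0 < x -> ln x <= x - 1.
Proof. by move=> x0; rewrite -{1}(subrK 1 x) addrC le_ln1Dx// ltrBrDl subrr. Qed.

(* Stein's loss of [A], the Kullback-Leibler divergence of the corresponding normal laws. *)
Definition stein_loss p (A : 'M[R]_p) := \tr A - p%:R - ln (\det A).

(** Replacing each ln (L i i) by its upper bound L i i - 1 leaves exactly the squared distance of
    [L] to the identity. *)
Lemma stein_loss_ge p (L : 'M[R]_p) : is_trig_mx L -> (forall i, 0 < L i i) ->
  \sum_i \sum_j (L i j - (i == j)%:R) ^+ 2 <= stein_loss (L *m L^T).
Proof.
move=> tL L0; rewrite /stein_loss trace_mul_trmx det_mul_trmx// lnXn ?prodr_gt0//.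
rewrite ln_prod// mulr2n.
have -> : \sum_i \sum_j (L i j - (i == j)%:R) ^+ 2 =
    \sum_i \sum_j L i j ^+ 2 - 2 * \sum_i L i i + p%:R.
  have -> : p%:R = \sum_(i < p) 1 :> R by rewrite sumr_const card_ord.
  rewrite mulr_sumr -sumrB -big_split /=.
  apply: eq_bigr => i _.
  rewrite (bigD1 i)//= [in RHS](bigD1 i)//= eqxx mulr1n.
  rewrite (eq_bigr (fun j => L i j ^+ 2)); last first.
    by move=> j /negbTE; rewrite eq_sym => ->; rewrite subr0.
  by set z := \sum_(j | _) _; ring.
have : \sum_i ln (L i i) <= \sum_i (L i i - 1).
  by apply: ler_sum => i _; exact: ln_leB1.
rewrite sumrB sumr_const card_ord => h; lra.
Qed.

Lemma stein_loss_ge0 p (A : 'M[R]_p) : posdefmx A -> 0 <= stein_loss A.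
Proof.
move=> /cholesky[L [tL L0 ->]]; apply: le_trans (stein_loss_ge tL L0).
by apply: sumr_ge0 => i _; apply: sumr_ge0 => j _; rewrite sqr_ge0.
Qed.

(** Since expR (x / 2) = expR (x / 4)^2 >= (1 + x / 4)^2 >= x. *)
Lemma ln_le_half (x : R) : 0 < x -> ln x <= x / 2.
Proof.
move=> x0; rewrite -ler_expR lnK//.
have := @expR_ge1Dx R (x / 4).
rewrite (_ : x / 2 = x / 4 + x / 4); last by field.
rewrite expRD; set e := expR _ => h.
have h4 : 0 <= x / 4 by rewrite divr_ge0// ltW.
apply: (@le_trans _ _ ((1 + x / 4) * (1 + x / 4))).
  rewrite -subr_ge0 (_ : _ - x = (1 - x / 4) ^+ 2) ?sqr_ge0//; by field.
by apply: ler_pM => //; rewrite addr_ge0.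
Qed.

(** By [ln_le_half] on the diagonal of the factor, the log-determinant is at most half of the trace.
    This lets errors proportional to the trace be absorbed by the loss itself. *)
Lemma trace_le_stein_loss p (A : 'M[R]_p) : posdefmx A ->
  \tr A <= 2 * (stein_loss A + p%:R).
Proof.
move=> /cholesky[L [tL L0 ->]].
rewrite /stein_loss trace_mul_trmx det_mul_trmx// lnXn ?prodr_gt0// ln_prod// mulr2n.
have : 2 * \sum_i ln (L i i) <= \sum_i \sum_j L i j ^+ 2 / 2.
  rewrite mulr_sumr; apply: ler_sum => i _.
  rewrite (bigD1 i)//= -[leLHS]addr0 lerD//; last first.
    by apply: sumr_ge0 => j _; rewrite divr_ge0 ?sqr_ge0.
  by rewrite mulr_natl -lnXn// ln_le_half// exprn_gt0.
have -> : \sum_i \sum_j L i j ^+ 2 / 2 = (\sum_i \sum_j L i j ^+ 2) / 2.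
  by rewrite mulr_suml; apply: eq_bigr => i _; rewrite mulr_suml.
move=> h; lra.
Qed.

End cholesky.

(** * Likelihood and first-order conditions *)

Section mle.
Context (R : realType) (p q : nat) (n : 'I_q.+1 -> nat) (S : 'I_q.+1 -> 'M[R]_p).

(** Minus twice the log-likelihood. *)
Definition nll (Sigma : 'I_q.+1 -> 'M[R]_p) : R :=
  \sum_k (n k)%:R * (ln (\det (Sigma k)) + \tr (invmx (Sigma k) *m S k)).

Lemma likelihoodE Sigma : (forall k, 0 < \det (Sigma k)) ->
  likelihood n S Sigma = expR (- (nll Sigma / 2)).
Proof.
move=> d0; rewrite /likelihood /nll mulr_suml -sumrN expR_sum.
apply: eq_bigr => k _; rewrite /powR gt_eqF// -expRD; congr expR.
by field.
Qed.

Lemma with_c1_gt0 (c : 'cV[R]_q) k : (forall j, 0 < c j 0) -> 0 < with_c1 c k.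
Proof. by move=> c0; rewrite /with_c1; case: unliftP => [j|] _. Qed.

Lemma det_prop_cov_gt0 (c : 'cV[R]_q) (Sigma1 : 'M[R]_p) k : prop_param c Sigma1 -> 0 < \det (prop_cov c Sigma1 k).
Proof.
by move=> [c0 pS]; rewrite detZ mulr_gt0 ?exprn_gt0 ?with_c1_gt0// det_posdef_gt0.
Qed.

Lemma nll_prop (c : 'cV[R]_q) (Sigma1 : 'M[R]_p) : prop_param c Sigma1 ->
  nll (prop_cov c Sigma1) = \sum_k (n k)%:R * (p%:R * ln (with_c1 c k) +
    ln (\det Sigma1) + \tr (invmx Sigma1 *m S k) / with_c1 c k).
Proof.
move=> [c0 pS]; apply: eq_bigr => k _; have ck := with_c1_gt0 k c0.
have dS := det_posdef_gt0 pS.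
rewrite /prop_cov detZ lnM ?posrE ?exprn_gt0// lnXn// -[ln _ *+ _]mulr_natl.
have ucS : with_c1 c k *: Sigma1 \in unitmx.
  by rewrite unitmxZ ?posdef_unitmx// unitfE gt_eqF.
by rewrite (invmxZ ucS) -scalemxAl linearZ /= [_^-1 * _]mulrC.
Qed.

Lemma mle_nll (c : 'cV[R]_q) (Sigma1 : 'M[R]_p) (c' : 'cV[R]_q) (Sigma1' : 'M[R]_p) : is_mle n S c Sigma1 -> prop_param c' Sigma1' ->
  nll (prop_cov c Sigma1) <= nll (prop_cov c' Sigma1').
Proof.
move=> [pc hmle] pc'; have := hmle _ _ pc'.
rewrite !likelihoodE; try by move=> k; exact: det_prop_cov_gt0.
by rewrite ler_expR lerN2 ler_pM2r ?invr_gt0.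
Qed.

(* First-order condition, from [ln y <= y - 1] applied to [y = 1 + h] and [y = 1 - h]. *)
Lemma log_linear_min (a c t : R) : 0 < c -> 0 <= a -> 0 <= t ->
  (forall x, 0 < x -> a * ln c + t / c <= a * ln x + t / x) -> t = a * c.
Proof.
move=> c0 a0 t0 h; pose tau := t / c.
suff : tau = a by rewrite /tau => <-; rewrite divfK ?gt_eqF.
have tau0 : 0 <= tau by rewrite divr_ge0// ltW.
have key y : 0 < y -> 0 <= (y - 1) * (a * y - tau).
  move=> y0; have := h (c * y) (mulr_gt0 c0 y0).
  rewrite lnM ?posrE// mulrDr -addrA lerD2l => h1.
  have h2 : a * ln y <= a * (y - 1) by rewrite ler_wpM2l// ln_leB1.
  have h3 : tau <= a * (y - 1) + tau / y.
    by rewrite (le_trans h1)// lerD// /tau invfM mulrA.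
  rewrite (_ : (y - 1) * (a * y - tau) = (a * (y - 1) + tau / y - tau) * y); last by field; rewrite gt_eqF.
  by rewrite mulr_ge0 ?subr_ge0// ltW.
apply/eqP; rewrite eq_le; apply/andP; split.
  apply/ler_addgt0Pl => e e0.
  pose k := e / (a + 1).
  have k0 : 0 < k by rewrite divr_gt0// ltr_wpDl.
  have := key (1 + k) ltac:(lra).
  rewrite addrAC subrr add0r pmulr_rge0// subr_ge0 => /le_trans; apply.
  rewrite mulrDr mulr1 addrC lerD2r /k mulrA ler_pdivrMr ?ltr_wpDl// mulrC.
  by rewrite ler_wpM2l ?lerDl// ltW.
apply/ler_addgt0Pl => e e0.
pose k := Num.min 2^-1 (e / (a + 1)).
have k0 : 0 < k by rewrite lt_min invr_gt0 divr_gt0 ?ltr_wpDl// ltr0n.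
have k1 : k <= 2^-1 by rewrite ge_min lexx.
have ke : k <= e / (a + 1) by rewrite ge_min lexx orbT.
have := key (1 - k) ltac:(lra).
rewrite addrAC subrr add0r mulNr oppr_ge0 pmulr_rle0// subr_le0 => h1.
have : a * k <= e.
  move: ke; rewrite ler_pdivlMr ?ltr_wpDl// => ke.
  by rewrite (le_trans _ ke)// mulrC ler_wpM2l ?lerDl// ltW.
lra.
Qed.

Hypothesis n0 : forall k, (0 < n k)%N.

Let set_c (c : 'cV[R]_q) j x : 'cV[R]_q := \col_i if i == j then x else c i 0.

Let with_set_c (c : 'cV[R]_q) j x k : with_c1 (set_c c j x) k =
  if k == lift ord0 j then x else with_c1 c k.
Proof.
rewrite /with_c1; case: (unliftP ord0 k) => [i|] ->.
  by rewrite mxE (inj_eq lift_inj).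
by rewrite (negbTE (neq_lift _ _)).
Qed.

(** Only c_j is varied; [log_linear_min] applies to the single term of [nll] that depends on it. *)
Lemma mle_c_lift (c : 'cV[R]_q) (Sigma1 : 'M[R]_p) j : is_mle n S c Sigma1 ->
  0 <= \tr (invmx Sigma1 *m S (lift ord0 j)) ->
  \tr (invmx Sigma1 *m S (lift ord0 j)) = p%:R * c j 0.
Proof.
move=> mle t0; have [pc _] := mle; have [c0 pS] := pc.
apply: log_linear_min => // x x0.
have pc' : prop_param (set_c c j x) Sigma1.
  by split => // i; rewrite mxE; case: eqP.
have := mle_nll mle pc'; rewrite !nll_prop//.
rewrite (bigD1 (lift ord0 j))//= [leRHS](bigD1 (lift ord0 j))//=.
rewrite [X in _ <= _ + X](eq_bigr (fun k => (n k)%:R * (p%:R * ln (with_c1 c k) +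
    ln (\det Sigma1) + \tr (invmx Sigma1 *m S k) / with_c1 c k))); last first.
  by move=> k /negbTE kj; rewrite with_set_c kj.
rewrite lerD2r ler_pM2l ?ltr0n// with_set_c eqxx.
have -> : with_c1 c (lift ord0 j) = c j 0 by rewrite /with_c1 liftK.
lra.
Qed.

(** Population 1 has no scale of its own to vary. Scaling [Sigma1] instead shows that the sum of the
    n_k t_k / c_k is p times the sum of the n_k; subtracting the conditions for k >= 2 leaves n_1
    t_1 = n_1 p. *)
Lemma mle_c (c : 'cV[R]_q) (Sigma1 : 'M[R]_p) k : (0 < p)%N -> is_mle n S c Sigma1 ->
  (forall k, 0 <= \tr (invmx Sigma1 *m S k)) ->
  \tr (invmx Sigma1 *m S k) = p%:R * with_c1 c k.
Proof.
move=> p0 mle t0; have [pc _] := mle; have [c0 pS] := pc.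
have hl j : \tr (invmx Sigma1 *m S (lift ord0 j)) = p%:R * with_c1 c (lift ord0 j).
  by rewrite (mle_c_lift mle)// /with_c1 liftK.
case: (unliftP ord0 k) => [j|] ->; first exact: hl.
pose t k := \tr (invmx Sigma1 *m S k).
have N0 : 0 < \sum_k (n k)%:R :> R.
  by rewrite (bigD1 ord0)//= ltr_pwDl ?ltr0n// sumr_ge0.
have : \sum_k (n k)%:R * (t k / with_c1 c k) = p%:R * (\sum_k (n k)%:R) * 1.
  apply: log_linear_min => //.
  - by rewrite mulr_ge0// ltW.
  - apply: sumr_ge0 => i _; apply: mulr_ge0 => //.
    by apply: divr_ge0; [exact: t0|apply/ltW; exact: with_c1_gt0].
  move=> x x0.
  have pc' : prop_param c (x *: Sigma1).
    split => //; case: pS => sS pS; split; first by rewrite linearZ /= sS.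
    by move=> v v0; rewrite -scalemxAr -scalemxAl mxE mulr_gt0// pS.
  have := mle_nll mle pc'; rewrite !nll_prop//.
  have dS := det_posdef_gt0 pS.
  have E i : p%:R * ln (with_c1 c i) + ln (\det (x *: Sigma1)) +
     \tr (invmx (x *: Sigma1) *m S i) / with_c1 c i =
     (p%:R * ln (with_c1 c i) + ln (\det Sigma1)) + p%:R * ln x +
      x^-1 * (t i / with_c1 c i).
    rewrite detZ lnM ?posrE ?exprn_gt0// lnXn// -[ln _ *+ _]mulr_natl.
    have uxS : x *: Sigma1 \in unitmx by rewrite unitmxZ ?posdef_unitmx// unitfE gt_eqF.
    by rewrite (invmxZ uxS) -scalemxAl linearZ /= /t; ring.
  pose A := \sum_i (n i)%:R * (p%:R * ln (with_c1 c i) + ln (\det Sigma1)).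
  pose B := \sum_i (n i)%:R * (t i / with_c1 c i).
  have -> : \sum_i (n i)%:R * (p%:R * ln (with_c1 c i) + ln (\det Sigma1) +
      \tr (invmx Sigma1 *m S i) / with_c1 c i) = A + B.
    by rewrite -big_split /=; apply: eq_bigr => i _; rewrite mulrDr.
  have -> : \sum_i (n i)%:R * (p%:R * ln (with_c1 c i) + ln (\det (x *: Sigma1)) +
      \tr (invmx (x *: Sigma1) *m S i) / with_c1 c i) =
      A + p%:R * (\sum_i (n i)%:R) * ln x + B / x.
    rewrite mulr_sumr !mulr_suml -!big_split /=; apply: eq_bigr => i _.
    by rewrite E; ring.
  rewrite ln1 mulr0 add0r divr1 -/B; lra.
rewrite mulr1 !big_ord_recl /= mulrDr.
rewrite [X in _ + X = _](_ : _ = p%:R * \sum_(i < q) (n (lift ord0 i))%:R); last first.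
  rewrite mulr_sumr; apply: eq_bigr => i _; rewrite /t hl mulfK ?gt_eqF ?with_c1_gt0//.
  by rewrite mulrC.
move=> /addIr; rewrite /with_c1 unlift_none divr1 mulr1 [RHS]mulrC.
by apply: mulfI; rewrite pnatr_eq0 -lt0n.
Qed.

End mle.

Section posdef_entries.
Context (R : realType).

(** On the rows of a Cholesky factor, |x y| <= (x^2 + y^2) / 2 bounds each entry by the mean of two
    diagonal entries. *)
Lemma posdef_sum_norm_le p (M : 'M[R]_p) : posdefmx M ->
  \sum_a \sum_b `|M a b| <= p%:R * \tr M.
Proof.
move=> /cholesky[L [_ _ ->]]; set N := L *m L^T.
have NE a b : N a b = \sum_c L a c * L b c.
  by rewrite mxE; apply: eq_bigr => c _; rewrite mxE.
have Nab a b : `|N a b| <= N a a / 2 + N b b / 2.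
  rewrite !NE !mulr_suml -big_split /=.
  rewrite (le_trans (ler_norm_sum _ _ _))//; apply: ler_sum => c _.
  rewrite ler_norml; set x := L a c; set y := L b c.
  have h1 := sqr_ge0 (x - y); have h2 := sqr_ge0 (x + y).
  by apply/andP; split; nra.
apply: (@le_trans _ _ (\sum_a \sum_b (N a a / 2 + N b b / 2))).
  by apply: ler_sum => a _; apply: ler_sum => b _.
have -> : \sum_a \sum_b (N a a / 2 + N b b / 2) = p%:R * \tr N / 2 + p%:R * \tr N / 2.
  under eq_bigr do rewrite big_split /= sumr_const card_ord -mulr_suml.
  rewrite big_split /= sumr_const card_ord; congr (_ + _).
    by rewrite /mxtrace mulr_sumr mulr_suml; apply: eq_bigr => a _; rewrite -[_ *+ p]mulr_natl mulrA.
  by rewrite -[_ *+ p]mulr_natl mulrA.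
by rewrite -splitr.
Qed.

Lemma posdef_trace_mul_le p (M D : 'M[R]_p) (e : R) : posdefmx M ->
  (forall a b, `|D a b| <= e) -> `|\tr (M *m D)| <= e * (p%:R * \tr M).
Proof.
move=> pM De; rewrite /mxtrace (le_trans (ler_norm_sum _ _ _))//.
case: p M D pM De => [|p] M D pM De; first by rewrite !big_ord0 !mul0r mulr0.
have e0 : 0 <= e by rewrite (le_trans _ (De ord0 ord0)).
apply: le_trans (_ : e * \sum_a \sum_b `|M a b| <= _); last first.
  by rewrite ler_wpM2l// posdef_sum_norm_le.
rewrite mulr_sumr; apply: ler_sum => a _.
rewrite mxE (le_trans (ler_norm_sum _ _ _))// mulr_sumr.
by apply: ler_sum => b _; rewrite normrM mulrC ler_pM.
Qed.

(** Writing L = 1 + E, [stein_loss_ge] bounds the squared norm of E by [h], and M - 1 = E + E^T + E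
    E^T. The square root of the loss is the source of the rate n_+^(-1/4). *)
Lemma stein_loss_entries p (M : 'M[R]_p) (h : R) : posdefmx M -> stein_loss M <= h ->
  forall a b, `|M a b - (a == b)%:R| <= 2 * Num.sqrt h + h.
Proof.
move=> /cholesky[L [tL L0 ->]] hh a b.
pose E : 'M[R]_p := L - 1%:M.
have EE i j : E i j = L i j - (i == j)%:R by rewrite !mxE.
have sE : \sum_i \sum_j E i j ^+ 2 <= h.
  apply: le_trans hh; apply: le_trans (stein_loss_ge tL L0).
  by apply: ler_sum => i _; apply: ler_sum => j _; rewrite EE.
have rE i : \sum_j E i j ^+ 2 <= h.
  apply: le_trans sE; rewrite [leRHS](bigD1 i)//= lerDl.
  by apply: sumr_ge0 => k _; apply: sumr_ge0 => j _; rewrite sqr_ge0.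
have eE i j : `|E i j| <= Num.sqrt h.
  rewrite -sqrtr_sqr ler_wsqrtr// (le_trans _ (rE i))// [leRHS](bigD1 j)//= lerDl.
  by apply: sumr_ge0 => k _; rewrite sqr_ge0.
have LE : L *m L^T - 1%:M = E + E^T + E *m E^T.
  have -> : L = E + 1%:M by rewrite subrK.
  rewrite linearD /= trmx1 mulmxDl mulmxDr mulmx1 mul1mx addrA addrK.
  by rewrite -addrA addrC.
have -> : (L *m L^T) a b - (a == b)%:R = E a b + E b a + \sum_c E a c * E b c.
  transitivity ((L *m L^T - 1%:M) a b); first by rewrite !mxE.
  rewrite LE mxE [(E + _) a b]mxE [E^T a b]mxE [(E *m _) a b]mxE; congr (_ + _).
  by apply: eq_bigr => c _; rewrite [E^T _ _]mxE.
rewrite (le_trans (ler_normD _ _))// lerD//.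
  by rewrite mulr_natl mulr2n (le_trans (ler_normD _ _))// lerD.
rewrite (le_trans (ler_norm_sum _ _ _))//.
apply: (@le_trans _ _ (\sum_c (E a c ^+ 2 / 2 + E b c ^+ 2 / 2))).
  apply: ler_sum => c _; rewrite ler_norml; set x := E a c; set y := E b c.
  have h1 := sqr_ge0 (x - y); have h2 := sqr_ge0 (x + y).
  by apply/andP; split; nra.
rewrite big_split /= -!mulr_suml.
by have := rE a; have := rE b; lra.
Qed.

End posdef_entries.

(** * Closeness of the estimated covariance to the true one *)

Section consistency.
Context (R : realType) (p q : nat) (n : 'I_q.+1 -> nat) (S : 'I_q.+1 -> 'M[R]_p).
Variables (A0 Sigma1 : 'M[R]_p).
Hypotheses (p0 : (0 < p)%N) (n0 : forall k, (0 < n k)%N).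
Hypotheses (uA0 : A0 \in unitmx) (A0E : A0 *m A0^T = Sigma1).

Lemma invmx_mul_trmx (L : 'M[R]_p) : L \in unitmx ->
  invmx (L *m L^T) = (invmx L)^T *m invmx L.
Proof.
move=> uL; have uLL : L *m L^T \in unitmx by rewrite unitmx_mul unitmx_tr uL.
rewrite -[RHS](mulKmx uLL) -[LHS]mulmx1; congr (_ *m _).
rewrite -mulmxA [L^T *m _]mulmxA -trmx_mul mulVmx// trmx1 mul1mx mulmxV//.
Qed.

Definition whiten (S : 'M[R]_p) := invmx A0 *m S *m (invmx A0)^T.

(** The inverse covariance in whitened coordinates, equal to the identity at [Sigma1]. Together with
    [whiten] it reduces the traces to the case where the true covariance is the identity. *)
Definition precision (Sigma : 'M[R]_p) := A0^T *m invmx Sigma *m A0.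

Lemma trace_whiten Sigma T : \tr (invmx Sigma *m T) = \tr (precision Sigma *m whiten T).
Proof.
have -> : precision Sigma *m whiten T = A0^T *m (invmx Sigma *m T *m (invmx A0)^T).
  by rewrite /precision /whiten !mulmxA (mulmxK uA0).
rewrite [RHS]mxtrace_mulC -[RHS]/(\tr (_ *m _ *m _)) -mulmxA -trmx_mul mulmxV//.
by rewrite trmx1 mulmx1.
Qed.

Lemma posdef_precision Sigma : posdefmx Sigma -> posdefmx (precision Sigma).
Proof.
move=> /cholesky[L [tL L0 ->]]; have uL := trig_unitmx tL L0.
have uLt : L^T \in unitmx by rewrite unitmx_tr.
have -> : precision (L *m L^T) = (A0^T *m (invmx L)^T) *m (A0^T *m (invmx L)^T)^T.
  by rewrite /precision invmx_mul_trmx// trmx_mul !trmxK !mulmxA.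
by apply: posdefmx_mul_trmx; rewrite unitmx_mul !unitmx_tr uA0 unitmx_inv.
Qed.

Lemma det_precision Sigma : posdefmx Sigma ->
  ln (\det (precision Sigma)) = ln (\det Sigma1) - ln (\det Sigma).
Proof.
move=> pS; have dS := det_posdef_gt0 pS.
have pA0 : posdefmx Sigma1 by rewrite -A0E; exact: posdefmx_mul_trmx.
have dA0 := det_posdef_gt0 pA0.
rewrite /precision !det_mulmx det_inv det_tr mulrAC -{1}det_tr mulrC.
rewrite [\det A0^T * _]mulrC -det_mulmx A0E lnM ?posrE ?invr_gt0// lnV ?posrE//.
by rewrite addrC.
Qed.

Lemma scale_posdef p' (A : 'M[R]_p') (x : R) : 0 < x -> posdefmx A -> posdefmx (x *: A).
Proof.
move=> x0 [sA pA]; split; first by rewrite linearZ /= sA.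
by move=> v v0; rewrite -scalemxAr -scalemxAl mxE mulr_gt0// pA.
Qed.

(* Compares the likelihoods at the maximum and at [c = 1], [Sigma = Sigma1]. *)
Lemma mle_stein_loss (c : 'cV[R]_q) Sigma (e : R) : is_mle n S c Sigma ->
  (forall k a b, `|whiten (S k) a b - (a == b)%:R| <= e) -> 4 * p%:R * e <= 1 ->
  (n ord0)%:R * stein_loss (precision Sigma) <= (nplus n)%:R * (6 * p%:R ^+ 2 * e).
Proof.
move=> mle Se pe; have [pc _] := mle; have [c0 pS] := pc.
have pS1 : posdefmx Sigma1 by rewrite -A0E; exact: posdefmx_mul_trmx.
have pp : 1 <= p%:R :> R by rewrite ler1n.
have e0 : 0 <= e by rewrite (le_trans _ (Se ord0 (Ordinal p0) (Ordinal p0))).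
pose M := precision Sigma.
have pM : posdefmx M := posdef_precision pS.
pose Mk k := (with_c1 c k)^-1 *: M.
have ck k : 0 < with_c1 c k := with_c1_gt0 k c0.
have pMk k : posdefmx (Mk k) by apply: scale_posdef => //; rewrite invr_gt0.
pose D k := whiten (S k) - 1%:M.
have De k a b : `|D k a b| <= e by rewrite !mxE; have := Se k a b; rewrite !mxE.
have p1 : prop_param (const_mx 1 : 'cV[R]_q) Sigma1.
  by split => // j; rewrite mxE.
have := mle_nll mle p1; rewrite !nll_prop//.
have lo k : (n k)%:R * (p%:R * ln (with_c1 c k) + ln (\det Sigma) +
    \tr (invmx Sigma *m S k) / with_c1 c k) >=
    (n k)%:R * (ln (\det Sigma1) + (stein_loss (Mk k) / 2 + p%:R - 2 * p%:R ^+ 2 * e)).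
  rewrite ler_wpM2l//.
  have -> : \tr (invmx Sigma *m S k) / with_c1 c k = \tr (Mk k) + \tr (Mk k *m D k).
    rewrite trace_whiten -/M /D mulmxBr mulmx1 linearB /= addrC subrK.
    by rewrite /Mk -scalemxAl linearZ /= mulrC.
  have -> : p%:R * ln (with_c1 c k) + ln (\det Sigma) = ln (\det Sigma1) - ln (\det (Mk k)).
    rewrite /Mk detZ lnM ?posrE ?exprn_gt0 ?invr_gt0// ?det_posdef_gt0//.
    rewrite lnXn ?invr_gt0// lnV ?posrE// det_precision// -mulr_natl; ring.
  have h1 := posdef_trace_mul_le (pMk k) (De k).
  have h2 := trace_le_stein_loss (pMk k).
  have h3 := stein_loss_ge0 (pMk k).
  have [h4 _] : - (e * (p%:R * \tr (Mk k))) <= \tr (Mk k *m D k) /\ True.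
    by split => //; move: h1; rewrite ler_norml => /andP[].
  have h5 : e * (p%:R * \tr (Mk k)) <= e * p%:R * (2 * (stein_loss (Mk k) + p%:R)).
    by rewrite [leLHS]mulrA ler_wpM2l// mulr_ge0.
  (* The assumption [4 * p%:R * e <= 1] enters here: the error proportional to the loss is absorbed
     by half of the loss. *)
  have h6 : 2 * p%:R * e * stein_loss (Mk k) <= stein_loss (Mk k) / 2.
    by rewrite [leLHS]mulrC ler_wpM2l//; lra.
  have h7 : stein_loss (Mk k) = \tr (Mk k) - p%:R - ln (\det (Mk k)) by [].
  nra.
have hi k : (n k)%:R * (p%:R * ln (with_c1 (const_mx 1 : 'cV[R]_q) k) + ln (\det Sigma1) +
    \tr (invmx Sigma1 *m S k) / with_c1 (const_mx 1 : 'cV[R]_q) k) <=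
    (n k)%:R * (ln (\det Sigma1) + (p%:R + p%:R * e)).
  rewrite ler_wpM2l//.
  have -> : with_c1 (const_mx 1 : 'cV[R]_q) k = 1.
    by rewrite /with_c1; case: unlift => // j; rewrite mxE.
  rewrite ln1 mulr0 add0r divr1 lerD2l trace_whiten.
  have -> : precision Sigma1 = 1%:M.
    rewrite /precision -A0E invmx_mul_trmx// !mulmxA -trmx_mul mulVmx//.
    by rewrite trmx1 mul1mx mulVmx.
  rewrite mul1mx (_ : whiten (S k) = 1%:M + D k); last by rewrite addrC subrK.
  rewrite linearD /= mxtrace1 lerD2l (le_trans (ler_norm _))//.
  rewrite (le_trans (ler_norm_sum _ _ _))//.
  apply: (@le_trans _ _ (\sum_(i < p) e)); first by apply: ler_sum => i _; exact: De.
  by rewrite sumr_const card_ord mulr_natl.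
move=> H.
have H2 : \sum_k (n k)%:R * (ln (\det Sigma1) +
      (stein_loss (Mk k) / 2 + p%:R - 2 * p%:R ^+ 2 * e)) <=
    \sum_k (n k)%:R * (ln (\det Sigma1) + (p%:R + p%:R * e)).
  by apply: (le_trans _ (le_trans H _)); apply: ler_sum => k _.
(* On weighted average, loss / 2 <= 2 p^2 e + p e <= 3 p^2 e, whence the factor 6. *)
have H3 : \sum_k (n k)%:R * stein_loss (Mk k) <= (nplus n)%:R * (6 * p%:R ^+ 2 * e).
  rewrite /nplus natr_sum mulr_suml -subr_ge0 -sumrB.
  have : 0 <= 2 * (\sum_k (n k)%:R * (ln (\det Sigma1) + (p%:R + p%:R * e)) -
    \sum_k (n k)%:R * (ln (\det Sigma1) +
      (stein_loss (Mk k) / 2 + p%:R - 2 * p%:R ^+ 2 * e))).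
    by rewrite mulr_ge0// subr_ge0.
  move/le_trans; apply; rewrite -sumrB mulr_sumr; apply: ler_sum => k _.
  have nk : 0 <= (n k)%:R :> R by [].
  have pe2 : p%:R * e <= p%:R ^+ 2 * e.
    by rewrite ler_wpM2r// expr2 ler_peMr// (le_trans ler01).
  by rewrite -mulrBr mulrCA -mulrBr ler_wpM2l//; lra.
(* Only the term of population 1 is kept: as c_1 = 1, it is the loss of the precision matrix itself,
   free of any unknown scale. *)
apply: le_trans H3; rewrite [leRHS](bigD1 ord0)//=.
have -> : Mk ord0 = M by rewrite /Mk /with_c1 unlift_none invr1 scale1r.
by rewrite lerDl; apply: sumr_ge0 => k _; rewrite mulr_ge0// stein_loss_ge0.
Qed.

End consistency.

Section bounds.
Context (R : realType).

Lemma ler_sum_ord n (f : 'I_n -> R) (c : R) : (forall i, f i <= c) -> \sum_i f i <= n%:R * c.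
Proof.
move=> fc; rewrite mulr_natl -[X in _ <= _ *+ X](card_ord n) -sumr_const.
by apply: ler_sum => i _.
Qed.

Lemma cvg0Ml (U : Type) (F : set_system U) (FF : Filter F) (k : R) (f : U -> R) :
  f y @[y --> F] --> (0 : R) -> k * f y @[y --> F] --> (0 : R).
Proof.
by move=> f0; rewrite -[X in _ --> X](mulr0 k); apply: cvgM => //; exact: cvg_cst.
Qed.

End bounds.

(** * Weighted variance and the identity for the statistic *)

Section weighted_variance.
Context (R : realType) (I : finType) (r : I -> R).
Hypothesis r1 : \sum_k r k = 1.

Definition wvar (x : I -> R) : R := \sum_k r k * x k ^+ 2 - (\sum_k r k * x k) ^+ 2.

Lemma wvar_affine (a s : R) (x : I -> R) : wvar (fun k => a + s * x k) = s ^+ 2 * wvar x.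
Proof.
rewrite /wvar.
have -> : \sum_k r k * (a + s * x k) = a + s * \sum_k r k * x k.
  rewrite -[a in RHS]mul1r -r1 mulr_suml mulr_sumr -big_split /=.
  by apply: eq_bigr => k _; ring.
have -> : \sum_k r k * (a + s * x k) ^+ 2 =
    a ^+ 2 + 2 * a * s * (\sum_k r k * x k) + s ^+ 2 * \sum_k r k * x k ^+ 2.
  have -> : a ^+ 2 = \sum_k r k * a ^+ 2 by rewrite -mulr_suml r1 mul1r.
  rewrite !mulr_sumr -!big_split /=.
  by apply: eq_bigr => k _; ring.
by ring.
Qed.

Lemma wvar_ge0 (x : I -> R) : (forall k, 0 <= r k) -> 0 <= wvar x.
Proof.
move=> r0; pose m := \sum_k r k * x k.
have -> : wvar x = wvar (fun k => - m + 1 * x k) by rewrite wvar_affine expr1n mul1r.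
rewrite /wvar [X in _ - X](_ : _ = 0) ?subr0.
  by apply: sumr_ge0 => k _; rewrite mulr_ge0 ?sqr_ge0.
under eq_bigr do rewrite mul1r mulrDr.
by rewrite big_split /= -mulr_suml r1 mul1r addNr expr0n.
Qed.

(** The difference of the variances is the covariance of x - y and x + y under the weights, and |x +
    y| <= 2 K + 1 because z <= 1. *)
Lemma wvar_lip (x y : I -> R) (z K : R) : (forall k, 0 <= r k) -> z <= 1 ->
  (forall k, `|x k - y k| <= z) -> (forall k, `|y k| <= K) ->
  `|wvar x - wvar y| <= 2 * (z * (2 * K + 1)).
Proof.
move=> r0 z1 xyz yK.
have [k0 _|I0] := pickP I; last first.
  by have := r1; rewrite big_pred0// => /eqP; rewrite eq_sym oner_eq0.
have z0 : 0 <= z by rewrite (le_trans _ (xyz k0)).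
have K0 : 0 <= K by rewrite (le_trans _ (yK k0)).
have xyK k : `|x k + y k| <= 2 * K + 1.
  rewrite (_ : x k + y k = (x k - y k) + 2 * y k); last by ring.
  rewrite (le_trans (ler_normD _ _))// addrC lerD//.
    by rewrite normrM ger0_norm// ler_wpM2l.
  by rewrite (le_trans (xyz k)).
have avg (u : I -> R) (c : R) : (forall k, `|u k| <= c) -> `|\sum_k r k * u k| <= c.
  move=> uc; rewrite (le_trans (ler_norm_sum _ _ _))// (_ : c = \sum_k r k * c); last by rewrite -mulr_suml r1 mul1r.
  by apply: ler_sum => k _; rewrite normrM ger0_norm// ler_wpM2l.
have -> : wvar x - wvar y = \sum_k r k * ((x k - y k) * (x k + y k)) -
    (\sum_k r k * (x k - y k)) * (\sum_k r k * (x k + y k)).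
  rewrite /wvar.
  under [\sum_k r k * (x k - y k)]eq_bigr do rewrite mulrBr.
  under [\sum_k r k * (x k + y k)]eq_bigr do rewrite mulrDr.
  rewrite sumrB big_split /=.
  have -> : \sum_k r k * ((x k - y k) * (x k + y k)) =
      \sum_k r k * x k ^+ 2 - \sum_k r k * y k ^+ 2.
    by rewrite -sumrB; apply: eq_bigr => k _; ring.
  by ring.
rewrite (le_trans (ler_normB _ _))// mulr_natl mulr2n lerD//.
  by apply: avg => k; rewrite normrM ler_pM.
by rewrite normrM ler_pM//; apply: avg.
Qed.

End weighted_variance.

Section statistic_identity.
Context (R : realType) (p q : nat) (r : 'I_q.+1 -> R).
Hypothesis r1 : \sum_k r k = 1.

(** As (c_j - 1) / c_j = 1 - 1 / c_j, both sums in the quadratic form are moments of 1 - 1 / c_k.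
    This quantity is 0 for population 1, which can therefore be added, and the weights then sum to
    1. *)
Lemma statistic_wvar N (c : 'cV[R]_q) : (forall j, c j 0 != 0) ->
  statistic p r N c = N%:R * p%:R / 2 * wvar r (fun k => (with_c1 c k)^-1).
Proof.
move=> c0; rewrite /statistic -mulrA -mulrA; congr (_ * _).
have cl j : with_c1 c (lift ord0 j) = c j 0 by rewrite /with_c1 liftK.
have c00 : with_c1 c ord0 = 1 by rewrite /with_c1 unlift_none.
have -> : wvar r (fun k => (with_c1 c k)^-1) = wvar r (fun k => 1 + -1 * (with_c1 c k)^-1).
  by rewrite wvar_affine// sqrrN expr1n mul1r.
set v := c - const_mx 1.
have vE j : v j 0 = c j 0 - 1 by rewrite !mxE.
clearbody v.
rewrite /U11 -scalemxAr -scalemxAl mxE mulrA; congr (_ * _).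
rewrite mulmxBr mulmxBl [LHS]mxE; congr (_ + _).
  rewrite mxE big_ord_recl c00 invr1 mulN1r subrr expr0n mulr0 add0r.
  apply: eq_bigr => j _; rewrite cl mul_mx_diag !mxE vE.
  by field; rewrite c0.
rewrite mxE; congr (- _).
have aE : ((alpha r c)^T *m v) 0 0 = \sum_k r k * (1 + -1 / with_c1 c k).
  rewrite mxE big_ord_recl c00 divr1 subrr mulr0 add0r.
  by apply: eq_bigr => j _; rewrite cl !mxE vE; field; rewrite c0.
rewrite (_ : _ *m v = (v^T *m alpha r c) *m ((alpha r c)^T *m v)); last by rewrite !mulmxA.
rewrite mxE big_ord1 aE.
have -> : (v^T *m alpha r c) 0 0 = ((alpha r c)^T *m v) 0 0.
  by rewrite -[v^T *m _]trmxK trmx_mul trmxK mxE.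
by rewrite aE expr2.
Qed.

End statistic_identity.

Section mle_expansion.
Context (R : realType) (p q : nat) (n : 'I_q.+1 -> nat) (S : 'I_q.+1 -> 'M[R]_p).
Variables (A0 Sigma1 : 'M[R]_p).
Hypotheses (p0 : (0 < p)%N) (n0 : forall k, (0 < n k)%N).
Hypotheses (uA0 : A0 \in unitmx) (A0E : A0 *m A0^T = Sigma1).

Definition trace_dev k : R := (\tr (whiten A0 (S k)) - p%:R) / p%:R.

(** With M the precision and D_k the whitened S_k minus 1, p c_k = tr M + tr (M D_k). Subtracting
    the equation with c_1 = 1 cancels tr M. Replacing M by 1 in what remains costs the term in w e,
    and 1 - 1 / c = (c - 1) - (c - 1)^2 / c accounts for the square. *)
Lemma mle_expansion (c : 'cV[R]_q) Sigma (e w : R) : is_mle n S c Sigma ->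
  (forall k a b, `|whiten A0 (S k) a b - (a == b)%:R| <= e) -> 4 * p%:R * e <= 1 ->
  (forall a b, `|precision A0 Sigma a b - (a == b)%:R| <= w) ->
  e * (2 + 2 * p%:R * w) <= 2^-1 ->
  forall k, `|1 - (with_c1 c k)^-1 - (trace_dev k - trace_dev ord0)| <=
    2 * p%:R * w * e + 2 * (e * (2 + 2 * p%:R * w)) ^+ 2.
Proof.
move=> mle Se pe Mw ew k; have [pc _] := mle; have [c0 pS] := pc.
have pp : 1 <= p%:R :> R by rewrite ler1n.
have pp0 : 0 < p%:R :> R by rewrite ltr0n.
have e0 : 0 <= e by rewrite (le_trans _ (Se ord0 (Ordinal p0) (Ordinal p0))).
have w0 : 0 <= w by rewrite (le_trans _ (Mw (Ordinal p0) (Ordinal p0))).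
pose M := precision A0 Sigma.
have pM : posdefmx M := posdef_precision uA0 pS.
pose D k := whiten A0 (S k) - 1%:M.
have De i a b : `|D i a b| <= e by rewrite !mxE; have := Se i a b; rewrite !mxE.
have trE i : \tr (invmx Sigma *m S i) = \tr M + \tr (M *m D i).
  by rewrite (trace_whiten uA0) -/M /D mulmxBr mulmx1 linearB /= addrC subrK.
have tr0 i : 0 <= \tr (invmx Sigma *m S i).
  rewrite trE; have := posdef_trace_mul_le pM (De i).
  rewrite ler_norml => /andP[h _].
  have tM : 0 <= \tr M.
    by have [L [_ _ ->]] := cholesky pM; rewrite trace_mul_trmx;
      apply: sumr_ge0 => a _; apply: sumr_ge0 => b _; rewrite sqr_ge0.
  have : e * (p%:R * \tr M) <= \tr M by rewrite mulrA ler_piMl//; lra.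
  lra.
have ckE i : with_c1 c i = (\tr M + \tr (M *m D i)) / p%:R.
  by rewrite -trE (mle_c n0 i p0 mle tr0) mulrC mulKf// gt_eqF.
have c1 : with_c1 c ord0 = 1 by rewrite /with_c1 unlift_none.
have tdE i : trace_dev i = \tr (D i) / p%:R.
  by rewrite /trace_dev /D linearB /= mxtrace1.
pose F i := \tr ((M - 1%:M) *m D i).
have FE i : \tr (M *m D i) = \tr (D i) + F i.
  rewrite /F -linearD /=; congr (\tr _).
  by rewrite -{2}(mul1mx (D i)) -mulmxDl [1%:M + _]addrC subrK.
have Fb i : `|F i| <= p%:R * (p%:R * (w * e)).
  rewrite /F /mxtrace (le_trans (ler_norm_sum _ _ _))//.
  apply: ler_sum_ord => a.
  rewrite mxE (le_trans (ler_norm_sum _ _ _))//.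
  apply: ler_sum_ord => b.
  by rewrite normrM ler_pM// !mxE; have := Mw a b; rewrite !mxE.
pose g := trace_dev k - trace_dev ord0.
pose dk := with_c1 c k - 1.
have dkE : dk = g + (F k - F ord0) / p%:R.
  have h1 : dk = (\tr M + \tr (M *m D k)) / p%:R - (\tr M + \tr (M *m D ord0)) / p%:R.
    by rewrite -!ckE c1.
  by rewrite h1 /g !tdE !FE; field; rewrite gt_eqF.
have tdb i : `|trace_dev i| <= e.
  rewrite tdE normrM [`|_^-1|]ger0_norm ?invr_ge0// ler_pdivrMr//.
  by rewrite (le_trans (ler_norm_sum _ _ _))// mulrC; apply: ler_sum_ord.
have F2 : `|(F k - F ord0) / p%:R| <= 2 * p%:R * w * e.
  rewrite normrM [`|_^-1|]ger0_norm ?invr_ge0// ler_pdivrMr//.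
  rewrite (le_trans (ler_normB _ _))// (le_trans (lerD (Fb _) (Fb _)))//.
  by rewrite le_eqVlt; apply/orP; left; apply/eqP; ring.
have dkb : `|dk| <= e * (2 + 2 * p%:R * w).
  rewrite dkE (le_trans (ler_normD _ _))//.
  have : `|g| <= e + e by rewrite (le_trans (ler_normB _ _))// lerD.
  by move=> hg; rewrite (le_trans (lerD hg F2))// le_eqVlt; apply/orP; left; apply/eqP; ring.
have dk2 : `|dk| <= 2^-1 := le_trans dkb ew.
have ckh : 2^-1 <= with_c1 c k.
  by move: dk2; rewrite ler_norml /dk => /andP[h _]; lra.
have ck0 : 0 < with_c1 c k by lra.
have -> : 1 - (with_c1 c k)^-1 - (trace_dev k - trace_dev ord0) =
    (F k - F ord0) / p%:R - dk ^+ 2 / with_c1 c k.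
  have -> : trace_dev k - trace_dev ord0 = dk - (F k - F ord0) / p%:R by rewrite dkE addrK.
  by rewrite /dk; field; rewrite !gt_eqF.
rewrite (le_trans (ler_normB _ _))// lerD//.
rewrite normrM normrX [`|_^-1|]ger0_norm ?invr_ge0 ?(ltW ck0)// ler_pdivrMr//.
apply: (@le_trans _ _ ((e * (2 + 2 * p%:R * w)) ^+ 2)).
  by rewrite lerXn2r// nnegrE// (le_trans _ dkb).
set z := _ ^+ 2; have : 0 <= z by rewrite sqr_ge0.
move=> z0; nra.
Qed.

End mle_expansion.

(** * Standardized samples *)

Section standard_normal.
Context (R : realType).

Lemma sum_expr_le (I : finType) (u : I -> R) (k : nat) : (0 < #|I|)%N ->
  (forall i, 0 <= u i) -> (\sum_i u i) ^+ k <= #|I|%:R ^+ k * \sum_i u i ^+ k.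
Proof.
move=> /card_gt0P[i0 _] u0.
have [m _ hm] := arg_maxP u (isT : xpredT i0).
have h : \sum_i u i <= #|I|%:R * u m.
  by rewrite mulr_natl -sumr_const; apply: ler_sum => i _; exact: hm.
apply: (@le_trans _ _ ((#|I|%:R * u m) ^+ k)).
  by rewrite lerXn2r// nnegrE ?sumr_ge0// mulr_ge0.
rewrite exprMn ler_wpM2l ?exprn_ge0// [leRHS](bigD1 m)//= lerDl.
by apply: sumr_ge0 => i _; rewrite exprn_ge0.
Qed.

(** Controls the third absolute moment of x^2 - 1, since |x^2 - 1| <= x^2 + 1. *)
Definition sqr1_cube : R := EE (gaussian R) (fun x => (x ^+ 2 + 1) ^+ 3).

Lemma integ_sqr1_cube : integ (gaussian R) (fun x => (x ^+ 2 + 1) ^+ 3).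
Proof.
rewrite (_ : (fun x => _) = fun x : measurableTypeR R => x ^+ 6 + (3 * x ^+ 4 + (3 * x ^+ 2 + 1))).
  have i6 := integ_gaussian_exp R 6; have i4 := integ_gaussian_exp R 4.
  have i2 := integ_gaussian_exp R 2.
  exact: (integD i6 (integD (integZ 3 i4) (integD (integZ 3 i2) (integ_cst (gaussian R) 1)))).
by apply/funext => x; ring.
Qed.

Context d (T : measurableType d) (P : probability T R) (p : nat).
Variable Z : 'I_p -> {RV P >-> R}.
Hypothesis hZ : standard_normal_vector Z.

Lemma EE_std i (f : R -> R) : measurable_fun setT f -> integ (gaussian R) f ->
  integ P (fun w => f (Z i w)) /\ EE P (fun w => f (Z i w)) = EE (gaussian R) f.
Proof.
move=> mf intf; have [_ hd] := hZ.
have mZi : measurable_fun setT (Z i : T -> measurableTypeR R).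
  by move=> mT B mB; exact: (@measurable_funPT _ _ T R (Z i) mT B mB).
pose Z' : {mfun T >-> measurableTypeR R} :=
  HB.pack (Z i : T -> measurableTypeR R) (isMeasurableFun.Build _ _ _ _ _ mZi).
have mfE : measurable_fun [set: measurableTypeR R] (EFin \o f).
  by apply/measurable_EFinP; exact: integ_measurable intf.
have fi : integ P (fun w => f (Z i w)).
  apply/integrableP; split.
    by apply/measurable_EFinP; apply: measurableT_comp.
  rewrite -(ge0_integral_distribution Z' (f := fun x : measurableTypeR R => `|(f x)%:E|%E))//; last first.
    by apply: measurableT_comp.
  have -> : (\int[distribution P Z']_x `|(f x)%:E| = \int[gaussian R]_x `|(f x)%:E|)%E.
    by apply: eq_measure_integral => A mA _; exact: hd.
  by case/integrableP : intf.
split => //; apply: EFin_inj; rewrite !EE_EFin//.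
transitivity (\int[distribution P Z']_x (f x)%:E)%E.
  by rewrite (integral_distribution (X := Z') mfE).
apply: eq_measure_integral => A mA _; exact: hd.
Qed.

Let mZ i : measurable_fun setT (Z i : T -> R).
Proof. exact: measurable_funP. Qed.

Lemma integ_std_exp i k : integ P (fun w => Z i w ^+ k).
Proof. by have [] := EE_std i (exprn_measurable k) (integ_gaussian_exp R k). Qed.

Lemma EE_std_exp i k : EE P (fun w => Z i w ^+ k) = EE (gaussian R) (fun x => x ^+ k).
Proof. by have [] := EE_std i (exprn_measurable k) (integ_gaussian_exp R k). Qed.

Lemma integ_stdM i j : integ P (fun w => Z i w * Z j w).
Proof.
apply: (@integ_le _ _ _ _ _ (fun w => Z i w ^+ 2 + Z j w ^+ 2)).
- exact: measurable_funM.
- move=> w; rewrite normrM -[X in _ <= X + _]real_normK ?num_real//.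
  rewrite -[X in _ <= _ + X]real_normK ?num_real//.
  set x := `|_|; set y := `|_|; have := sqr_ge0 (x - y); have := sqr_ge0 (x + y).
  by nra.
- by apply: integD; exact: integ_std_exp.
Qed.

Lemma EE_std1 i : EE P (fun w => Z i w) = 0.
Proof. by have := EE_std_exp i 1; rewrite [RHS]gaussian_mean. Qed.

Lemma EE_stdM i j : EE P (fun w => Z i w * Z j w) = (i == j)%:R.
Proof.
have i1 k : integ P (Z k : T -> R) by have := integ_std_exp k 1.
case: eqVneq => [->|ij].
  by have := EE_std_exp j 2; case: (gaussian_moments R) => -> _.
have := EE_pair_indep mZ (proj1 hZ) ij (@measurable_id _ _ setT) (@measurable_id _ _ setT) (i1 i) (i1 j)
  (integ_stdM i j).
by move=> ->; rewrite [X in X * _]EE_std1 mul0r.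
Qed.

Definition sqnorm w := \sum_i Z i w ^+ 2.

Lemma integ_sqnorm : integ P sqnorm.
Proof. by apply: integ_sum => i _; exact: integ_std_exp. Qed.

Lemma EE_sqnorm : EE P sqnorm = p%:R.
Proof.
rewrite /sqnorm EE_sum; last by move=> i; exact: integ_std_exp.
under eq_bigr do rewrite EE_std_exp (proj1 (gaussian_moments R)).
by rewrite sumr_const card_ord.
Qed.

Lemma sqnorm_centered w : sqnorm w - p%:R = \sum_i (Z i w ^+ 2 - 1).
Proof. by rewrite sumrB sumr_const card_ord. Qed.

Let mcenter : measurable_fun setT (fun x : R => x ^+ 2 - 1).
Proof. by apply: measurable_funB => //; exact: exprn_measurable. Qed.

Lemma EE_sqnorm_var : EE P (fun w => (sqnorm w - p%:R) ^+ 2) = 2 * p%:R.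
Proof.
have i4 := integ_gaussian_exp R 4; have i2 := integ_gaussian_exp R 2.
have ic i : integ P (fun w => (Z i w ^+ 2 - 1) ^+ 2).
  rewrite (_ : (fun w => _) = fun w => Z i w ^+ 4 - 2 * Z i w ^+ 2 + 1).
    exact: (integD (integB (integ_std_exp i 4) (integZ 2 (integ_std_exp i 2))) (integ_cst P 1)).
  by apply/funext => w; ring.
have Ec i : EE P (fun w => (Z i w ^+ 2 - 1) ^+ 2) = 2.
  rewrite (_ : (fun w => _) = fun w => Z i w ^+ 4 - 2 * Z i w ^+ 2 + 1); last first.
    by apply/funext => w; ring.
  rewrite (EED (integB (integ_std_exp i 4) (integZ 2 (integ_std_exp i 2))) (integ_cst P 1)).
  rewrite (EEB (integ_std_exp i 4) (integZ 2 (integ_std_exp i 2))) (EEZ 2 (integ_std_exp i 2)).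
  rewrite !EE_std_exp EE_cst; case: (gaussian_moments R) => -> ->; lra.
have E0 i : EE P (fun w => Z i w ^+ 2 - 1) = 0.
  rewrite (EEB (integ_std_exp i 2) (integ_cst P 1)) EE_cst EE_std_exp.
  by case: (gaussian_moments R) => -> _; rewrite subrr.
have [h _] := EE_sqr_sum_indep mZ (proj1 hZ) finset.setT (fun i => mcenter) ic E0.
rewrite (_ : (fun w => (sqnorm w - _) ^+ 2) =
  (fun w => (\sum_(i in finset.setT) (Z i w ^+ 2 - 1)) ^+ 2)); last first.
  by apply/funext => w; rewrite sqnorm_centered; congr (_ ^+ 2); apply: eq_bigl => i; rewrite inE.
rewrite h (eq_bigr (fun=> 2)); last by move=> i _; exact: Ec.
by rewrite sumr_const cardsT card_ord mulr_natr.
Qed.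

Hypothesis p0 : (0 < p)%N.

Lemma sqnorm_cube : integ P (fun w => `|sqnorm w - p%:R| ^+ 3) /\
  EE P (fun w => `|sqnorm w - p%:R| ^+ 3) <= p%:R ^+ 4 * sqr1_cube.
Proof.
have mf : measurable_fun setT (fun x : R => (x ^+ 2 + 1) ^+ 3).
  by apply: measurable_funX; apply: measurable_funD => //; exact: exprn_measurable.
have i3 i := EE_std i mf integ_sqr1_cube.
pose B w := p%:R ^+ 3 * \sum_i (Z i w ^+ 2 + 1) ^+ 3.
have iS : integ P (fun w => \sum_i (Z i w ^+ 2 + 1) ^+ 3).
  by apply: integ_sum => i _; have [] := i3 i.
have iB : integ P B by exact: integZ.
have nB w : `|sqnorm w - p%:R| ^+ 3 <= B w.
  apply: (@le_trans _ _ ((\sum_i (Z i w ^+ 2 + 1)) ^+ 3)).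
    rewrite lerXn2r ?nnegrE//; first by apply: sumr_ge0 => i _; rewrite addr_ge0 ?sqr_ge0.
    rewrite sqnorm_centered (le_trans (ler_norm_sum _ _ _))//; apply: ler_sum => i _.
    by rewrite (le_trans (ler_normB _ _))// normr1 ger0_norm ?sqr_ge0.
  have := @sum_expr_le _ (fun i : 'I_p => Z i w ^+ 2 + 1) 3; rewrite card_ord; apply => //.
  by move=> i; rewrite addr_ge0 ?sqr_ge0.
have ms : measurable_fun setT sqnorm := integ_measurable integ_sqnorm.
have i1 : integ P (fun w => `|sqnorm w - p%:R| ^+ 3).
  apply: integ_le iB.
    by apply: measurable_funX; apply: measurableT_comp => //; exact: measurable_funB.
  by move=> w; rewrite ger0_norm ?exprn_ge0.
split => //; apply: (le_trans (EE_le i1 iB nB)).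
rewrite EEZ// EE_sum; last by move=> i; have [] := i3 i.
rewrite (eq_bigr (fun=> sqr1_cube)); last by move=> i _; have [] := i3 i.
by rewrite sumr_const card_ord -[sqr1_cube *+ p]mulr_natl mulrA -exprSr.
Qed.

Lemma sqnorm_sqr : integ P (fun w => sqnorm w ^+ 2) /\
  EE P (fun w => sqnorm w ^+ 2) <= 3 * p%:R ^+ 3.
Proof.
pose B w := p%:R ^+ 2 * \sum_i (Z i w ^+ 2) ^+ 2.
have E4 i : (fun w => (Z i w ^+ 2) ^+ 2) = (fun w => Z i w ^+ 4).
  by apply/funext => w; rewrite -exprM.
have i4 i : integ P (fun w => (Z i w ^+ 2) ^+ 2) by rewrite E4; exact: integ_std_exp.
have iB : integ P B by apply: integZ; apply: integ_sum => i _.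
have nB w : sqnorm w ^+ 2 <= B w.
  have := @sum_expr_le _ (fun i : 'I_p => Z i w ^+ 2) 2; rewrite card_ord; apply => //.
  by move=> i; rewrite sqr_ge0.
have ms : measurable_fun setT sqnorm := integ_measurable integ_sqnorm.
have i1 : integ P (fun w => sqnorm w ^+ 2).
  apply: integ_le iB; first exact: measurable_funX.
  by move=> w; rewrite ger0_norm ?sqr_ge0.
split => //; apply: (le_trans (EE_le i1 iB nB)).
rewrite EEZ ?EE_sum//; last by apply: integ_sum.
rewrite (eq_bigr (fun=> 3)); last by move=> i _; rewrite E4 EE_std_exp; case: (gaussian_moments R).
rewrite sumr_const card_ord -[3 *+ p]mulr_natr.
by rewrite le_eqVlt; apply/orP; left; apply/eqP; ring.
Qed.

Section rotation.
Variable O : 'M[R]_p.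
Hypothesis OO : O *m O^T = 1%:M.

Definition rot a w := \sum_c O a c * Z c w.

Lemma integ_rot a : integ P (rot a).
Proof.
by apply: integ_sum => c _; apply: integZ; have := integ_std_exp c 1.
Qed.

Lemma EE_rot a : EE P (rot a) = 0.
Proof.
have i1 k : integ P (Z k : T -> R) by have := integ_std_exp k 1.
rewrite /rot EE_sum; last by move=> c; exact: integZ.
by rewrite big1// => c _; rewrite EEZ// EE_std1 mulr0.
Qed.

Lemma rotM a b : (fun w => rot a w * rot b w) =
  (fun w => \sum_c \sum_e (O a c * O b e) * (Z c w * Z e w)).
Proof.
apply/funext => w; rewrite /rot mulr_suml; apply: eq_bigr => c _.
by rewrite mulr_sumr; apply: eq_bigr => e _; ring.
Qed.

Lemma integ_rotM a b : integ P (fun w => rot a w * rot b w).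
Proof.
rewrite rotM; apply: integ_sum => c _; apply: integ_sum => e _.
by apply: integZ; exact: integ_stdM.
Qed.

Lemma EE_rotM a b : EE P (fun w => rot a w * rot b w) = (a == b)%:R.
Proof.
rewrite rotM EE_sum; last first.
  by move=> c; apply: integ_sum => e _; apply: integZ; exact: integ_stdM.
transitivity ((O *m O^T) a b); last by rewrite OO mxE.
rewrite mxE; apply: eq_bigr => c _.
rewrite EE_sum; last by move=> e; apply: integZ; exact: integ_stdM.
rewrite (bigD1 c)//= big1 ?addr0.
  by rewrite EEZ ?EE_stdM ?eqxx ?mulr1 ?mxE//; exact: integ_stdM.
move=> e /negbTE ec; rewrite EEZ ?EE_stdM; last exact: integ_stdM.
by rewrite eq_sym ec mulr0.
Qed.

Lemma rot_sqnorm w : \sum_a rot a w ^+ 2 = sqnorm w.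
Proof.
pose z : 'cV[R]_p := \col_i Z i w.
have rE a : rot a w = (O *m z) a 0 by rewrite mxE; apply: eq_bigr => c _; rewrite mxE.
have OO' : O^T *m O = 1%:M by exact: mulmx1C.
transitivity (((O *m z)^T *m (O *m z)) 0 0).
  by rewrite mxE; apply: eq_bigr => a _; rewrite rE [(_^T) _ _]mxE expr2.
rewrite trmx_mul -mulmxA (mulmxA O^T) OO' mul1mx mxE.
by apply: eq_bigr => a _; rewrite !mxE expr2.
Qed.

Lemma rot_norm_le a b w : `|rot a w * rot b w| <= sqnorm w.
Proof.
rewrite -rot_sqnorm normrM.
have h k : `|rot k w| ^+ 2 <= \sum_a rot a w ^+ 2.
  rewrite real_normK ?num_real// [leRHS](bigD1 k)//= lerDl.
  by apply: sumr_ge0 => i _; rewrite sqr_ge0.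
have ha := h a; have hb := h b.
set x := `|_| in ha *; set y := `|_| in hb *.
by have := sqr_ge0 (x - y); nra.
Qed.

(** Comes from (x - delta)^2 <= 2 |Z|^4 + 2, for x a product of two rotated coordinates and delta 0
    or 1, and from E |Z|^4 <= 3 p^3. *)
Definition rot_bound : R := 6 * p%:R ^+ 3 + 2.

Lemma rotM_var a b : integ P (fun w => (rot a w * rot b w - (a == b)%:R) ^+ 2) /\
  EE P (fun w => (rot a w * rot b w - (a == b)%:R) ^+ 2) <= rot_bound.
Proof.
have [i2 E2] := sqnorm_sqr.
have iB : integ P (fun w => 2 * sqnorm w ^+ 2 + 2).
  exact: (integD (integZ 2 i2) (integ_cst P 2)).
have nB w : (rot a w * rot b w - (a == b)%:R) ^+ 2 <= 2 * sqnorm w ^+ 2 + 2.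
  have := rot_norm_le a b w; rewrite -real_normK ?num_real//.
  set x := rot a w * rot b w => hx.
  have e01 : `|(a == b)%:R : R| <= 1 by case: eqP; rewrite ?normr1 ?normr0.
  have := ler_normB x (a == b)%:R; set u := `|_ - _| => hu.
  have u0 : 0 <= u by rewrite normr_ge0.
  have hv : u <= sqnorm w + 1 by lra.
  have s0 : 0 <= sqnorm w by rewrite (le_trans _ hx).
  by have := sqr_ge0 (sqnorm w - 1); nra.
have i1 : integ P (fun w => (rot a w * rot b w - (a == b)%:R) ^+ 2).
  apply: integ_le iB; last by move=> w; rewrite ger0_norm ?sqr_ge0.
  apply: measurable_funX; apply: measurable_funB => //.
  exact: integ_measurable (integ_rotM a b).
split => //; apply: (le_trans (EE_le i1 iB nB)).
rewrite (EED (integZ 2 i2) (integ_cst P 2)) (EEZ 2 i2) EE_cst /rot_bound lerD2r.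
move: E2; lra.
Qed.

End rotation.

End standard_normal.

(** * Whitened observations *)

Section standardized_coordinates.
Context (R : realType) (p : nat) (A0 Sigma1 : 'M[R]_p).
Hypotheses (p0 : (0 < p)%N) (uA0 : A0 \in unitmx) (A0E : A0 *m A0^T = Sigma1).

Definition std_coord (mu : 'cV[R]_p) (x : p.-tuple R) (a : 'I_p) : R :=
  (invmx A0 *m (col_of_tuple x - mu)) a 0.

Definition std_quad mu x : R := \sum_a std_coord mu x a ^+ 2.

Lemma measurable_std_coord mu a : measurable_fun setT (fun x => std_coord mu x a).
Proof.
rewrite (_ : (fun x => _) = fun x : p.-tuple R =>
    \sum_c invmx A0 a c * (tnth x c - mu c 0)); last first.
  by apply/funext => x; rewrite /std_coord mxE; apply: eq_bigr => c _; rewrite !mxE.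
apply: measurable_sum_cond => c _; apply: measurable_funM => //.
by apply: measurable_funB => //; exact: measurable_tnth.
Qed.

Lemma measurable_std_quad mu : measurable_fun setT (std_quad mu).
Proof.
by apply: measurable_sum_cond => a _; apply: measurable_funX; exact: measurable_std_coord.
Qed.

Context d (T : measurableType d) (P : probability T R).
Variables (mu : 'cV[R]_p) (X : {RV P >-> p.-tuple R}).
Hypothesis hX : multivariate_normal mu Sigma1 X.

(** The factor [A] that comes with an observation may differ from [A0], but A0^-1 A is orthogonal.
    Afterwards only the rotation-invariant norm and moment bounds of the coordinates are used. *)
Lemma std_coord_rot : exists (Z : 'I_p -> {RV P >-> R}) (O : 'M[R]_p),
  [/\ standard_normal_vector Z, O *m O^T = 1%:M &
      forall a, (fun w => std_coord mu (X w) a) = rot Z O a].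
Proof.
have [A [Z [AE hZ XE]]] := hX; exists Z, (invmx A0 *m A); split => //.
  rewrite trmx_mul mulmxA -(mulmxA _ A) AE -A0E mulmxA mulVmx// mul1mx.
  by rewrite -trmx_mul mulVmx// trmx1.
move=> a; apply/funext => w; rewrite /std_coord XE addrC addrA addNr add0r mulmxA mxE.
by apply: eq_bigr => c _; rewrite !mxE.
Qed.

Lemma std_coord_mean a : integ P (fun w => std_coord mu (X w) a) /\
  EE P (fun w => std_coord mu (X w) a) = 0.
Proof.
have [Z [U [hZ UU h]]] := std_coord_rot; rewrite h.
by split; [exact: integ_rot|exact: EE_rot].
Qed.

Lemma std_coord_cov a b :
  integ P (fun w => std_coord mu (X w) a * std_coord mu (X w) b) /\
  EE P (fun w => std_coord mu (X w) a * std_coord mu (X w) b) = (a == b)%:R.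
Proof.
have [Z [U [hZ UU h]]] := std_coord_rot.
rewrite (_ : (fun w => _) = fun w => rot Z U a w * rot Z U b w).
  by split; [exact: integ_rotM|exact: EE_rotM].
by apply/funext => w; rewrite -!h.
Qed.

Lemma std_coord_cov_var a b :
  integ P (fun w => (std_coord mu (X w) a * std_coord mu (X w) b - (a == b)%:R) ^+ 2) /\
  EE P (fun w => (std_coord mu (X w) a * std_coord mu (X w) b - (a == b)%:R) ^+ 2)
    <= rot_bound R p.
Proof.
have [Z [U [hZ UU h]]] := std_coord_rot.
rewrite (_ : (fun w => _) = fun w => (rot Z U a w * rot Z U b w - (a == b)%:R) ^+ 2).
  exact: rotM_var.
by apply/funext => w; rewrite -!h.
Qed.

Let quadE (Z : 'I_p -> {RV P >-> R}) (U : 'M[R]_p) w : standard_normal_vector Z -> U *m U^T = 1%:M ->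
  (forall a, (fun w => std_coord mu (X w) a) = rot Z U a) ->
  std_quad mu (X w) = sqnorm Z w.
Proof.
move=> hZ UU h; rewrite -(rot_sqnorm _ UU); apply: eq_bigr => a _.
by rewrite -h.
Qed.

Lemma std_quad_mean : integ P (fun w => std_quad mu (X w)) /\
  EE P (fun w => std_quad mu (X w)) = p%:R.
Proof.
have [Z [U [hZ UU h]]] := std_coord_rot.
rewrite (_ : (fun w => _) = sqnorm Z).
  by split; [exact: integ_sqnorm|exact: EE_sqnorm].
by apply/funext => w; exact: quadE h.
Qed.

Lemma std_quad_var : EE P (fun w => (std_quad mu (X w) - p%:R) ^+ 2) = 2 * p%:R.
Proof.
have [Z [U [hZ UU h]]] := std_coord_rot.
rewrite (_ : (fun w => _) = fun w => (sqnorm Z w - p%:R) ^+ 2); first exact: EE_sqnorm_var.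
by apply/funext => w; rewrite (quadE _ hZ UU h).
Qed.

Lemma std_quad_cube : integ P (fun w => `|std_quad mu (X w) - p%:R| ^+ 3) /\
  EE P (fun w => `|std_quad mu (X w) - p%:R| ^+ 3) <= p%:R ^+ 4 * sqr1_cube R.
Proof.
have [Z [U [hZ UU h]]] := std_coord_rot.
rewrite (_ : (fun w => _) = fun w => `|sqnorm Z w - p%:R| ^+ 3); first exact: sqnorm_cube.
by apply/funext => w; rewrite (quadE _ hZ UU h).
Qed.

End standardized_coordinates.

Lemma big_tagged (R : Type) (idx : R) (op : Monoid.com_law idx) (J : finType)
    (K : J -> finType) (j : J) (F : {k : J & K k} -> R) :
  \big[op/idx]_(s | tag s == j) F s = \big[op/idx]_(i : K j) F (Tagged K i).
Proof.
rewrite -[RHS](@big_pred1_eq _ idx op J j (fun k => \big[op/idx]_(i : K k) F (Tagged K i))).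
rewrite sig_big_dep /=.
by apply: eq_big => [s|[k i] _]; rewrite ?andbT.
Qed.

Section one_stage.
Context (R : realType) (p q : nat) (n : 'I_q.+1 -> nat) (mu : 'I_q.+1 -> 'cV[R]_p).
Variables (A0 Sigma1 : 'M[R]_p).
Hypotheses (p0 : (0 < p)%N) (n0 : forall k, (0 < n k)%N).
Hypotheses (uA0 : A0 \in unitmx) (A0E : A0 *m A0^T = Sigma1).
Context d (T : measurableType d) (P : probability T R).
Variable X : forall k : 'I_q.+1, 'I_(n k).+1 -> {RV P >-> p.-tuple R}.
Hypothesis hX : forall k i, multivariate_normal (mu k) Sigma1 (@X k i).
Hypothesis hind : mutually_independent P
  (fun s : {k : 'I_q.+1 & 'I_(n k).+1} => X (tagged s) : T -> _).

Let I : finType := {k : 'I_q.+1 & 'I_(n k).+1}.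

Let mX (s : I) : measurable_fun setT (X (tagged s) : T -> _).
Proof. exact: measurable_funP. Qed.

Let hXs (s : I) : multivariate_normal (mu (tag s)) Sigma1 (X (tagged s)).
Proof. exact: hX. Qed.

(** There are n_k + 1 summands of variance 2 p, normalized with n_k as in the sample covariance, so
    the variance is (n_k + 1) / n_k rather than 1. *)
Definition std_trace (k : 'I_q.+1) (w : T) : R :=
  (Num.sqrt (2 * p%:R * (n k)%:R))^-1 * \sum_i (std_quad A0 (mu k) (@X k i w) - p%:R).

Let xi (s : I) (x : p.-tuple R) : R :=
  (Num.sqrt (2 * p%:R))^-1 * (std_quad A0 (mu (tag s)) x - p%:R).

Let mxi s : measurable_fun setT (xi s).
Proof.
by apply: measurable_funM => //; apply: measurable_funB => //; exact: measurable_std_quad.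
Qed.

Let pp1 : 1 <= 2 * p%:R :> R.
Proof.
have : 1 <= p%:R :> R by rewrite ler1n.
by move=> h; rewrite (le_trans h)// ler_peMl// ler1n.
Qed.

Let sp1 : (Num.sqrt (2 * p%:R))^-1 <= 1 :> R.
Proof. by rewrite invf_le1 ?sqrtr_gt0 ?(lt_le_trans _ pp1)// -[leLHS]sqrtr1 ler_wsqrtr. Qed.

Let xi_cube s : integ P (fun w => `|xi s (X (tagged s) w)| ^+ 3) /\
  EE P (fun w => `|xi s (X (tagged s) w)| ^+ 3) <= p%:R ^+ 4 * sqr1_cube R.
Proof.
have [i3 E3] := std_quad_cube p0 uA0 A0E (hXs s).
have le3 w : `|xi s (X (tagged s) w)| ^+ 3 <=
    `|std_quad A0 (mu (tag s)) (X (tagged s) w) - p%:R| ^+ 3.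
  rewrite lerXn2r ?nnegrE// normrM ler_piMl//.
  by rewrite ger0_norm// invr_ge0 sqrtr_ge0.
have i1 : integ P (fun w => `|xi s (X (tagged s) w)| ^+ 3).
  apply: integ_le i3.
    by apply: measurable_funX; apply: measurableT_comp => //; exact: measurableT_comp.
  by move=> w; rewrite ger0_norm ?exprn_ge0.
by split => //; apply: le_trans E3; exact: EE_le.
Qed.

Let xi_mean s : EE P (fun w => xi s (X (tagged s) w)) = 0.
Proof.
have [i1 E1] := std_quad_mean uA0 A0E (hXs s).
rewrite /xi (EEZ _ (integB i1 (integ_cst P p%:R))) (EEB i1 (integ_cst P p%:R)).
by rewrite EE_cst E1 subrr mulr0.
Qed.

Let xi_var s : EE P (fun w => xi s (X (tagged s) w) ^+ 2) = 1.
Proof.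
have i2 : integ P (fun w => (std_quad A0 (mu (tag s)) (X (tagged s) w) - p%:R) ^+ 2).
  have [i3 _] := std_quad_cube p0 uA0 A0E (hXs s).
  apply: (integ_of_cube2 _ i3); apply: measurable_funB => //.
  by apply: measurableT_comp => //; exact: measurable_std_quad.
rewrite (_ : (fun w => _) = fun w => (2 * p%:R)^-1 *
    (std_quad A0 (mu (tag s)) (X (tagged s) w) - p%:R) ^+ 2); last first.
  by apply/funext => w; rewrite /xi exprMn exprVn sqr_sqrtr// (le_trans ler01).
rewrite EEZ// (std_quad_var uA0 A0E (hXs s)) mulVf//.
by rewrite gt_eqF// (lt_le_trans _ pp1).
Qed.

Let rate (j : 'I_q.+1) : R := (Num.sqrt (n j)%:R)^-1.

Let std_traceE j w : \sum_(s : I | tag s == j) rate (tag s) * xi s (X (tagged s) w) =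
  std_trace j w.
Proof.
rewrite big_tagged /std_trace mulr_sumr; apply: eq_bigr => i _ /=.
rewrite /rate /xi mulrA; congr (_ * _).
by rewrite -invfM -sqrtrM// mulrC.
Qed.

(** Each of the n_j + 1 observations of group j is scaled by n_j^(-1/2); hence the time (n_j + 1) /
    n_j and the error (n_j + 1) n_j^(-3/2) <= 2 n_j^(-1/2). *)
Lemma std_trace_lindeberg (a : 'I_q.+1 -> R) (b : R) : 0 < b ->
  `|EE P (fun w => \prod_j expR (- b * std_trace j w ^+ 2 + a j * std_trace j w)) -
    \prod_j heat b (a j) ((n j).+1%:R / (n j)%:R) 0| <=
  chain_const a b * (p%:R ^+ 4 * sqr1_cube R + gauss_abs3 R) *
  \sum_j 2 * (Num.sqrt (n j)%:R)^-1.
Proof.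
move=> b0.
have rate0 j : 0 <= rate j by rewrite invr_ge0 sqrtr_ge0.
have H := lindeberg mX hind mxi (fun s => (xi_cube s).1) (fun s => (xi_cube s).2)
  xi_mean xi_var (fun s => tag s) a rate0 b0.
have E1 : (fun w => \prod_j expR (- b * std_trace j w ^+ 2 + a j * std_trace j w)) =
   (fun w => \prod_j
      expR (- b * (\sum_(i : I | tag i == j) rate j * xi i (X (tagged i) w)) ^+ 2 +
            a j * \sum_(i : I | tag i == j) rate j * xi i (X (tagged i) w))).
  apply/funext => w; apply: eq_bigr => j _.
  rewrite (eq_bigr (fun s => rate (tag s) * xi s (X (tagged s) w))); last by move=> s /eqP <-.
  by rewrite std_traceE.
have E2 j : \sum_(i : I | tag i == j) rate j ^+ 2 = (n j).+1%:R / (n j)%:R.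
  rewrite big_tagged sumr_const card_ord /rate exprVn sqr_sqrtr//.
  by rewrite -[_ *+ (n j).+1]mulr_natl.
rewrite E1; move: H; under [X in _ - X]eq_bigr do rewrite E2.
move/le_trans; apply.
have C0 : 0 <= chain_const a b * (p%:R ^+ 4 * sqr1_cube R + gauss_abs3 R).
  rewrite mulr_ge0// ?addr_ge0 ?mulr_ge0 ?exprn_ge0//.
  - by rewrite addr_ge0// mulr_ge0// ltW.
  - by rewrite addr_ge0// mulr_ge0// sqr_ge0.
  - by apply: prodr_ge0 => j _; exact: expR_ge0.
  - by apply: EE_ge0 => x; rewrite exprn_ge0// addr_ge0// sqr_ge0.
  - by apply: EE_ge0 => x; rewrite exprn_ge0.
rewrite ler_wpM2l//.
rewrite (partition_big (fun s : {k : 'I_q.+1 & 'I_(n k).+1} => tag s) xpredT)//=; apply: ler_sum => j _.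
rewrite (eq_bigr (fun=> rate j ^+ 3)); last by move=> s /eqP <-.
rewrite big_tagged sumr_const card_ord -[_ *+ (n j).+1]mulr_natl.
have nj : 1 <= (n j)%:R :> R by rewrite ler1n.
have s2 : rate j ^+ 2 = (n j)%:R^-1 by rewrite /rate exprVn sqr_sqrtr.
rewrite exprSr s2 mulrA ler_wpM2r ?rate0//.
rewrite ler_pdivrMr ?(lt_le_trans _ nj)// -natr1.
lra.
Qed.

(** One variable that dominates the squares of all centred sums divided by n_k. Its mean is bounded
    uniformly in the sample sizes, so a single Markov-type bound confines all these sums to order
    sqrt n_k. *)
Definition deviation (w : T) : R :=
  \sum_k (\sum_a \sum_b (\sum_i (std_coord A0 (mu k) (@X k i w) a *
                                 std_coord A0 (mu k) (@X k i w) b - (a == b)%:R)) ^+ 2 +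
          \sum_a (\sum_i std_coord A0 (mu k) (@X k i w) a) ^+ 2) / (n k)%:R.

Lemma deviation_bound : integ P deviation /\
  EE P deviation <= q.+1%:R * ((p%:R ^+ 2 + p%:R) * (2 * rot_bound R p)).
Proof.
have V0 : 0 <= rot_bound R p by rewrite addr_ge0// mulr_ge0// exprn_ge0.
have V1 : 1 <= rot_bound R p.
  by rewrite (@le_trans _ _ 2) ?ler1n// lerDr mulr_ge0// exprn_ge0.
have hsum (k : 'I_q.+1) (g : 'cV[R]_p -> p.-tuple R -> R) :
    (forall v, measurable_fun setT (g v)) ->
    (forall s : I, integ P (fun w => g (mu (tag s)) (X (tagged s) w) ^+ 2)) ->
    (forall s : I, EE P (fun w => g (mu (tag s)) (X (tagged s) w)) = 0) ->
    (forall s : I, EE P (fun w => g (mu (tag s)) (X (tagged s) w) ^+ 2) <= rot_bound R p) ->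
    integ P (fun w => (\sum_i g (mu k) (@X k i w)) ^+ 2) /\
    EE P (fun w => (\sum_i g (mu k) (@X k i w)) ^+ 2) <= (n k).+1%:R * rot_bound R p.
  move=> mg ig g0 gV.
  have [hE hi] := EE_sqr_sum_indep mX hind [set s : I | tag s == k]%SET
     (fun s => mg (mu (tag s))) ig g0.
  have E : (fun w => (\sum_i g (mu k) (@X k i w)) ^+ 2) =
      (fun w => (\sum_(s in [set s : I | tag s == k]%SET) g (mu (tag s)) (X (tagged s) w)) ^+ 2).
    apply/funext => w; congr (_ ^+ 2).
    rewrite (eq_bigl (fun s : I => tag s == k)); last by move=> s; rewrite inE.
    by rewrite big_tagged.
  rewrite E; split => //; rewrite hE.
  rewrite (eq_bigl (fun s : I => tag s == k)); last by move=> s; rewrite inE.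
  apply: (@le_trans _ _ (\sum_(s : I | tag s == k) rot_bound R p)).
    by apply: ler_sum => s _.
  by rewrite big_tagged sumr_const card_ord mulr_natl.
have hab k a b := hsum k (fun v x => std_coord A0 v x a * std_coord A0 v x b - (a == b)%:R).
have ha k a := hsum k (fun v x => std_coord A0 v x a).
pose y k (i : 'I_(n k).+1) a w := std_coord A0 (mu k) (@X k i w) a.
pose cross k a b w := (\sum_i (y k i a w * y k i b w - (a == b)%:R)) ^+ 2.
pose lin k a w := (\sum_i y k i a w) ^+ 2.
have {}hab k a b : integ P (cross k a b) /\ EE P (cross k a b) <= (n k).+1%:R * rot_bound R p.
  apply: hab.
  - by move=> v; apply: measurable_funB => //; apply: measurable_funM; exact: measurable_std_coord.
  - by move=> s; have [] := std_coord_cov_var p0 uA0 A0E (hXs s) a b.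
  - move=> s; have [i1 E1] := std_coord_cov uA0 A0E (hXs s) a b.
    by rewrite (EEB i1 (integ_cst P _)) EE_cst E1 subrr.
  - by move=> s; have [] := std_coord_cov_var p0 uA0 A0E (hXs s) a b.
have {}ha k a : integ P (lin k a) /\ EE P (lin k a) <= (n k).+1%:R * rot_bound R p.
  apply: ha.
  - by move=> v; exact: measurable_std_coord.
  - by move=> s; have [] := std_coord_cov uA0 A0E (hXs s) a a; under eq_fun do rewrite -expr2.
  - by move=> s; have [] := std_coord_mean uA0 A0E (hXs s) a.
  - move=> s; have [_] := std_coord_cov uA0 A0E (hXs s) a a; under eq_fun do rewrite -expr2.
    by move=> ->; rewrite eqxx.
pose D k w := \sum_a \sum_b cross k a b w + \sum_a lin k a w.
have i2 k : integ P (fun w => \sum_a \sum_b cross k a b w).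
  by apply: integ_sum => a _; apply: integ_sum => b _; have [] := hab k a b.
have i1 k : integ P (fun w => \sum_a lin k a w) by apply: integ_sum => a _; have [] := ha k a.
have iD k : integ P (D k) by exact: (integD (i2 k) (i1 k)).
have ED k : EE P (D k) <= (p%:R ^+ 2 + p%:R) * ((n k).+1%:R * rot_bound R p).
  rewrite (EED (i2 k) (i1 k)) mulrDl lerD//.
    rewrite EE_sum; last by move=> a; apply: integ_sum => b _; have [] := hab k a b.
    rewrite expr2 -mulrA; apply: ler_sum_ord => a; rewrite EE_sum; last by move=> b; have [] := hab k a b.
    by apply: ler_sum_ord => b; have [] := hab k a b.
  rewrite EE_sum; last by move=> a; have [] := ha k a.
  by apply: ler_sum_ord => a; have [] := ha k a.
have dE : deviation = (fun w => \sum_k (n k)%:R^-1 * D k w).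
  by apply/funext => w; apply: eq_bigr => k _; rewrite mulrC.
rewrite dE; split; first by apply: integ_sum => k _; exact: integZ.
rewrite EE_sum; last by move=> k; exact: integZ.
apply: ler_sum_ord => k; rewrite EEZ//.
have nk : 1 <= (n k)%:R :> R by rewrite ler1n.
rewrite mulrC ler_pdivrMr ?(lt_le_trans _ nk)// (le_trans (ED k))//.
rewrite -mulrA ler_wpM2l ?addr_ge0 ?exprn_ge0//.
by rewrite mulrAC ler_wpM2r// -natr1; lra.
Qed.

End one_stage.

(** * Asymptotic expansion of the statistic *)

(** N is n, with N + 1 observations; D is the sum of the centred products, U V / (N + 1) the
    correction for the sample mean, x the Kronecker symbol. *)
Lemma cov_dev_arith (R : realType) (N s U V D x B : R) : 1 <= s -> s ^+ 2 = N -> 0 <= B ->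
  `|D| <= B * s -> `|U| <= B * s -> `|V| <= B * s -> 0 <= x -> x <= 1 ->
  `|N^-1 * (D + (N + 1) * x - (N + 1)^-1 * (U * V)) - x| <= (B + 1 + B ^+ 2) / s.
Proof.
move=> s1 <- B0 hD hU hV x0 x1; have s0 : 0 < s by lra.
have N1 : 0 < s ^+ 2 + 1 by rewrite addr_gt0 ?exprn_gt0.
have -> : (s ^+ 2)^-1 * (D + (s ^+ 2 + 1) * x - (s ^+ 2 + 1)^-1 * (U * V)) - x =
    (s ^+ 2)^-1 * (D + x - (s ^+ 2 + 1)^-1 * (U * V)) by field; rewrite !gt_eqF.
have h : `|(s ^+ 2 + 1)^-1 * (U * V)| <= B ^+ 2.
  rewrite normrM (@ger0_norm _ (_ ^-1)) ?invr_ge0 ?(ltW N1)// [leLHS]mulrC ler_pdivrMr// normrM.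
  rewrite (le_trans (ler_pM _ _ hU hV))//; nra.
rewrite normrM ger0_norm ?invr_ge0 ?sqr_ge0// [leLHS]mulrC ler_pdivrMr ?exprn_gt0//.
have -> : (B + 1 + B ^+ 2) / s * s ^+ 2 = (B + 1 + B ^+ 2) * s by field; rewrite gt_eqF.
have h2 : `|D + x - (s ^+ 2 + 1)^-1 * (U * V)| <= B * s + 1 + B ^+ 2.
  by rewrite (le_trans (ler_normB _ _))// lerD// (le_trans (ler_normD _ _))// lerD// ger0_norm.
by rewrite (le_trans h2)// !mulrDl mul1r lerD// ?lerD// ler_peMr// sqr_ge0.
Qed.

Section sample_covariance_whitened.
Context (R : realType) (p : nat) (A0 : 'M[R]_p).

Lemma whiten_sample_cov n (x : 'I_n.+1 -> 'cV[R]_p) (mu : 'cV[R]_p) a b :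
  let y i c := (invmx A0 *m (x i - mu)) c 0 in
  whiten A0 (sample_cov x) a b = n%:R^-1 * (\sum_i y i a * y i b -
    n.+1%:R^-1 * ((\sum_i y i a) * (\sum_i y i b))).
Proof.
move=> y; set N : R := n.+1%:R.
have N0 : N != 0 by rewrite pnatr_eq0.
pose m c := N^-1 * \sum_i y i c.
have ym i c : (invmx A0 *m (x i - sample_mean x)) c 0 = y i c - m c.
  have -> : x i - sample_mean x = (x i - mu) - N^-1 *: \sum_j (x j - mu).
    rewrite /sample_mean sumrB sumr_const card_ord scalerBr -/N.
    by rewrite -scaler_nat scalerA mulVf// scale1r opprB addrA subrK.
  have entry (U V : 'cV[R]_p) s : (U - s *: V) c 0 = U c 0 - s * V c 0 by rewrite !mxE.
  by rewrite mulmxBr -scalemxAr entry mulmx_sumr summxE.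
have -> : whiten A0 (sample_cov x) a b = n%:R^-1 * \sum_i (y i a - m a) * (y i b - m b).
  rewrite /whiten /sample_cov /= -scalemxAr -scalemxAl mxE; congr (_ * _).
  rewrite mulmx_sumr mulmx_suml summxE; apply: eq_bigr => i _.
  rewrite mulmxA -(mulmxA (invmx A0 *m _)) -trmx_mul mxE big_ord1 -!ym; congr (_ * _).
  by rewrite mxE.
congr (_ * _).
have -> : \sum_i (y i a - m a) * (y i b - m b) = \sum_i y i a * y i b -
    m b * (\sum_i y i a) - m a * (\sum_i y i b) + N * (m a * m b).
  have -> : N * (m a * m b) = \sum_(i < n.+1) m a * m b.
    by rewrite sumr_const card_ord mulr_natl.
  rewrite !mulr_sumr -!sumrB -big_split /=; apply: eq_bigr => i _; ring.
by rewrite /m; field.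
Qed.

Lemma whiten_sample_cov_dev n (x : 'I_n.+1 -> 'cV[R]_p) (mu : 'cV[R]_p) (B : R) :
  let y i c := (invmx A0 *m (x i - mu)) c 0 in (0 < n)%N -> 0 <= B ->
  (forall a b, `|\sum_i (y i a * y i b - (a == b)%:R)| <= B * Num.sqrt n%:R) ->
  (forall a, `|\sum_i y i a| <= B * Num.sqrt n%:R) ->
  forall a b, `|whiten A0 (sample_cov x) a b - (a == b)%:R| <=
    (B + 1 + B ^+ 2) / Num.sqrt n%:R.
Proof.
move=> y n0 B0 hab ha a b.
have nR : 1 <= n%:R :> R by rewrite ler1n.
have s2 : Num.sqrt n%:R ^+ 2 = n%:R :> R by rewrite sqr_sqrtr.
have s1 : 1 <= Num.sqrt n%:R :> R by rewrite -[leLHS]sqrtr1 ler_wsqrtr.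
rewrite (whiten_sample_cov x mu) -/(y) -natr1.
have -> : \sum_i y i a * y i b =
    \sum_i (y i a * y i b - (a == b)%:R) + (n%:R + 1) * (a == b)%:R.
  by rewrite sumrB sumr_const card_ord -[_ *+ n.+1]mulr_natl natr1 subrK.
by apply: (cov_dev_arith s1 s2 B0 (hab a b) (ha a) (ha b) (ler0n _ _)); case: (a == b).
Qed.

Lemma std_sum_bound n (x : 'I_n.+1 -> 'cV[R]_p) (mu : 'cV[R]_p) (B : R) :
  let y i c := (invmx A0 *m (x i - mu)) c 0 in (0 < p)%N -> (0 < n)%N -> 0 <= B ->
  (forall a, `|\sum_i (y i a ^+ 2 - 1)| <= B * Num.sqrt n%:R) ->
  `|(Num.sqrt (2 * p%:R * n%:R))^-1 * \sum_i (\sum_a y i a ^+ 2 - p%:R)| <= p%:R * B.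
Proof.
move=> y p0 n0 B0 hy.
have n1 : 0 < n%:R :> R by rewrite ltr0n.
have pp : 1 <= 2 * p%:R :> R by rewrite -natrM ler1n muln_gt0.
rewrite normrM normfV (ger0_norm (sqrtr_ge0 _)) [leLHS]mulrC.
rewrite ler_pdivrMr ?sqrtr_gt0 ?mulr_gt0 ?ltr0n//.
have -> : \sum_i (\sum_a y i a ^+ 2 - p%:R) = \sum_a \sum_i (y i a ^+ 2 - 1).
  rewrite exchange_big; apply: eq_bigr => i _.
  by rewrite sumrB sumr_const card_ord.
rewrite (le_trans (ler_norm_sum _ _ _))// -[leRHS]mulrA.
apply: ler_sum_ord => a; rewrite (le_trans (hy a))// ler_wpM2l// ler_wsqrtr//.
by rewrite ler_peMl// ltW.
Qed.

(** [E] plays the role of sqrt n_+ and [r] that of n / n_+. The factor is the limiting standard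
    deviation, as n_+ (2 p) / (p^2 n) = 2 / (p r). The remainder comes from the correction for the
    sample mean and from n + 1 observations against the divisor n. *)
Lemma trace_whiten_sample_cov n (x : 'I_n.+1 -> 'cV[R]_p) (mu : 'cV[R]_p) (B E r : R) :
  let y i c := (invmx A0 *m (x i - mu)) c 0 in (0 < p)%N -> (0 < n)%N -> 0 <= B ->
  0 < E -> 0 < r -> r * E ^+ 2 = n%:R ->
  (forall a, `|\sum_i y i a| <= B * Num.sqrt n%:R) ->
  `|E * ((\tr (whiten A0 (sample_cov x)) - p%:R) / p%:R) - Num.sqrt (2 / (p%:R * r)) *
     ((Num.sqrt (2 * p%:R * n%:R))^-1 * \sum_i (\sum_a y i a ^+ 2 - p%:R))| <=
  (1 + B ^+ 2) * (r^-1 * E^-1).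
Proof.
move=> y p0 n0 B0 E0 r0 rE ha.
have n1 : 0 < n%:R :> R by rewrite ltr0n.
have pp : 0 < p%:R :> R by rewrite ltr0n.
have key : Num.sqrt (2 / (p%:R * r)) * (Num.sqrt (2 * p%:R * n%:R))^-1 = E / (n%:R * p%:R).
  rewrite -rE -sqrtrV ?mulr_ge0 ?(ltW E0) ?(ltW r0)// -sqrtrM ?divr_ge0 ?mulr_ge0 ?(ltW r0)//.
  have -> : 2 / (p%:R * r) / (2 * p%:R * (r * E ^+ 2)) = (E / (r * E ^+ 2 * p%:R)) ^+ 2.
    by move: E0 r0 pp; clear; move: p%:R => P E0 r0 pp; field; rewrite !gt_eqF.
  by rewrite sqrtr_sqr ger0_norm// divr_ge0 ?mulr_ge0 ?sqr_ge0 ?(ltW E0) ?(ltW r0).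
rewrite (mulrA (Num.sqrt (2 / _))) key.
pose W := \sum_a (n%:R + 1)^-1 * (\sum_i y i a) ^+ 2.
set Q := \sum_i _.
have trE : \tr (whiten A0 (sample_cov x)) = n%:R^-1 * (Q + (n%:R + 1) * p%:R - W).
  have -> : Q = (\sum_i \sum_a y i a ^+ 2) - (n%:R + 1) * p%:R.
    by rewrite /Q sumrB sumr_const card_ord -[_ *+ n.+1]mulr_natl natr1.
  rewrite subrK exchange_big -sumrB mulr_sumr; apply: eq_bigr => a _.
  rewrite (whiten_sample_cov x mu) -/(y) -natr1 expr2; congr (_ * (_ - _)).
have W0 : 0 <= W.
  by apply: sumr_ge0 => a _; rewrite mulr_ge0 ?sqr_ge0// invr_ge0 addr_ge0 ?(ltW n1).
have WB : W <= p%:R * B ^+ 2.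
  apply: ler_sum_ord => a.
  rewrite [leLHS]mulrC ler_pdivrMr ?addr_gt0// -real_normK ?num_real//.
  apply: (@le_trans _ _ ((B * Num.sqrt n%:R) ^+ 2)).
    by rewrite lerXn2r ?nnegrE ?mulr_ge0 ?sqrtr_ge0.
  by rewrite exprMn sqr_sqrtr ?(ltW n1)// ler_wpM2l ?sqr_ge0// lerDl.
rewrite trE.
have -> : E * ((n%:R^-1 * (Q + (n%:R + 1) * p%:R - W) - p%:R) / p%:R) -
   E / (n%:R * p%:R) * Q = (E / n%:R) * ((p%:R - W) / p%:R).
  by move: n1 pp; clear; move: n%:R p%:R W Q => *; field; rewrite !gt_eqF.
have -> : E / n%:R = r^-1 * E^-1 by rewrite -rE; move: E0 r0; clear => *; field; rewrite !gt_eqF.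
rewrite normrM ger0_norm; last by rewrite mulr_ge0 ?invr_ge0 ?(ltW E0) ?(ltW r0).
rewrite [leLHS]mulrC ler_wpM2r ?mulr_ge0 ?invr_ge0 ?(ltW E0) ?(ltW r0)//.
rewrite normrM normfV (gtr0_norm pp) ler_pdivrMr//.
rewrite (le_trans (ler_normB _ _))// (gtr0_norm pp) (ger0_norm W0).
by rewrite mulrDl mul1r lerD// mulrC.
Qed.

End sample_covariance_whitened.

Section closeness.
Context (R : realType) (p q : nat) (r : 'I_q.+1 -> R).
Hypotheses (p0 : (0 < p)%N) (r0 : forall k, 0 < r k) (r1 : \sum_k r k = 1).

(** The squared norm of the projection of Y orthogonally to the unit vector (sqrt r_k). *)
Definition quad_stat (Y : 'I_q.+1 -> R) : R :=
  \sum_k Y k ^+ 2 - (\sum_k Num.sqrt (r k) * Y k) ^+ 2.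

Let pp0 : 0 < p%:R :> R. Proof. by rewrite ltr0n. Qed.

Let zscale k : R := Num.sqrt (2 / (p%:R * r k)).

Let zs_sqr k : r k * zscale k ^+ 2 = 2 / p%:R.
Proof.
rewrite /zscale sqr_sqrtr ?divr_ge0 ?mulr_ge0 ?ltW//.
have E (a b : R) : a != 0 -> b != 0 -> b * (2 / (a * b)) = 2 / a.
  by move=> a0 b0; field; rewrite a0 b0.
by rewrite E// gt_eqF.
Qed.

(** Holds because r_k zscale_k^2 = 2 / p is the same for every k. *)
Lemma quad_stat_wvar (Y : 'I_q.+1 -> R) :
  quad_stat Y = p%:R / 2 * wvar r (fun k => zscale k * Y k).
Proof.
have pn0 : p%:R != 0 :> R by rewrite gt_eqF.
rewrite /quad_stat /wvar mulrBr; congr (_ - _).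
  rewrite mulr_sumr; apply: eq_bigr => k _.
  by rewrite exprMn (mulrA (r k)) zs_sqr; field.
have zr k : r k * (zscale k * Y k) = Num.sqrt (2 / p%:R) * (Num.sqrt (r k) * Y k).
  rewrite !mulrA; congr (_ * _); rewrite /zscale.
  have -> : 2 / (p%:R * r k) = 2 / p%:R * (r k)^-1 by rewrite invfM mulrA.
  rewrite sqrtrM ?divr_ge0 ?ltW// mulrCA; congr (_ * _).
  rewrite (sqrtrV (ltW (r0 k))) -{1}[r k]sqr_sqrtr ?ltW// expr2 -mulrA mulfV ?mulr1//.
  by rewrite gt_eqF// sqrtr_gt0.
under [in RHS]eq_bigr do rewrite zr.
rewrite -mulr_sumr exprMn sqr_sqrtr ?divr_ge0 ?ltW// mulrA.
by rewrite (_ : _ / 2 * _ = 1) ?mul1r//; field.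
Qed.

Lemma quad_stat_ge0 Y : 0 <= quad_stat Y.
Proof.
rewrite quad_stat_wvar mulr_ge0//; last by apply: wvar_ge0 => // k; exact: ltW.
Qed.

Section rates.
Variable B : R.
Hypothesis B0 : 0 <= B.

(** With e = n_+^(-1/2): [B1 * e] bounds the entries of the whitened S_k minus 1, [h] the loss, [w]
    the entries of the precision minus 1, and [rho] the error in the approximation of sqrt n_+ (1 -
    1 / c_k). The bounds [w] and [rho] are of order e^(1/2), and [Kz] bounds the approximating
    variables. *)
Let S1 : R := \sum_k (Num.sqrt (r k))^-1.
Let S2 : R := \sum_k (r k)^-1.
Let B1 : R := (B + 1 + B ^+ 2) * S1.
Let h (e : R) := 6 * p%:R ^+ 2 * B1 / r ord0 * e.
Let w (e : R) := 2 * Num.sqrt (h e) + h e.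
Let rho (e : R) := B1 * (2 * p%:R * w e) + 2 * B1 ^+ 2 * e * (2 + 2 * p%:R * w e) ^+ 2
  + 2 * (1 + B ^+ 2) * S2 * e.
Let Kz : R := 2 * \sum_k zscale k * (p%:R * B).

Let h_cvg : h e @[e --> (0 : R)] --> 0.
Proof. by apply: cvg0Ml; exact: cvg_id. Qed.

Let w_cvg : w e @[e --> (0 : R)] --> 0.
Proof.
rewrite -[X in _ --> X](addr0 0); apply: cvgD; last exact: h_cvg.
apply: cvg0Ml; rewrite -[X in _ --> X]sqrtr0.
by apply: (@continuous_cvg _ _ _ _ _ h (Num.sqrt : R -> R)); [exact: sqrt_continuous|exact: h_cvg].
Qed.

Let w2_cvg : 2 + 2 * p%:R * w e @[e --> (0 : R)] --> (2 : R).
Proof.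
rewrite -[X in _ --> X](addr0 2); apply: cvgD; first exact: cvg_cst.
by apply: cvg0Ml; exact: w_cvg.
Qed.

Let lin_cvg k : k * e @[e --> (0 : R)] --> (0 : R).
Proof. by apply: cvg0Ml; exact: cvg_id. Qed.

Let rho_cvg : rho e @[e --> (0 : R)] --> 0.
Proof.
rewrite -[X in _ --> X](addr0 0); apply: cvgD; last exact: lin_cvg.
rewrite -[X in _ --> X](addr0 0); apply: cvgD.
  by do 2 apply: cvg0Ml; exact: w_cvg.
rewrite -[X in _ --> X](mul0r (2 ^+ 2)); apply: cvgM; first exact: lin_cvg.
rewrite expr2; under eq_cvg do rewrite expr2.
by apply: cvgM; exact: w2_cvg.
Qed.

Let rates_small (z : R) : 0 < z -> exists2 e0 : R, 0 < e0 & forall e : R, 0 < e -> e <= e0 ->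
  [/\ 4 * p%:R * (B1 * e) <= 1, B1 * e * (2 + 2 * p%:R * w e) <= 2^-1 & rho e <= z].
Proof.
move=> z0.
have c1 : 4 * p%:R * (B1 * e) @[e --> (0 : R)] --> 0 by apply: cvg0Ml; exact: lin_cvg.
have c2 : B1 * e * (2 + 2 * p%:R * w e) @[e --> (0 : R)] --> 0.
  rewrite -[X in _ --> X](mul0r 2); apply: cvgM; last exact: w2_cvg.
  exact: lin_cvg.
have /cvgrPdist_le/(_ 1 ltr01) n1 := c1.
have h2 : 0 < 2^-1 :> R by rewrite invr_gt0.
have /cvgrPdist_le/(_ _ h2) n2 := c2.
have /cvgrPdist_le/(_ _ z0) n3 := rho_cvg.
have [d /= d0 hd] := (nbhs_ballP _ _).1 (filterI n1 (filterI n2 n3)); exists (d / 2); first by rewrite divr_gt0.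
move=> e e0 ed.
have [|k1 [k2 k3]] := hd e.
  rewrite /ball /= sub0r normrN gtr0_norm// (le_lt_trans ed)//.
  by rewrite ltr_pdivrMr// ltr_pMr// ltr1n.
move: k1 k2 k3; rewrite /= !sub0r !normrN => k1 k2 k3.
by split; apply: le_trans (ler_norm _) _.
Qed.

(** A deterministic statement: [e0] is chosen before the data, the sample sizes and the estimator,
    so it serves for all outcomes of the event at once. *)
Lemma statistic_quad_stat (z : R) : 0 < z -> exists2 e0 : R, 0 < e0 &
  forall (A0 : 'M[R]_p) (n : 'I_q.+1 -> nat) (mu : 'I_q.+1 -> 'cV[R]_p)
    (x : forall k, 'I_(n k).+1 -> 'cV[R]_p) (c : 'cV[R]_q) (Sigma : 'M[R]_p),
  let y k (i : 'I_(n k).+1) a : R := (invmx A0 *m (x k i - mu k)) a 0 in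
  A0 \in unitmx -> (forall k, (0 < n k)%N) ->
  (forall k, r k * (nplus n)%:R = (n k)%:R) -> (Num.sqrt (nplus n)%:R)^-1 <= e0 ->
  (forall k a b, `|\sum_i (y k i a * y k i b - (a == b)%:R)| <= B * Num.sqrt (n k)%:R) ->
  (forall k a, `|\sum_i y k i a| <= B * Num.sqrt (n k)%:R) ->
  is_mle n (fun k => sample_cov (x k)) c Sigma ->
  `|statistic p r (nplus n) c - quad_stat (fun k =>
     (Num.sqrt (2 * p%:R * (n k)%:R))^-1 * \sum_i (\sum_a y k i a ^+ 2 - p%:R))| <= z.
Proof.
move=> z0.
have zs0 k : 0 <= zscale k by exact: sqrtr_ge0.
have Kz0 : 0 <= Kz.
  by rewrite mulr_ge0// sumr_ge0// => k _; rewrite !mulr_ge0 ?ler0n.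
have K1 : 0 < 2 * Kz + 1 by rewrite ltr_wpDl// mulr_ge0.
(* Scaled so that [wvar_lip], after multiplication by p / 2, yields [z]; the minimum with 1 is the
   smallness required by that lemma. *)
have z1 : 0 < Num.min 1 (z / (p%:R * (2 * Kz + 1))).
  by rewrite lt_min ltr01 divr_gt0// mulr_gt0.
have [e0 e00 small] := rates_small z1; exists e0 => //.
move=> A0 n mu x c Sigma y uA0 n0 rn he hab ha mle.
set N : R := (nplus n)%:R in rn he *; set E := Num.sqrt N in he *.
have N0 : 0 < N.
  by rewrite ltr0n /nplus big_ord_recl addn_gt0 n0.
have E0 : 0 < E by rewrite sqrtr_gt0.
have EN : E ^+ 2 = N by rewrite sqr_sqrtr// ltW.
have Ev0 : 0 < E^-1 by rewrite invr_gt0.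
have [] := small _ Ev0 he; rewrite le_min; set e := B1 * E^-1.
move=> pe ew /andP[rho1 rhoz].
have [pc _] := mle; have [c0 pS] := pc.
have sE k : Num.sqrt (n k)%:R = Num.sqrt (r k) * E.
  by rewrite -rn sqrtrM// ltW.
have Se k a b : `|whiten A0 (sample_cov (x k)) a b - (a == b)%:R| <= e.
  rewrite (le_trans (whiten_sample_cov_dev (n0 k) B0 (hab k) (ha k) a b))//.
  rewrite sE invfM mulrA /e /B1 ler_wpM2r ?(ltW Ev0)// ler_wpM2l//.
    by rewrite addr_ge0 ?sqr_ge0 ?addr_ge0.
  rewrite /S1 (bigD1 k)//= lerDl; apply: sumr_ge0 => j _.
  by rewrite invr_ge0 sqrtr_ge0.
have loss : stein_loss (precision A0 Sigma) <= h E^-1.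
  have := mle_stein_loss p0 uA0 (erefl (A0 *m A0^T)) mle Se pe.
  rewrite -rn -/N => L.
  have {}L : (r ord0 * N) * stein_loss (precision A0 Sigma) <= (r ord0 * N) * h E^-1.
    have alg (u b v e' M : R) : v != 0 -> M * (6 * u * (b * e')) = v * M * (6 * u * b / v * e').
      by move=> v0; field.
    by apply: (le_trans L); rewrite /e (alg _ _ (r ord0)) ?gt_eqF.
  by move: L; rewrite ler_pM2l// mulr_gt0.
have Mw a b : `|precision A0 Sigma a b - (a == b)%:R| <= w E^-1.
  exact: (stein_loss_entries (posdef_precision uA0 pS) loss).
have main k := mle_expansion p0 n0 uA0 mle Se pe Mw ew k.
set Y := fun k => _.
have Yb k : `|Y k| <= p%:R * B.
  apply: std_sum_bound => // a; move: (hab k a a); rewrite eqxx.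
  by under eq_bigr do rewrite -expr2.
pose t k := trace_dev (fun k => sample_cov (x k)) A0 k.
have tY k : `|E * t k - zscale k * Y k| <= (1 + B ^+ 2) * ((r k)^-1 * E^-1).
  have rE : r k * E ^+ 2 = (n k)%:R by rewrite EN.
  exact: (trace_whiten_sample_cov p0 (n0 k) B0 E0 (r0 k) rE (ha k)).
have tY2 k : `|E * t k - zscale k * Y k| <= (1 + B ^+ 2) * S2 * E^-1.
  rewrite (le_trans (tY k))// mulrA ler_wpM2r ?(ltW Ev0)// ler_wpM2l//.
    by rewrite addr_ge0 ?sqr_ge0.
  rewrite /S2 (bigD1 k)//= lerDl; apply: sumr_ge0 => j _.
  by rewrite invr_ge0 ltW.
rewrite statistic_wvar//; last by move=> j; rewrite gt_eqF.
rewrite quad_stat_wvar -/N.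
(* A variance ignores constants, so both families are shifted to vanish at population 1; in this
   normalization [mle_expansion] compares them. *)
have -> : wvar r (fun k => zscale k * Y k) =
    wvar r (fun k => - (zscale ord0 * Y ord0) + 1 * (zscale k * Y k)).
  by rewrite wvar_affine// expr1n mul1r.
have -> : N * p%:R / 2 * wvar r (fun k => (with_c1 c k)^-1) =
    p%:R / 2 * wvar r (fun k => E + - E * (with_c1 c k)^-1).
  have alg (a b v : R) : a * b / 2 * v = b / 2 * (a * v) by field.
  by rewrite wvar_affine// sqrrN EN alg.
rewrite -mulrBr normrM ger0_norm ?divr_ge0//.
have := @wvar_lip _ _ r r1 (fun k => E + - E * (with_c1 c k)^-1)
  (fun k => - (zscale ord0 * Y ord0) + 1 * (zscale k * Y k)) (rho E^-1) Kz
  (fun k => ltW (r0 k)) rho1.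
have zY k : `|zscale k * Y k| <= \sum_k zscale k * (p%:R * B).
  rewrite normrM ger0_norm//; apply: (@le_trans _ _ (zscale k * (p%:R * B))).
    by rewrite ler_wpM2l.
  rewrite (bigD1 k)//= lerDl; apply: sumr_ge0 => j _.
  by rewrite !mulr_ge0.
have cl1 k : `|E + - E * (with_c1 c k)^-1 - (- (zscale ord0 * Y ord0) + 1 * (zscale k * Y k))|
    <= rho E^-1.
  have -> : E + - E * (with_c1 c k)^-1 - (- (zscale ord0 * Y ord0) + 1 * (zscale k * Y k)) =
      E * (1 - (with_c1 c k)^-1 - (t k - t ord0)) +
      ((E * t k - zscale k * Y k) - (E * t ord0 - zscale ord0 * Y ord0)).
    by move: (zscale k) (zscale ord0) (t k) (t ord0); clear; move=> *; ring.
  have alg (u b E' v s : R) : E' != 0 -> b * (u * v) + 2 * b ^+ 2 * E'^-1 * (2 + u * v) ^+ 2 +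
      2 * s * E'^-1 = E' * (u * v * (b * E'^-1) + 2 * (b * E'^-1 * (2 + u * v)) ^+ 2) +
      (s * E'^-1 + s * E'^-1) by move=> v0; field.
  rewrite /rho -(mulrA 2 (1 + B ^+ 2)) alg ?gt_eqF// (le_trans (ler_normD _ _))// lerD//.
    by rewrite normrM (gtr0_norm E0) ler_wpM2l ?(ltW E0).
  by rewrite (le_trans (ler_normB _ _))// lerD.
have rho0 : 0 <= rho E^-1 := le_trans (normr_ge0 _) (cl1 ord0).
move=> /(_ cl1) lip.
have {}lip : `|wvar r (fun k => E + - E * (with_c1 c k)^-1) -
    wvar r (fun k => - (zscale ord0 * Y ord0) + 1 * (zscale k * Y k))| <=
    2 * (rho E^-1 * (2 * Kz + 1)).
  apply: lip => k; rewrite mul1r (le_trans (ler_normD _ _))// normrN /Kz mulr_natl mulr2n.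
  by rewrite lerD.
apply: (le_trans (ler_wpM2l _ lip)); first by rewrite divr_ge0.
rewrite -(mulrA p%:R) mulKf//.
by move: rhoz; rewrite ler_pdivlMr ?mulr_gt0// [p%:R * (2 * Kz + 1)]mulrC mulrA mulrC.
Qed.

End rates.

End closeness.

Section measurability.
Context (R : realType) d (T : measurableType d).

(** The inverse is written f (f^2)^(-1), with a measurable power of a nonnegative base; where f
    vanishes both sides are 0. *)
Lemma measurable_fun_inv (f : T -> R) : measurable_fun setT f ->
  measurable_fun setT (fun x => (f x)^-1).
Proof.
move=> mf; rewrite (_ : (fun x => _) = fun x => f x * (f x ^+ 2) `^ (- 1)); last first.
  apply/funext => x; rewrite powR_inv1 ?sqr_ge0//.
  have [->|f0] := eqVneq (f x) 0; first by rewrite invr0 mul0r.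
  by rewrite expr2 invfM mulrA mulfV// mul1r.
apply: measurable_funM => //.
exact: (measurableT_comp (@measurable_powR R (-1)) (measurable_funX 2 mf)).
Qed.

Lemma measurable_statistic p q (r : 'I_q.+1 -> R) N (c : 'I_q -> T -> R) :
  (forall j, measurable_fun setT (c j)) ->
  measurable_fun setT (fun w => statistic p r N (\col_j c j w)).
Proof.
move=> mc.
rewrite (_ : (fun w => _) = fun w => N%:R * (\sum_j (\sum_i (c i w - 1) *
    (p%:R / 2 * ((r (lift ord0 i) / c i w ^+ 2) *+ (i == j) -
     (r (lift ord0 i) / c i w) * (r (lift ord0 j) / c j w)))) * (c j w - 1))); last first.
  apply/funext => w; rewrite /statistic mxE; congr (_ * _); apply: eq_bigr => j _.
  rewrite [in LHS]mxE; congr (_ * _); last by rewrite !mxE.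
  apply: eq_bigr => i _; rewrite !mxE; congr (_ * (_ * (_ - _))).
  by rewrite big_ord1 !mxE.
have mV j : measurable_fun setT (fun w => (c j w)^-1) by exact: measurable_fun_inv.
apply: measurable_funM => //; apply: measurable_sum_cond => j _.
apply: measurable_funM; last exact: measurable_funB.
apply: measurable_sum_cond => i _; apply: measurable_funM; first exact: measurable_funB.
apply: measurable_funM => //; apply: measurable_funB.
  have m1 : measurable_fun setT (fun w => r (lift ord0 i) / c i w ^+ 2).
    apply: measurable_funM => //; apply: measurable_fun_inv; exact: measurable_funX.
  by case: (i == j) => //; under eq_fun do rewrite mulr0n.
by apply: measurable_funM; apply: measurable_funM.
Qed.

(** The minimum of |f| and g satisfies the bound everywhere and equals |f| almost everywhere. *)
Lemma EE_ae_norm_le (P : probability T R) (f g : T -> R) : integ P f -> integ P g ->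
  (forall w, 0 <= g w) -> {ae P, forall w, `|f w| <= g w} -> `|EE P f| <= EE P g.
Proof.
move=> fi gi g0 fg.
have mf := integ_measurable fi; have mg := integ_measurable gi.
have mn : measurable_fun setT (fun w => `|f w|) by exact: measurableT_comp.
have mm : measurable_fun setT (fun w => Num.min `|f w| (g w)) by exact: measurable_minr.
have ni : integ P (fun w => `|f w|) by exact: integrable_norm.
have mi : integ P (fun w => Num.min `|f w| (g w)).
  apply: (integ_le mm _ gi) => w.
  by rewrite ger0_norm ?ge_min ?lexx ?orbT// le_min normr_ge0 g0.
apply: (@le_trans _ _ (EE P (fun w => `|f w|))); first exact: EE_norm_le.
rewrite (ae_eq_EE mn mm); first by apply: EE_le => // w; rewrite ge_min lexx orbT.
by apply: filterS fg => w h; rewrite min_l.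
Qed.

Lemma ae_eq_sublevel (P : probability T R) (f g : T -> R) x :
  measurable_fun setT f -> measurable_fun setT g -> {ae P, forall w, f w = g w} ->
  P [set w | f w <= x] = P [set w | g w <= x].
Proof.
move=> mf mg fg.
have mA (h : T -> R) : measurable_fun setT h -> measurable [set w | h w <= x].
  move=> mh; have -> : [set w | h w <= x] = h @^-1` `]-oo, x].
    by apply/seteqP; split => w /=; rewrite in_itv.
  by rewrite -[X in measurable X]setTI; exact: mh.
rewrite -[LHS]fineK ?fin_num_measure//; last exact: mA.
rewrite -[RHS]fineK ?fin_num_measure//; last exact: mA.
congr EFin; rewrite -!EE_indic; [|exact: mA|exact: mA].
apply: ae_eq_EE; [by apply: measurable_indic; exact: mA|by apply: measurable_indic; exact: mA|].
by apply: filterS fg => w h; rewrite !indicE; congr (nat_of_bool _)%:R; apply/idP/idP;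
  rewrite !inE /= h.
Qed.

End measurability.

Section limits.
Context (R : realType).

Lemma invsqrt_cvg0 (f : nat -> nat) : f m @[m --> \oo] --> \oo ->
  (Num.sqrt (f m)%:R)^-1 @[m --> \oo] --> (0 : R).
Proof.
move=> foo; apply/cvgrPdist_le => e e0.
pose K := Num.bound ((e^-1) ^+ 2).
have KE : (e^-1) ^+ 2 < K%:R by apply: archi_boundP; exact: sqr_ge0.
have fK : \forall m \near \oo, (K <= f m)%N := foo _ (nbhs_infty_ge K).
apply: filterS fK => m Km.
have eV : 0 < e^-1 by rewrite invr_gt0.
rewrite sub0r normrN ger0_norm ?invr_ge0// -[leRHS]invrK lef_pV2 ?posrE//.
  rewrite -(ger0_norm (ltW eV)) -sqrtr_sqr ler_wsqrtr// (le_trans (ltW KE))//.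
  by rewrite ler_nat.
by rewrite sqrtr_gt0 (lt_le_trans (lt_trans _ KE)) ?exprn_gt0// ler_nat.
Qed.

Lemma heat_cvg (b a : R) (t : nat -> R) : 0 < b -> t m @[m --> \oo] --> (1 : R) ->
  heat b a (t m) 0 @[m --> \oo] --> heat b a 1 0.
Proof.
move=> b0 t1; rewrite heat_at0; under eq_fun do rewrite heat_at0.
have D0 : 0 < 1 + 2 * b * 1 by rewrite mulr1 ltr_wpDr// mulr_ge0// ltW.
have Dc : 1 + 2 * b * t m @[m --> \oo] --> (1 + 2 * b * 1 : R).
  by apply: cvgD; [exact: cvg_cst|apply: cvgM; [exact: cvg_cst|]].
apply: cvgM.
  apply: cvgV; first by rewrite gt_eqF// sqrtr_gt0.
  by apply: (@continuous_cvg _ _ _ _ _ _ (Num.sqrt : R -> R)); [exact: sqrt_continuous|].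
apply: (@continuous_cvg _ _ _ _ _ _ (@expR R)); first exact: continuous_expR.
apply: cvgM; first by apply: cvgM => //; exact: cvg_cst.
apply: cvgV; first by rewrite gt_eqF// mulr_gt0.
by apply: cvgM; [exact: cvg_cst|].
Qed.

(** At eps = 0 the last factor is sqrt (1 + 2 lam) and cancels one of the q + 1 others: this is the
    lost degree of freedom. *)
Lemma penalized_limit_cvg (lam : R) q : 0 < lam ->
  (Num.sqrt (1 + 2 * (lam + eps)))^-1 ^+ q.+1 *
  (Num.sqrt ((1 + 2 * eps) / (1 + 2 * (lam + eps))))^-1 @[eps --> (0 : R)] -->
  (Num.sqrt (1 + 2 * lam))^-1 ^+ q.
Proof.
move=> l0.
have D0 : 0 < 1 + 2 * lam by rewrite ltr_wpDr// mulr_ge0// ltW.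
have s0 : Num.sqrt (1 + 2 * lam) != 0 by rewrite gt_eqF// sqrtr_gt0.
have -> : (Num.sqrt (1 + 2 * lam))^-1 ^+ q = (Num.sqrt (1 + 2 * (lam + 0)))^-1 ^+ q.+1 *
    (Num.sqrt ((1 + 2 * 0) / (1 + 2 * (lam + 0))))^-1.
  rewrite mulr0 !addr0 mul1r sqrtrV ?ltW// invrK exprSr -mulrA mulVf// mulr1.
  by [].
have Dc : 1 + 2 * (lam + eps) @[eps --> (0 : R)] --> (1 + 2 * (lam + 0) : R).
  apply: cvgD; first exact: cvg_cst.
  apply: cvgM; first exact: cvg_cst.
  by apply: cvgD; [exact: cvg_cst|exact: cvg_id].
have Nc : 1 + 2 * eps @[eps --> (0 : R)] --> (1 + 2 * 0 : R).
  apply: cvgD; first exact: cvg_cst.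
  by apply: cvgM; [exact: cvg_cst|exact: cvg_id].
apply: cvgM.
  apply: (@continuous_cvg _ _ _ _ _ _ (fun x : R => x ^+ q.+1)); first exact: exprn_continuous.
  apply: cvgV; first by rewrite addr0.
  by apply: (@continuous_cvg _ _ _ _ _ _ (Num.sqrt : R -> R)); [exact: sqrt_continuous|].
apply: cvgV.
  by rewrite mulr0 !addr0 mul1r sqrtrV ?invr_eq0// ltW.
apply: (@continuous_cvg _ _ _ _ _ _ (Num.sqrt : R -> R)); first exact: sqrt_continuous.
by apply: cvgM => //; apply: cvgV => //; rewrite addr0 gt_eqF.
Qed.

End limits.

(** * Null distribution *)

Lemma expRN_lip (R : realType) (u v : R) : 0 <= u -> 0 <= v ->
  `|expR (- u) - expR (- v)| <= `|u - v|.
Proof.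
wlog uv : u v / u <= v => [hw|] u0 v0.
  have [uv|vu] := leP u v; first exact: hw.
  by rewrite distrC [leRHS]distrC; apply: hw => //; exact: ltW.
rewrite ger0_norm; last by rewrite subr_ge0 ler_expR lerN2.
rewrite distrC ger0_norm ?subr_ge0//.
have -> : expR (- v) = expR (- u) * expR (- (v - u)) by rewrite -expRD; congr expR; ring.
have h1 := expR_ge1Dx (- (v - u)).
have h2 : expR (- u) <= 1 by rewrite expR_le1 oppr_le0.
have h3 := expR_ge0 (- u).
have h4 : 0 <= v - u by rewrite subr_ge0.
move: h1 h2 h3 h4; clear; move: (v - u) => c; move: (expR (- c)) (expR (- u)) => a b; nra.
Qed.

Section one_stage_laplace.
Context (R : realType) (p q : nat) (n : 'I_q.+1 -> nat) (mu : 'I_q.+1 -> 'cV[R]_p).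
Variables (A0 Sigma1 : 'M[R]_p).
Hypotheses (p0 : (0 < p)%N) (n0 : forall k, (0 < n k)%N).
Hypotheses (uA0 : A0 \in unitmx) (A0E : A0 *m A0^T = Sigma1).
Context d (T : measurableType d) (P : probability T R).
Variable X : forall k : 'I_q.+1, 'I_(n k).+1 -> {RV P >-> p.-tuple R}.

Let sum_sqr_ge0 (I : finType) (F : I -> R) : 0 <= \sum_i F i ^+ 2.
Proof. by apply: sumr_ge0 => i _; rewrite sqr_ge0. Qed.

Lemma deviation_ge0 w : 0 <= deviation mu A0 X w.
Proof. by apply: sumr_ge0 => k _; rewrite divr_ge0// addr_ge0// sumr_ge0. Qed.

Lemma deviation_coord w (B : R) : 0 <= B -> deviation mu A0 X w <= B ^+ 2 ->
  let y k (i : 'I_(n k).+1) a := std_coord A0 (mu k) (@X k i w) a in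
  (forall k a b, `|\sum_i (y k i a * y k i b - (a == b)%:R)| <= B * Num.sqrt (n k)%:R) /\
  (forall k a, `|\sum_i y k i a| <= B * Num.sqrt (n k)%:R).
Proof.
move=> B0 dB y.
have main k (z : R) : z ^+ 2 <= \sum_a \sum_b (\sum_i (y k i a * y k i b - (a == b)%:R)) ^+ 2 +
      \sum_a (\sum_i y k i a) ^+ 2 -> `|z| <= B * Num.sqrt (n k)%:R.
  move=> hz; have nk : 0 < (n k)%:R :> R by rewrite ltr0n.
  rewrite -(ger0_norm B0) -(ger0_norm (sqrtr_ge0 (n k)%:R)) -normrM.
  rewrite -ler_sqr ?nnegrE// !real_normK ?num_real// exprMn sqr_sqrtr ?(ltW nk)//.
  rewrite (le_trans hz)// -ler_pdivrMr// (le_trans _ dB)// /deviation (bigD1 k)//= lerDl.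
  by apply: sumr_ge0 => j _; rewrite divr_ge0// addr_ge0// sumr_ge0.
split=> [k a b|k a]; apply: main.
  rewrite (bigD1 a)//= (bigD1 b)//= -!addrA lerDl !addr_ge0//.
  - by apply: sumr_ge0 => c _; rewrite sqr_ge0.
  - by apply: sumr_ge0 => c _; exact: sum_sqr_ge0.
rewrite [X in _ + X](bigD1 a)//= addrCA lerDl addr_ge0//.
  by apply: sumr_ge0 => c _; exact: sum_sqr_ge0.
by apply: sumr_ge0 => c _; rewrite sqr_ge0.
Qed.

Lemma measurable_std_trace k : measurable_fun setT (std_trace mu A0 X k).
Proof.
apply: measurable_funM => //; apply: measurable_sum_cond => i _.
apply: measurable_funB => //; apply: measurableT_comp => //; exact: measurable_std_quad.
Qed.

Lemma std_trace_le w (B : R) : 0 <= B -> deviation mu A0 X w <= B ^+ 2 ->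
  forall k, `|std_trace mu A0 X k w| <= p%:R * B.
Proof.
move=> B0 /(deviation_coord B0)[hab _] k.
apply: (@std_sum_bound _ _ A0 (n k) (fun i => col_of_tuple (@X k i w)) (mu k)) => // a.
have := hab k a a; rewrite eqxx /std_coord.
by under eq_bigr do rewrite -expr2.
Qed.

Hypothesis hX : forall k i, multivariate_normal (mu k) Sigma1 (@X k i).
Hypothesis hind : mutually_independent P
  (fun s : {k : 'I_q.+1 & 'I_(n k).+1} => X (tagged s) : T -> _).
Variable r : 'I_q.+1 -> R.
Hypotheses (r0 : forall k, 0 < r k) (r1 : \sum_k r k = 1).

(** Where the deviation is at most B^2, [eta] pays for the approximation and [eps] for the penalty;
    elsewhere the exponentials differ by at most 1, which the mean of the deviation pays for. The
    absolute value makes the first exponential at most 1 at every outcome. *)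
Lemma laplace_penalized_close (Stat : T -> R) (B lam eps eta : R) :
  0 < B -> 0 <= lam -> 0 <= eps -> 0 <= eta -> measurable_fun setT Stat ->
  {ae P, forall w, deviation mu A0 X w <= B ^+ 2 ->
    `|Stat w - quad_stat r (fun k => std_trace mu A0 X k w)| <= eta} ->
  `|EE P (fun w => expR (- lam * `|Stat w|)) -
    EE P (fun w => penalized_exp (fun k => Num.sqrt (r k)) lam eps
      (fun k => std_trace mu A0 X k w))| <=
  lam * eta + eps * (q.+1%:R * (p%:R * B) ^+ 2) +
  (B ^+ 2)^-1 * (q.+1%:R * ((p%:R ^+ 2 + p%:R) * (2 * rot_bound R p))).
Proof.
move=> B0 lam0 eps0 eta0 mS hae.
have B2 : 0 < B ^+ 2 by rewrite exprn_gt0.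
have [iD ED] := deviation_bound p0 n0 uA0 A0E hX hind.
pose Y w k := std_trace mu A0 X k w.
pose v w := lam * quad_stat r (Y w) + eps * \sum_k Y w k ^+ 2.
have v0 w : 0 <= v w.
  by rewrite addr_ge0// mulr_ge0//; exact: (quad_stat_ge0 p0 r0 r1).
have penE w : penalized_exp (fun k => Num.sqrt (r k)) lam eps (Y w) = expR (- v w).
  by rewrite /penalized_exp /v /quad_stat opprD mulNr.
have mY k : measurable_fun setT (fun w => Y w k) by exact: measurable_std_trace.
have mv : measurable_fun setT v.
  apply: measurable_funD; apply: measurable_funM => //.
    apply: measurable_funB; first by apply: measurable_sum_cond => k _; exact: measurable_funX.
    by apply: measurable_funX; apply: measurable_sum_cond => k _; exact: measurable_funM.
  by apply: measurable_sum_cond => k _; exact: measurable_funX.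
rewrite (_ : (fun w => penalized_exp _ _ _ _) = fun w => expR (- v w)); last first.
  by apply/funext => w; rewrite -penE.
have iexp (f : T -> R) : measurable_fun setT f -> (forall w, 0 <= f w) ->
    integ P (fun w => expR (- f w)).
  move=> mf f0; apply: (@integ_bounded _ _ _ _ _ 1).
    by apply: measurableT_comp => //; exact: measurableT_comp.
  by move=> w; rewrite ger0_norm ?expR_ge0// expR_le1 oppr_le0.
have mu0 : measurable_fun setT (fun w => lam * `|Stat w|).
  by apply: measurable_funM => //; exact: measurableT_comp.
have u0 w : 0 <= lam * `|Stat w| by rewrite mulr_ge0.
have i1 := iexp _ mu0 u0; have i2 := iexp _ mv v0.
rewrite (_ : (fun w => expR (- lam * `|Stat w|)) = fun w => expR (- (lam * `|Stat w|))); last first.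
  by apply/funext => w; rewrite mulNr.
rewrite -EEB//; set K := lam * eta + _.
have K0 : 0 <= K by apply: addr_ge0; rewrite mulr_ge0// mulr_ge0// sqr_ge0.
(* Dominates the difference at almost every outcome: where the deviation exceeds B^2, the second
   term exceeds 1. *)
pose g w := K + (B ^+ 2)^-1 * deviation mu A0 X w.
have iZ := integZ (B ^+ 2)^-1 iD.
have ig : integ P g by exact: (integD (integ_cst P K) iZ).
have gE : EE P g <= K + (B ^+ 2)^-1 * (q.+1%:R * ((p%:R ^+ 2 + p%:R) * (2 * rot_bound R p))).
  rewrite (EED (integ_cst P K) iZ) EE_cst EEZ// lerD2l ler_wpM2l// invr_ge0 ltW//.
apply: le_trans gE; apply: EE_ae_norm_le => //.
- exact: integB.
- by move=> w; rewrite addr_ge0// mulr_ge0 ?invr_ge0 ?(ltW B2)// deviation_ge0.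
apply: filterS hae => w hw.
have [dB|dB] := leP (deviation mu A0 X w) (B ^+ 2); last first.
  apply: (@le_trans _ _ 1).
    have e1 := expR_ge0 (- (lam * `|Stat w|)); have e2 := expR_ge0 (- v w).
    have e3 : expR (- (lam * `|Stat w|)) <= 1 by rewrite expR_le1 oppr_le0.
    have e4 : expR (- v w) <= 1 by rewrite expR_le1 oppr_le0.
    by move: e1 e2 e3 e4; clear; move: (expR (- v w)) (expR _) => a b *; rewrite ler_norml; lra.
  by rewrite /g ler_wpDl// mulrC ler_pdivlMr// mul1r ltW.
rewrite (le_trans (expRN_lip (u0 w) (v0 w)))//.
apply: (@le_trans _ _ K); last first.
  by rewrite /g lerDl mulr_ge0 ?invr_ge0 ?(ltW B2)// deviation_ge0.
rewrite /v opprD addrA -mulrBr (le_trans (ler_normB _ _))// /K lerD//.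
  rewrite normrM (ger0_norm lam0) ler_wpM2l//.
  have Q0 : 0 <= quad_stat r (Y w) by exact: (quad_stat_ge0 p0 r0 r1).
  by rewrite -{1}(ger0_norm Q0) (le_trans (ler_dist_dist _ _))// hw.
rewrite normrM (ger0_norm eps0) ler_wpM2l// ger0_norm//.
apply: ler_sum_ord => k; rewrite -real_normK ?num_real// lerXn2r ?nnegrE ?mulr_ge0 ?(ltW B0)//.
by apply: std_trace_le => //; exact: ltW.
Qed.

End one_stage_laplace.

Section null_distribution.
Context (R : realType) (p q : nat) (mu : 'I_q.+1 -> 'cV[R]_p) (A0 Sigma1 : 'M[R]_p).
Hypotheses (p0 : (0 < p)%N) (uA0 : A0 \in unitmx) (A0E : A0 *m A0^T = Sigma1).
Variables (n : nat -> 'I_q.+1 -> nat) (r : 'I_q.+1 -> R).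
Hypotheses (n0 : forall m k, (0 < n m k)%N)
  (rE : forall m k, r k = (n m k)%:R / (nplus (n m))%:R)
  (noo : nplus (n m) @[m --> \oo] --> \oo).

Let N0 m : 0 < (nplus (n m))%:R :> R.
Proof. by rewrite ltr0n /nplus big_ord_recl addn_gt0 n0. Qed.

Lemma proportion_gt0 k : 0 < r k.
Proof. by rewrite (rE 0) divr_gt0// ltr0n. Qed.

Lemma sum_proportion : \sum_k r k = 1.
Proof.
under eq_bigr do rewrite (rE 0).
by rewrite -mulr_suml -natr_sum -/(nplus (n 0)) mulfV ?gt_eqF.
Qed.

Lemma proportionM m k : r k * (nplus (n m))%:R = (n m k)%:R.
Proof. by rewrite (rE m k) divfK ?gt_eqF. Qed.

Lemma sample_invsqrt_cvg0 k : (Num.sqrt (n m k)%:R)^-1 @[m --> \oo] --> (0 : R).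
Proof.
rewrite (_ : (fun m => _) = fun m => (Num.sqrt (r k))^-1 * (Num.sqrt (nplus (n m))%:R)^-1).
  by apply: cvg0Ml; exact: invsqrt_cvg0.
by apply/funext => m; rewrite -invfM -sqrtrM ?proportionM// ltW// proportion_gt0.
Qed.

Context (d : nat -> measure_display) (T : forall m, measurableType (d m)).
Variables (P : forall m, probability (T m) R)
  (X : forall m (k : 'I_q.+1), 'I_(n m k).+1 -> {RV (P m) >-> p.-tuple R}).
Hypothesis hX : forall m k i, multivariate_normal (mu k) Sigma1 (@X m k i).
Hypothesis hind : forall m, mutually_independent (P m)
  (fun s : {k : 'I_q.+1 & 'I_(n m k).+1} => X (tagged s) : T m -> _).

Lemma std_trace_mgf_cvg (b : R) (a : 'I_q.+1 -> R) : 0 < b ->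
  EE (P m) (fun w => \prod_j expR (- b * std_trace mu A0 (@X m) j w ^+ 2 +
    a j * std_trace mu A0 (@X m) j w)) @[m --> \oo] --> \prod_j heat b (a j) 1 0.
Proof.
move=> b0; set f := fun m => _.
pose g m := \prod_j heat b (a j) ((n m j).+1%:R / (n m j)%:R) 0.
have gc : g m @[m --> \oo] --> \prod_j heat b (a j) 1 0.
  apply: cvg_big => [|j _]; first exact: mul_continuous.
  apply: (@heat_cvg _ b (a j) (fun m => (n m j).+1%:R / (n m j)%:R)) => //.
  rewrite (_ : (fun m => _) = fun m => 1 + (Num.sqrt (n m j)%:R)^-1 * (Num.sqrt (n m j)%:R)^-1).
    rewrite -[X in _ --> X]addr0; apply: cvgD; first exact: cvg_cst.
    rewrite -[X in _ --> X](mulr0 (0 : R)).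
    by apply: cvgM; exact: sample_invsqrt_cvg0.
  apply/funext => m; have nm : 0 < (n m j)%:R :> R by rewrite ltr0n.
  rewrite -invfM -expr2 sqr_sqrtr ?ltW// -natr1 mulrDl mulfV ?gt_eqF//.
  by rewrite mul1r.
rewrite (_ : f = fun m => (f m - g m) + g m); last by apply/funext => m; rewrite subrK.
rewrite -[X in _ --> X]add0r; apply: cvgD => //.
pose u m : R := chain_const a b * (p%:R ^+ 4 * sqr1_cube R + gauss_abs3 R) *
  \sum_j 2 * (Num.sqrt (n m j)%:R)^-1.
have uc : u m @[m --> \oo] --> (0 : R).
  apply: cvg0Ml; rewrite [X in _ --> X](_ : 0 = \sum_(j < q.+1) 0); last by rewrite big1.
  apply: (@cvg_big _ _ _ _ _ _ _ _ _ _ (fun=> 0)) => [|j _]; first exact: add_continuous.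
  by apply: cvg0Ml; exact: sample_invsqrt_cvg0.
apply/cvgrPdist_le => e e0; have /cvgrPdist_le/(_ _ e0) := uc.
apply: filterS => m; rewrite !sub0r !normrN => ue.
apply: (le_trans (std_trace_lindeberg p0 (n0 m) uA0 A0E (@hX m) (@hind m) a b0)).
exact: le_trans (ler_norm _) ue.
Qed.

Variables (S : forall m, T m -> 'I_q.+1 -> 'M[R]_p) (chat : forall m, 'I_q -> {RV (P m) >-> R}).
Arguments S : clear implicits.
Hypothesis hS : forall m w k, S m w k = sample_cov (fun i => col_of_tuple (@X m k i w)).
Hypothesis hmle : \forall m \near \oo, {ae P m, forall w,
  is_mle_c (n m) (S m w) (\col_j @chat m j w)}.

Let Stat m w := statistic p r (nplus (n m)) (\col_j @chat m j w).

Lemma measurable_mle_statistic m : measurable_fun setT (@Stat m).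
Proof. by apply: measurable_statistic => j; exact: measurable_funP. Qed.

Lemma mle_statistic_laplace_cvg (lam : R) : 0 < lam ->
  EE (P m) (fun w => expR (- lam * `|Stat w|)) @[m --> \oo] --> (Num.sqrt (1 + 2 * lam))^-1 ^+ q.
Proof.
move=> l0; apply/cvgrPdist_le => z z0.
(* Five errors: Markov-type bound, penalty, approximation of the statistic, limit in m, limit in
   eps. [B] is chosen first, then [eps] and [eta], and only then the stage m. *)
have z5 : 0 < z / 5 by rewrite divr_gt0.
pose C : R := q.+1%:R * ((p%:R ^+ 2 + p%:R) * (2 * rot_bound R p)).
have C0 : 0 <= C.
  rewrite !mulr_ge0 ?addr_ge0 ?exprn_ge0// mulr_ge0// exprn_ge0//.
pose B : R := C / (z / 5) + 1.
have B1 : 1 <= B by rewrite lerDr divr_ge0// ltW.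
have B0 : 0 < B by rewrite (lt_le_trans _ B1).
have CB : (B ^+ 2)^-1 * C <= z / 5.
  rewrite mulrC ler_pdivrMr ?exprn_gt0// mulrC -ler_pdivrMr//.
  by apply: (@le_trans _ _ B); [rewrite lerDl|rewrite expr2 ler_peMl// ltW].
pose K : R := q.+1%:R * (p%:R * B) ^+ 2.
have K0 : 0 <= K by rewrite mulr_ge0// sqr_ge0.
have K1 : 0 < K + 1 by rewrite ltr_wpDl.
have /cvgrPdist_le/(_ _ z5) := @penalized_limit_cvg R lam q l0.
move=> /nbhs_ballP[del /= del0 hdel].
pose eps : R := Num.min (del / 2) (z / 5 / (K + 1)).
have eps0 : 0 < eps by rewrite lt_min !divr_gt0.
have {}hdel := hdel eps.
have /hdel {}hdel : ball (0 : R) del eps.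
  rewrite /ball /= sub0r normrN gtr0_norm// (@le_lt_trans _ _ (del / 2)) ?ge_min ?lexx//.
  by rewrite ltr_pdivrMr// ltr_pMr// ltr1n.
have eK : eps * K <= z / 5.
  apply: (@le_trans _ _ (z / 5 / (K + 1) * (K + 1))); last by rewrite divfK// gt_eqF.
  by rewrite ler_pM ?ge_min ?lexx ?orbT ?lerDl// ltW.
pose eta : R := z / 5 / lam.
have eta0 : 0 < eta by rewrite divr_gt0.
have le : lam * eta = z / 5 by rewrite mulrC divfK// gt_eqF.
have [e0 e00 close] := statistic_quad_stat p0 proportion_gt0 sum_proportion (ltW B0) eta0.
have /cvgrPdist_le/(_ _ e00) ne := @invsqrt_cvg0 R _ noo.
have s1 : \sum_k Num.sqrt (r k) ^+ 2 = 1.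
  rewrite -[RHS]sum_proportion; apply: eq_bigr => k _.
  by rewrite sqr_sqrtr// ltW// proportion_gt0.
have pen := @penalized_exp_cvg R _ (fun k => Num.sqrt (r k)) lam eps s1 d T P
  (fun m k => std_trace mu A0 (@X m) k) (ltW l0) eps0
  (fun m k => measurable_std_trace mu A0 (@X m) k)
  (fun a => @std_trace_mgf_cvg _ a (addr_gt0 l0 eps0)).
rewrite card_ord in pen.
have /cvgrPdist_le/(_ _ z5) npen := pen.
apply: filterS3 ne hmle npen => m nm mm pm.
have hae : {ae P m, forall w, deviation mu A0 (@X m) w <= B ^+ 2 ->
    `|Stat w - quad_stat r (fun k => std_trace mu A0 (@X m) k w)| <= eta}.
  apply: filterS mm => w [Sigma mle] dB.
  have [hab ha] := deviation_coord (n0 m) (ltW B0) dB.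
  apply: (close A0 (n m) mu (fun k i => col_of_tuple (@X m k i w)) _ Sigma) => //.
  - exact: proportionM.
  - by move: nm; rewrite sub0r normrN ger0_norm// invr_ge0.
  - by rewrite (_ : (fun k => _) = S m w)//; apply/funext => k; rewrite hS.
have := laplace_penalized_close p0 (n0 m) uA0 A0E (@hX m) (@hind m) proportion_gt0
  sum_proportion B0 (ltW l0) (ltW eps0) (ltW eta0) (@measurable_mle_statistic m) hae.
rewrite le -/C -/K => hclose.
move: hdel pm hclose CB eK => /= h1 h2 h3 h4 h5.
rewrite ler_norml; move: h1 h2 h3; rewrite !ler_norml => /andP[a1 a2] /andP[b1 b2] /andP[c1 c2].
by apply/andP; split; lra.
Qed.

Lemma mle_statistic_ge0 m w : is_mle_c (n m) (S m w) (\col_j @chat m j w) -> 0 <= Stat w.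
Proof.
move=> [Sigma [[c0 _] _]]; rewrite /Stat statistic_wvar; last 2 first.
- exact: sum_proportion.
- by move=> j; rewrite gt_eqF.
rewrite mulr_ge0// ?divr_ge0// ?mulr_ge0//; apply: wvar_ge0; first exact: sum_proportion.
by move=> k; rewrite ltW// proportion_gt0.
Qed.

(** The Laplace criterion is applied to [|Stat|], nonnegative at every outcome; at late stages it
    equals [Stat] almost surely, so the distribution functions coincide. *)
Lemma mle_statistic_cvg_chi_squared : cvg_in_distribution P Stat (chi_squared R q).
Proof.
have mabs m : measurable_fun setT (fun w => `|@Stat m w|).
  by apply: measurableT_comp => //; exact: measurable_mle_statistic.
have := @laplace_cvg_in_distribution R d T P (fun m w => `|@Stat m w|) (chi_squared R q) mabs
  (fun m w => normr_ge0 _) (chi_squared_lt0 R q).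
move=> h x cx; apply: cvg_trans (h _ x cx).
  apply: near_eq_cvg; apply: filterS hmle => m mm.
  apply/esym/ae_eq_sublevel => //; first exact: measurable_mle_statistic.
  by apply: filterS mm => w /mle_statistic_ge0 s0; rewrite ger0_norm.
move=> lam l0; rewrite chi_squared_laplace_norm//; exact: mle_statistic_laplace_cvg.
Qed.

End null_distribution.

Theorem mainTheorem4 (R : realType) (p q : nat) (hp : (1 <= p)%N) (hq : (1 <= q)%N)
  (* model parameters *)
  (mu : 'I_q.+1 -> 'cV[R]_p) (c : 'cV[R]_q) (Sigma1 : 'M[R]_p)
  (hparam : prop_param c Sigma1)
  (* degrees of freedom: at stage m, population k has sample size (n m k).+1 *)
  (n : nat -> 'I_q.+1 -> nat) (hn : forall m k, (0 < n m k)%N)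
  (r : 'I_q.+1 -> R)
  (hr : forall m k, r k = (n m k)%:R / (nplus (n m))%:R)
  (hninfty : nplus (n m) @[m --> \oo] --> \oo)
  (* independent normal samples *)
  (d : nat -> measure_display) (T : forall m, measurableType (d m))
  (P : forall m, probability (T m) R)
  (X : forall m (k : 'I_q.+1), 'I_(n m k).+1 -> {RV (P m) >-> p.-tuple R})
  (hX : forall m k i, multivariate_normal (mu k) (prop_cov c Sigma1 k) (X m k i))
  (hind : forall m, mutually_independent (P m)
     (fun (s : {k : 'I_q.+1 & 'I_(n m k).+1}) => X m (tag s) (tagged s) : T m -> _))
  (S : forall m, T m -> 'I_q.+1 -> 'M[R]_p)
  (hS : forall m w k, S m w k = sample_cov (fun i => col_of_tuple (X m k i w)))
  (* maximum likelihood estimators of c_2, ..., c_K *)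
  (chat : forall m, 'I_q -> {RV (P m) >-> R})
  (hmle : \forall m \near \oo, {ae P m, forall w,
     is_mle_c (n m) (S m w) (\col_j chat m j w)}) :
  (forall m w, is_mle_c (n m) (S m w) (\col_j chat m j w) ->
     statistic p r (nplus (n m)) (\col_j chat m j w) =
     (nplus (n m))%:R * p%:R / 2 *
       (\sum_k r k / with_c1 (\col_j chat m j w) k ^+ 2
        - (\sum_k r k / with_c1 (\col_j chat m j w) k) ^+ 2))
  /\
  ((forall j, c j 0 = 1) ->
     cvg_in_distribution P
       (fun m w => statistic p r (nplus (n m)) (\col_j chat m j w))
       (chi_squared R q)).
Proof.
split=> [m w [Sigma [[c0 _] _]]|c1].
  rewrite statistic_wvar; last 2 first.
  - exact: sum_proportion hn hr.
  - by move=> j; rewrite gt_eqF.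
  by congr (_ * (_ - _)); apply: eq_bigr => k _; rewrite exprVn.
have [_ pS] := hparam.
(* Whitening works with any invertible factor of [Sigma1]; the Cholesky factor supplies one. *)
have [L [_ _ LE]] := cholesky pS.
have uL : L \in unitmx.
  have : Sigma1 \in unitmx by exact: posdef_unitmx.
  by rewrite LE unitmx_mul => /andP[].
have covE k : prop_cov c Sigma1 k = Sigma1.
  rewrite /prop_cov /with_c1; case: unlift => [j|]; last by rewrite scale1r.
  by rewrite c1 scale1r.
have hX1 m k i : multivariate_normal (mu k) Sigma1 (X m k i) by rewrite -(covE k).
exact: (mle_statistic_cvg_chi_squared hp uL (esym LE) hn hr hninfty hX1 hind hS hmle).
Qed.
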